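(* Let $g:\mathbb{R}^d\to\mathbb{C}$ be a continuous symbol function whose real part satisfies $g_R\ge\kappa$ for some $\kappa>0$, and let $X\in\mathscr{V}'(\mathbb{R}^d\times\mathbb{R})\cap(\mathscr{V}(\mathbb{R}^d)\widehat{\boxtimes}C_{FD}(\mathbb{R}))'$. Let $$U^\infty=\mathscr{F}^{-1}\left(\frac{1}{i\omega+g(\xi)}\mathscr{F}(X)\right),$$ which is the unique solution in $\mathscr{V}'(\mathbb{R}^d\times\mathbb{R})$ of $\frac{\partial U}{\partial t}+\mathcal{L}_gU=X$. Then $U^\infty$ has a càdlàg-in-time representation.
   Context: Here $d\ge1$, $\mathbb{N}=\{0,1,2,\dots\}$; $(x,t)$ denotes physical space-time variables and $(\xi,\omega)$ the dual frequency variables. A symbol function is a measurable, polynomially bounded function $g:\mathbb{R}^d\to\mathbb{C}$ that is Hermitian (real part $g_R$ even, imaginary part odd). For $n\ge1$, $\mathscr{M}(\mathbb{R}^n)$ is the space of complex Radon measures ($\sigma$-additive complex functions on bounded Borel sets), and $\mathscr{M}_{SG}(\mathbb{R}^n)\subset\mathscr{S}'(\mathbb{R}^n)$ the space of slow-growing ones, i.e. those with $\int(1+|x|^2)^{-N}d|\mu|(x)<\infty$ for some $N\in\mathbb{N}$. For measurable polynomially bounded $f$, $f\mu$ is the measure $A\mapsto\int_Af\,d\mu$. $C_{FD}(\mathbb{R}^n)$: continuous $\varphi:\mathbb{R}^n\to\mathbb{C}$ with $\sup_x|(1+|x|^2)^N\varphi(x)|<\infty$ for all $N\in\mathbb{N}$.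 The Fourier transform on $\mathbb{R}^n$ is $\mathscr{F}(\varphi)(\xi)=(2\pi)^{-n/2}\int e^{-i\xi^Tx}\varphi(x)dx$, extended to tempered distributions by duality; on $\mathbb{R}^d\times\mathbb{R}$, $\mathscr{F}$ is the full space-time Fourier transform and $\mathscr{F}_S$ the Fourier transform in the space variable only, $\mathscr{F}_S(\psi)(\xi,t)=(2\pi)^{-d/2}\int_{\mathbb{R}^d}e^{-i\xi^Tx}\psi(x,t)dx$ (extended by duality). $\mathscr{V}(\mathbb{R}^n)=\mathscr{F}(C_{FD}(\mathbb{R}^n))$, with dual $\mathscr{V}'(\mathbb{R}^n)=\mathscr{F}(\mathscr{M}_{SG}(\mathbb{R}^n))$, the tempered distributions whose Fourier transform is a slow-growing measure (used with $n=d$ and $n=d+1$). $(\mathscr{V}(\mathbb{R}^d)\widehat{\boxtimes}C_{FD}(\mathbb{R}))'=\mathscr{F}_S(\mathscr{M}_{SG}(\mathbb{R}^d\times\mathbb{R}))$ is the space of tempered distributions on $\mathbb{R}^d\times\mathbb{R}$ whose spatial Fourier transform is a slow-growing measure; it is the dual of $\mathscr{V}(\mathbb{R}^d)\widehat{\boxtimes}C_{FD}(\mathbb{R}):=\mathscr{F}_S(C_{FD}(\mathbb{R}^d\times\mathbb{R}))$. The equation's operator $\frac{\partial}{\partial t}+\mathcal{L}_g$, with $\mathcal{L}_g=\mathscr{F}_S^{-1}(g\mathscr{F}_S(\cdot))$, is understood on $\mathscr{V}'(\mathbb{R}^d\times\mathbb{R})$ as $\mathscr{F}^{-1}((i\omega+g(\xi))\mathscr{F}(\cdot))$.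 When $g$ is a continuous symbol function with $g_R\ge\kappa$ for some $\kappa>0$ and $X\in\mathscr{V}'(\mathbb{R}^d\times\mathbb{R})\cap(\mathscr{V}(\mathbb{R}^d)\widehat{\boxtimes}C_{FD}(\mathbb{R}))'$, the distribution $U^\infty=\mathscr{F}^{-1}\left(\frac{1}{i\omega+g(\xi)}\mathscr{F}(X)\right)$ belongs to $\mathscr{V}'(\mathbb{R}^d\times\mathbb{R})\cap(\mathscr{V}(\mathbb{R}^d)\widehat{\boxtimes}C_{FD}(\mathbb{R}))'$. Càdlàg-in-time representation: with $(\varphi\boxtimes\theta)(x,t)=\varphi(x)\theta(t)$, $T\in(\mathscr{V}(\mathbb{R}^d)\widehat{\boxtimes}C_{FD}(\mathbb{R}))'$ has a càdlàg-in-time representation if there is a family $(T_t)_{t\in\mathbb{R}}\subset\mathscr{V}'(\mathbb{R}^d)$ such that for all $\varphi\in\mathscr{V}(\mathbb{R}^d)$ the function $t\mapsto\langle T_t,\varphi\rangle$ is càdlàg (right-continuous with left limits) and defines (as a density) a slow-growing measure over $\mathbb{R}$, and $\langle T,\varphi\boxtimes\theta\rangle=\int_{\mathbb{R}}\langle T_t,\varphi\rangle\theta(t)dt$ for all $\varphi\in\mathscr{V}(\mathbb{R}^d)$, $\theta\in C_{FD}(\mathbb{R})$. *)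

(* Defs.v *)
From HB Require Import structures.
From mathcomp Require Import all_boot all_order all_algebra.
From mathcomp Require Import complex.
From mathcomp Require Import all_classical all_reals all_analysis.

Set Implicit Arguments.
Unset Strict Implicit.
Unset Printing Implicit Defensive.

Import Order.TTheory GRing.Theory Num.Theory.
Import numFieldNormedType.Exports.

Local Open Scope classical_set_scope.
Local Open Scope ring_scope.
Local Open Scope complex_scope.

(* R^n is 'rV[R]_n with its Borel sigma-algebra.  R^d x R is 'rV[R]_(d + 1):
   lsubmx is the space (or xi) component and rsubmx the time (or omega) one. *)

Section borel_row_vectors.
Context (R : realType) (n : nat).

HB.instance Definition _ := @isMeasurable.Build
  (sigma_display (@open 'rV[R]_n)) 'rV[R]_n <<s @open 'rV[R]_n >>
  (@sigma_algebra0 _ setT (@open 'rV[R]_n))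
  (@sigma_algebraC _ (@open 'rV[R]_n))
  (@sigma_algebra_bigcup _ setT (@open 'rV[R]_n)).

End borel_row_vectors.

Section functions.
Context {R : realType}.

Definition dotv n (x y : 'rV[R]_n) : R := \sum_(i < n) x ord0 i * y ord0 i.

(* 1 + |x|^2 for the Euclidean norm; the library norm on 'rV is the sup norm. *)
Definition weight n (x : 'rV[R]_n) : R := 1 + dotv x x.

Definition last_coord d (z : 'rV[R]_(d + 1)) : R := rsubmx z ord0 ord0.

Definition cexpi (theta : R) : R[i] := cos theta +i* sin theta.

(* The topology of C is the one of the normed space R[i]^o. *)
Definition ccontinuous n (f : 'rV[R]_n -> R[i]) : Prop :=
  continuous (f : 'rV[R]_n -> R[i]^o).

Definition cmeasurable n (f : 'rV[R]_n -> R[i]) : Prop :=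
  measurable_fun setT (fun x => complex.Re (f x)) /\
  measurable_fun setT (fun x => complex.Im (f x)).

Definition poly_bounded n (f : 'rV[R]_n -> R[i]) : Prop :=
  exists (C : R) (N : nat), forall x, Normc.normc (f x) <= C * weight x ^+ N.

Definition symbol_function n (g : 'rV[R]_n -> R[i]) : Prop :=
  [/\ cmeasurable g, poly_bounded g,
      (forall x, complex.Re (g (- x)) = complex.Re (g x)) &
      (forall x, complex.Im (g (- x)) = - complex.Im (g x))].

Definition CFD n (f : 'rV[R]_n -> R[i]) : Prop :=
  ccontinuous f /\
  forall N, exists C : R, forall x, weight x ^+ N * Normc.normc (f x) <= C.

Definition tensor d (phi : 'rV[R]_d -> R[i]) (theta : R -> R[i]) :
    'rV[R]_(d + 1) -> R[i] :=
  fun z => phi (lsubmx z) * theta (last_coord z).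

Definition cadlag (h : R -> R[i]) : Prop := forall t : R,
  ((h x : R[i]^o) @[x --> t^'+] --> (h t : R[i]^o)) /\
  exists l : R[i]^o, (h x : R[i]^o) @[x --> t^'-] --> l.

End functions.

Section integrals.
Context {R : realType}.

(* [integral] only needs a set function; mu is not required to be bundled as
   a measure because the variations below are defined by suprema. *)
Definition rint d (T : measurableType d) (mu : set T -> \bar R) (f : T -> R) : R :=
  fine (integral mu setT (fun x => (f x)%:E)).

Definition cint d (T : measurableType d) (mu : set T -> \bar R) (f : T -> R[i]) :
    R[i] :=
  rint mu (fun x => complex.Re (f x)) +i* rint mu (fun x => complex.Im (f x)).

(* Lebesgue measure on R^n as the n-fold product of [lebesgue_measure]: the
   product measure of A is the integral of the measures of its sections. *)
Fixpoint lebesgue_rV (n : nat) : set 'rV[R]_n -> \bar R :=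
  match n return set 'rV[R]_n -> \bar R with
  | 0 => fun A => dirac (0 : 'rV[R]_0) A
  | m.+1 => fun A => integral (@lebesgue_measure R) setT
      (fun t : R => lebesgue_rV [set x : 'rV[R]_m | A (row_mx (const_mx t : 'rV[R]_1) x)])
  end.

(* Fourier transforms, F(f)(xi) = (2 pi)^(-n/2) \int e^(-i xi.x) f(x) dx. *)
Definition fourier_cst (n : nat) : R[i] := ((Num.sqrt (2 * pi)) ^- n)%:C.

Definition fourier n (f : 'rV[R]_n -> R[i]) : 'rV[R]_n -> R[i] := fun xi =>
  fourier_cst n * cint (@lebesgue_rV n) (fun x => cexpi (- dotv xi x) * f x).

Definition ifourier n (f : 'rV[R]_n -> R[i]) : 'rV[R]_n -> R[i] := fun x =>
  fourier_cst n * cint (@lebesgue_rV n) (fun xi => cexpi (dotv xi x) * f xi).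

Definition sfourier d (f : 'rV[R]_(d + 1) -> R[i]) : 'rV[R]_(d + 1) -> R[i] :=
  fun z => fourier_cst d * cint (@lebesgue_rV d)
    (fun x => cexpi (- dotv (lsubmx z) x) * f (row_mx x (rsubmx z))).

End integrals.

Section complex_measures.
Context {R : realType} {n : nat}.
Implicit Types (mu : set 'rV[R]_n -> R[i]) (m : set 'rV[R]_n -> R).

Definition bounded_borel (A : set 'rV[R]_n) : Prop :=
  measurable A /\ exists M : R, forall x, A x -> dotv x x <= M.

(* Complex Radon measures: total set functions of which only the values on
   bounded Borel sets are meaningful. *)
Definition complex_radon mu : Prop := forall F : nat -> set 'rV[R]_n,
  (forall k, measurable (F k)) -> trivIset setT F ->
  bounded_borel (\bigcup_k F k) ->
  (fun p => (\sum_(k < p) mu (F k)) : R[i]^o) @ \oo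
    --> (mu (\bigcup_k F k) : R[i]^o).

Definition total_variation mu (A : set 'rV[R]_n) : \bar R :=
  ereal_sup [set v | exists (p : nat) (F : nat -> set 'rV[R]_n),
    [/\ (forall k, bounded_borel (F k)), (forall k, F k `<=` A),
        trivIset setT F & v = (\sum_(k < p) Normc.normc (mu (F k)))%:E]].

(* M_SG(R^n) *)
Definition slow_growing mu : Prop := complex_radon mu /\
  exists N : nat,
    (integral (total_variation mu) setT (fun x => ((weight x) ^- N)%:E) < +oo)%E.

(* Positive part of the Jordan decomposition of a real Radon measure. *)
Definition pos_variation m (A : set 'rV[R]_n) : \bar R :=
  ereal_sup [set (m B)%:E | B in [set B | bounded_borel B /\ B `<=` A]].

Definition signed_int m (f : 'rV[R]_n -> R) : R :=
  rint (pos_variation m) f - rint (pos_variation (fun A => - m A)) f.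

Definition mint mu (f : 'rV[R]_n -> R[i]) : R[i] :=
  let mR := fun A => complex.Re (mu A) in let mI := fun A => complex.Im (mu A) in
  let fR := fun x => complex.Re (f x) in let fI := fun x => complex.Im (f x) in
  (signed_int mR fR - signed_int mI fI) +i* (signed_int mR fI + signed_int mI fR).

(* The measure f mu, A |-> \int_A f dmu. *)
Definition mul_measure (f : 'rV[R]_n -> R[i]) mu : set 'rV[R]_n -> R[i] :=
  fun A => mint mu (fun x => if x \in A then f x else 0).

End complex_measures.

(* h(t) dt, as a measure on R^1. *)
Definition density_measure (R : realType) (h : R -> R[i]) : set 'rV[R]_1 -> R[i] :=
  fun A => cint (@lebesgue_measure R)
    (fun t : R => if (const_mx t : 'rV[R]_1) \in A then h t else 0).

Section tempered_distributions.
Context {R : realType}.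

Definition line_fun n (f : 'rV[R]_n -> R[i]) (j : 'I_n) (x : 'rV[R]_n) :
    R -> R[i] := fun h => f (x + h *: delta_mx ord0 j).

Definition has_partial n (f : 'rV[R]_n -> R[i]) (j : 'I_n) (x : 'rV[R]_n) : Prop :=
  derivable (fun h => complex.Re (line_fun f j x h)) 0 1 /\
  derivable (fun h => complex.Im (line_fun f j x h)) 0 1.

Definition partial n (j : 'I_n) (f : 'rV[R]_n -> R[i]) : 'rV[R]_n -> R[i] :=
  fun x => derive1 (fun h => complex.Re (line_fun f j x h)) 0 +i*
           derive1 (fun h => complex.Im (line_fun f j x h)) 0.

Definition partials n (s : seq 'I_n) (f : 'rV[R]_n -> R[i]) : 'rV[R]_n -> R[i] :=
  foldr (@partial n) f s.

Definition schwartz n (f : 'rV[R]_n -> R[i]) : Prop := forall s : seq 'I_n,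
  [/\ ccontinuous (partials s f),
      (forall j x, has_partial (partials s f) j x) &
      forall N, exists C : R, forall x,
        weight x ^+ N * Normc.normc (partials s f x) <= C].

Definition schwartz_cvg0 n (phi : nat -> 'rV[R]_n -> R[i]) : Prop :=
  forall (s : seq 'I_n) (N : nat) (e : R), 0 < e ->
    \forall k \near \oo,
      forall x, weight x ^+ N * Normc.normc (partials s (phi k) x) <= e.

(* A distribution is a functional on all functions of which only the
   restriction to Schwartz functions is meaningful: [tempered] constrains that
   restriction, and [eq_dist] is the equality of tempered distributions. *)
Definition dist n := ('rV[R]_n -> R[i]) -> R[i].

Definition tempered n (T : dist n) : Prop :=
  (forall (a : R[i]) phi psi, schwartz phi -> schwartz psi ->
     T (fun x => a * phi x + psi x) = a * T phi + T psi) /\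
  (forall phi : nat -> 'rV[R]_n -> R[i],
     (forall k, schwartz (phi k)) -> schwartz_cvg0 phi ->
     (fun k => T (phi k) : R[i]^o) @ \oo --> (0 : R[i]^o)).

Definition eq_dist n (S T : dist n) : Prop := forall phi, schwartz phi -> S phi = T phi.

Definition dist_of_measure n (mu : set 'rV[R]_n -> R[i]) : dist n :=
  fun phi => mint mu phi.

Definition dfourier n (T : dist n) : dist n := fun phi => T (fourier phi).
Definition difourier n (T : dist n) : dist n := fun phi => T (ifourier phi).
Definition dsfourier d (T : dist (d + 1)) : dist (d + 1) := fun phi => T (sfourier phi).

Definition is_fourier_measure n (T : dist n) (mu : set 'rV[R]_n -> R[i]) : Prop :=
  slow_growing mu /\ eq_dist (dfourier T) (dist_of_measure mu).

Definition is_sfourier_measure d (T : dist (d + 1))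
    (mu : set 'rV[R]_(d + 1) -> R[i]) : Prop :=
  slow_growing mu /\ eq_dist (dsfourier T) (dist_of_measure mu).

(* The dual spaces V'(R^n) and (V(R^d) (x) C_FD(R))'. *)
Definition Vdual n (T : dist n) : Prop :=
  tempered T /\ exists mu, is_fourier_measure T mu.

Definition VCdual d (T : dist (d + 1)) : Prop :=
  tempered T /\ exists mu, is_sfourier_measure T mu.

(* F(T) and F_S(T) as measures, for T in Vdual, resp. in VCdual. *)
Definition fourier_measure n (T : dist n) : set 'rV[R]_n -> R[i] :=
  xget (fun=> 0) [set mu | is_fourier_measure T mu].

Definition sfourier_measure d (T : dist (d + 1)) : set 'rV[R]_(d + 1) -> R[i] :=
  xget (fun=> 0) [set mu | is_sfourier_measure T mu].

(* V(R^n) = F(C_FD(R^n)) and V(R^d) (x) C_FD(R) = F_S(C_FD(R^d x R)); F and F_S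
   are injective on C_FD, so the choices of preimages below are determined. *)
Definition Vspace n (phi : 'rV[R]_n -> R[i]) : Prop :=
  exists2 f, CFD f & fourier f = phi.

Definition Vpreimage n (phi : 'rV[R]_n -> R[i]) : 'rV[R]_n -> R[i] :=
  xget (fun=> 0) [set f | CFD f /\ fourier f = phi].

Definition VCpreimage d (psi : 'rV[R]_(d + 1) -> R[i]) : 'rV[R]_(d + 1) -> R[i] :=
  xget (fun=> 0) [set f | CFD f /\ sfourier f = psi].

(* <T, F f> = <F T, f> = \int f d(F T), and likewise with F_S. *)
Definition Vpairing n (T : dist n) (phi : 'rV[R]_n -> R[i]) : R[i] :=
  mint (fourier_measure T) (Vpreimage phi).

Definition VCpairing d (T : dist (d + 1)) (psi : 'rV[R]_(d + 1) -> R[i]) : R[i] :=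
  mint (sfourier_measure T) (VCpreimage psi).

(* F^-1 (a F(T)) for T in V'(R^n). *)
Definition multiplier n (a : 'rV[R]_n -> R[i]) (T : dist n) : dist n :=
  difourier (dist_of_measure (mul_measure a (fourier_measure T))).

(* i omega + g(xi), the symbol of d/dt + L_g. *)
Definition evolution_symbol d (g : 'rV[R]_d -> R[i]) : 'rV[R]_(d + 1) -> R[i] :=
  fun z => (0 +i* last_coord z) + g (lsubmx z).

Definition evolution_operator d (g : 'rV[R]_d -> R[i]) (U : dist (d + 1)) :
    dist (d + 1) := multiplier (evolution_symbol g) U.

Definition Uinfty d (g : 'rV[R]_d -> R[i]) (X : dist (d + 1)) : dist (d + 1) :=
  multiplier (fun z => (evolution_symbol g z)^-1) X.

Definition has_cadlag_in_time_representation d (T : dist (d + 1)) : Prop :=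
  exists T_ : R -> dist d,
    (forall t, Vdual (T_ t)) /\
    forall phi : 'rV[R]_d -> R[i], Vspace phi ->
      [/\ cadlag (fun t => Vpairing (T_ t) phi),
          slow_growing (density_measure (fun t => Vpairing (T_ t) phi)) &
          forall theta : R -> R[i], CFD (fun s : 'rV[R]_1 => theta (s ord0 ord0)) ->
            VCpairing T (tensor phi theta) =
            cint (@lebesgue_measure R) (fun t => Vpairing (T_ t) phi * theta t)].

End tempered_distributions.

(* Main.v *)
(** A slow-growing measure [mu] is the image of [u P] under a map [pi], for a
    positive measure [P] and a complex density [u].  If [(P, pi, u)] presents
    [F X], then [(P, pi, u / (i w + g))] presents the Fourier measure of the
    solution; existence and uniqueness follow, because Schwartz functions
    determine a slow-growing measure.

    Let [(Q, rho = (xi, tau), v)] present the spatial transform [F_S X].  As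
    [Re g >= kappa > 0], [1 / (i w + g)] is the integral over [s >= 0] of
    [exp (- (i w + g) s)], and [exp (- i w s)] is a translation by [s] in time.
    Hence the spatial transform of the solution is presented by
    [(xi, tau + s)] and [v exp (- g(xi) s)] on [Q x ds], [s >= 0].  Disintegrating
    along [t = tau + s], the slice at time [t] is the image under [xi] of
    [v exp (- g(xi) (t - tau)) 1_(tau <= t) Q].  The indicator is càdlàg in [t] and
    all the bounds are locally uniform in [t], so by dominated convergence
    pairing the slices with a test function gives a càdlàg function. *)
Require Import Defs.
From HB Require Import structures.
From mathcomp Require Import all_boot all_order all_algebra.
From mathcomp Require Import complex.
From mathcomp Require Import all_classical all_reals all_analysis.
From mathcomp Require Import measurable_realfun.
From mathcomp Require Import ring lra.
Import Defs.

Set Implicit Arguments.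
Unset Strict Implicit.
Unset Printing Implicit Defensive.

Import Order.TTheory GRing.Theory Num.Theory.
Import numFieldNormedType.Exports.

Local Open Scope classical_set_scope.
Local Open Scope ring_scope.
Local Open Scope complex_scope.

(** * Complex numbers and complex-valued integrals *)

(** A complex Radon measure has values only on bounded Borel sets, and [mint] integrates against
    suprema ([pos_variation]) that do not come as measures. Presentations remove this obstacle. They
    also record exactly the values on bounded sets, which is all that uniqueness determines, so a
    measure picked by [xget] can be replaced by a computed one.

    [F X] and [F_S X] are given independently. The link between them is Fourier inversion on
    Schwartz functions: [ifourier] after [sfourier] is the inverse transform in time alone. To
    obtain it, all transforms are split into one-coordinate transforms, which the Poisson kernel
    inverts on the line. This link concerns Schwartz test functions, whereas e^(-g(xi) s) is merely
    continuous in xi; it may be inserted because test functions determine, as measures, the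
    projections of both sides to xi-space.

    Peetre's inequality 1 + tau^2 <= 2 (1 + t^2) (1 + (t - tau)^2) lets the exponential decay in t -
    tau pay for any polynomial growth of [F_S X] in time. Hence every slice is slow-growing, with
    bounds polynomial in t. *)

Section complex_numbers.
Context {R : realType}.
Implicit Types a b z : R[i].

Lemma ReD a b : complex.Re (a + b) = complex.Re a + complex.Re b.
Proof. by case: a b => [? ?] [? ?]. Qed.
Lemma ImD a b : complex.Im (a + b) = complex.Im a + complex.Im b.
Proof. by case: a b => [? ?] [? ?]. Qed.
Lemma ReM a b :
  complex.Re (a * b) = complex.Re a * complex.Re b - complex.Im a * complex.Im b.
Proof. by case: a b => [? ?] [? ?]. Qed.
Lemma ImM a b :
  complex.Im (a * b) = complex.Re a * complex.Im b + complex.Im a * complex.Re b.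
Proof. by case: a b => [? ?] [? ?]. Qed.
Lemma ReN a : complex.Re (- a) = - complex.Re a.
Proof. by case: a. Qed.
Lemma ImN a : complex.Im (- a) = - complex.Im a.
Proof. by case: a. Qed.
Lemma complexP a b :
  complex.Re a = complex.Re b -> complex.Im a = complex.Im b -> a = b.
Proof. by case: a b => [? ?] [? ?] /= -> ->. Qed.

Lemma normc_ge0 z : 0 <= Normc.normc z.
Proof. by case: z => a b; exact: sqrtr_ge0. Qed.
Lemma normcDle a b : Normc.normc (a + b) <= Normc.normc a + Normc.normc b.
Proof. exact: le_normcD. Qed.
Lemma normc_real (r : R) : Normc.normc r%:C = `|r|.
Proof. by rewrite /= expr0n/= addr0 sqrtr_sqr. Qed.
Lemma normc_sqr z : Normc.normc z ^+ 2 = complex.Re z ^+ 2 + complex.Im z ^+ 2.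
Proof. by case: z => a b /=; rewrite sqr_sqrtr// addr_ge0// sqr_ge0. Qed.
Lemma Re_le_normc z : `|complex.Re z| <= Normc.normc z.
Proof.
rewrite -(ler_pXn2r (n := 2))// ?nnegrE ?normc_ge0//.
by rewrite normc_sqr real_normK ?num_real// lerDl sqr_ge0.
Qed.
Lemma Im_le_normc z : `|complex.Im z| <= Normc.normc z.
Proof.
rewrite -(ler_pXn2r (n := 2))// ?nnegrE ?normc_ge0//.
by rewrite normc_sqr real_normK ?num_real// lerDr sqr_ge0.
Qed.
Lemma normc_le_ReIm z : Normc.normc z <= `|complex.Re z| + `|complex.Im z|.
Proof.
rewrite -(ler_pXn2r (n := 2))// ?nnegrE ?normc_ge0 ?addr_ge0//.
rewrite normc_sqr sqrrD !real_normK ?num_real//.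
by rewrite lerD2r lerDl mulrn_wge0// mulr_ge0.
Qed.
Lemma normc_cexpi (t : R) : Normc.normc (cexpi t) = 1.
Proof. by rewrite /= cos2Dsin2 sqrtr1. Qed.
Lemma cexpiD (s t : R) : cexpi (s + t) = cexpi s * cexpi t.
Proof. by apply: complexP; rewrite ?ReM ?ImM /= ?cosD ?sinD//; ring. Qed.
Lemma cexpi0 : cexpi (0 : R) = 1.
Proof. by rewrite /cexpi cos0 sin0. Qed.

(** Limits, derivatives and integrals are handled below on real and imaginary parts; this is the
    bridge to the topology of [R[i]^o] used in the statement. *)
Lemma ccvgP (T : Type) (F : set_system T) {FF : Filter F} (f : T -> R[i]) (l : R[i]) :
  ((f : T -> R[i]^o) @ F --> (l : R[i]^o)) <->
  (complex.Re (f x) @[x --> F] --> complex.Re l) /\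
  (complex.Im (f x) @[x --> F] --> complex.Im l).
Proof.
have nE (z : R[i]) (e : R) : (`|z : R[i]^o| < e%:C) = (Normc.normc z < e).
  by rewrite -ltcR.
split=> [/cvgrPdist_lt h|[/cvgrPdist_lt hR /cvgrPdist_lt hI]].
- split; apply/cvgrPdist_lt => e e0.
  + have e0' : 0 < e%:C by rewrite ltcR.
    apply: filterS (h _ e0') => t; rewrite nE; apply: le_lt_trans.
    by rewrite -ReN -ReD Re_le_normc.
  + have e0' : 0 < e%:C by rewrite ltcR.
    apply: filterS (h _ e0') => t; rewrite nE; apply: le_lt_trans.
    by rewrite -ImN -ImD Im_le_normc.
- apply/cvgrPdist_lt => -[e e'] e0.
  (* Radii are elements of [R[i]], whose order compares only numbers with equal imaginary parts; a
     positive radius is therefore real. *)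
  have [e'0 {}e0] : e' = 0 /\ 0 < e by move: e0; rewrite ltcE/= => /andP[/eqP].
  rewrite e'0.
  have e20 : 0 < e / 2 by rewrite divr_gt0.
  apply: filterS2 (hR _ e20) (hI _ e20) => t h1 h2.
  rewrite -[(e +i* 0)%C]/(e%:C) nE; apply: le_lt_trans (normc_le_ReIm _) _.
  by rewrite ReD ImD ReN ImN (splitr e) ltrD.
Qed.

End complex_numbers.

(** [cmeasurable] over an arbitrary domain, since presentations live on product spaces. *)
Definition cmeas (R : realType) d (T : measurableType d) (f : T -> R[i]) :=
  measurable_fun setT (fun x => complex.Re (f x)) /\
  measurable_fun setT (fun x => complex.Im (f x)).

Definition rintegrable (R : realType) d (T : measurableType d)
  (P : {measure set T -> \bar R}) (f : T -> R) := P.-integrable setT (EFin \o f).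

Definition cintegrable (R : realType) d (T : measurableType d)
    (P : {measure set T -> \bar R}) (f : T -> R[i]) :=
  rintegrable P (fun x => complex.Re (f x)) /\
  rintegrable P (fun x => complex.Im (f x)).

Section cmeas_theory.
Context {R : realType} d (T : measurableType d).
Implicit Types f g : T -> R[i].

Lemma cmeasM f g : cmeas f -> cmeas g -> cmeas (fun x => f x * g x).
Proof.
move=> [fR fI] [gR gI]; split.
  under eq_fun do rewrite ReM.
  by apply: measurable_funB; exact: measurable_funM.
under eq_fun do rewrite ImM.
by apply: measurable_funD; exact: measurable_funM.
Qed.

Lemma cmeas_cst (c : R[i]) : cmeas (fun _ : T => c).
Proof. by split; exact: measurable_cst. Qed.

Lemma cmeas_real (f : T -> R) : measurable_fun setT f -> cmeas (fun x => (f x)%:C).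
Proof. by move=> mf; split => //=; exact: measurable_cst. Qed.

Lemma cmeas_cexpi (f : T -> R) : measurable_fun setT f -> cmeas (fun x => cexpi (f x)).
Proof.
move=> mf; split => /=; apply: measurableT_comp => //;
  apply: continuous_measurable_fun;
  [exact: continuous_cos|exact: continuous_sin].
Qed.

Lemma measurable_normc f : cmeas f -> measurable_fun setT (fun x => Normc.normc (f x)).
Proof.
move=> [fR fI].
have -> : (fun x => Normc.normc (f x)) =
    (fun x => Num.sqrt (complex.Re (f x) ^+ 2 + complex.Im (f x) ^+ 2)).
  by apply/funext => x; case: (f x).
apply: measurableT_comp => //.
  by apply: continuous_measurable_fun; exact: sqrt_continuous.
by apply: measurable_funD; exact: measurable_funX.
Qed.

Lemma cmeas_comp d' (T' : measurableType d') (h : T' -> T) f :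
  measurable_fun setT h -> cmeas f -> cmeas (fun x => f (h x)).
Proof.
move=> mh [fR fI]; split.
  exact: (measurableT_comp fR mh).
exact: (measurableT_comp fI mh).
Qed.

Lemma cmeas_if (A : set T) f : measurable A -> cmeas f ->
  cmeas (fun x => if x \in A then f x else 0).
Proof.
move=> mA [fR fI]; split.
  have := (measurable_restrict (fun x => complex.Re (f x)) mA measurableT).1.
  rewrite setTI => /(_ (measurable_funS measurableT (@subsetT _ _) fR)).
  congr (measurable_fun _ _); apply/funext => x; rewrite /restrict.
  by case: ifP.
have := (measurable_restrict (fun x => complex.Im (f x)) mA measurableT).1.
rewrite setTI => /(_ (measurable_funS measurableT (@subsetT _ _) fI)).
congr (measurable_fun _ _); apply/funext => x; rewrite /restrict.
by case: ifP.
Qed.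

End cmeas_theory.

Section cint_theory.
Context {R : realType} d (T : measurableType d) (P : {measure set T -> \bar R}).
Implicit Types (f g : T -> R[i]) (b : T -> R).

Lemma rintegrable_le b (f : T -> R) : rintegrable P b -> measurable_fun setT f ->
  (forall x, `|f x| <= b x) -> rintegrable P f.
Proof.
move=> ib mf fb; apply: (le_integrable _ _ _ ib) => //; first exact/measurable_EFinP.
by move=> x _ /=; rewrite lee_fin (le_trans (fb x))// ler_norm.
Qed.

Lemma cintegrable_le b f : rintegrable P b -> cmeas f ->
  (forall x, Normc.normc (f x) <= b x) -> cintegrable P f.
Proof.
move=> ib [mR mI] fb; split; apply: (rintegrable_le ib) => // x;
  apply: le_trans (fb x); [exact: Re_le_normc|exact: Im_le_normc].
Qed.

Lemma cintegrable_cmeas f : cintegrable P f -> cmeas f.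
Proof. by move=> [/measurable_int/measurable_EFinP ? /measurable_int/measurable_EFinP]. Qed.

Lemma rintegrableD (f g : T -> R) : rintegrable P f -> rintegrable P g ->
  rintegrable P (fun x => f x + g x).
Proof.
move=> iF ig; have := integrableD measurableT iF ig.
by apply: eq_integrable.
Qed.

Lemma rintegrableZ (c : R) (f : T -> R) : rintegrable P f ->
  rintegrable P (fun x => c * f x).
Proof. by move=> iF; exact: (integrableZl measurableT c iF). Qed.

Lemma rintegrableN (f : T -> R) : rintegrable P f -> rintegrable P (fun x => - f x).
Proof. by move=> iF; have := integrableN iF; apply: eq_integrable. Qed.

Lemma rintegrable_normc f : cintegrable P f ->
  rintegrable P (fun x => Normc.normc (f x)).
Proof.
move=> cf; have mf := cintegrable_cmeas cf; case: cf => fR fI.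
have ib := rintegrableD (integrable_norm fR) (integrable_norm fI).
apply: (rintegrable_le ib); first exact: measurable_normc.
by move=> x; rewrite ger0_norm ?normc_ge0// normc_le_ReIm.
Qed.

Lemma rintD (f g : T -> R) : rintegrable P f -> rintegrable P g ->
  rint P (fun x => f x + g x) = rint P f + rint P g.
Proof. exact: (RintegralD measurableT). Qed.

Lemma rintB (f g : T -> R) : rintegrable P f -> rintegrable P g ->
  rint P (fun x => f x - g x) = rint P f - rint P g.
Proof. exact: (RintegralB measurableT). Qed.

Lemma rintZ (c : R) (f : T -> R) : rintegrable P f ->
  rint P (fun x => c * f x) = c * rint P f.
Proof. exact: (RintegralZl c measurableT). Qed.

Lemma cintegrableD f g : cintegrable P f -> cintegrable P g ->
  cintegrable P (fun x => f x + g x).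
Proof.
move=> [fR fI] [gR gI]; split.
  by under [X in rintegrable _ X]eq_fun do rewrite ReD; exact: rintegrableD.
by under [X in rintegrable _ X]eq_fun do rewrite ImD; exact: rintegrableD.
Qed.

Lemma cintegrableZ (c : R[i]) f : cintegrable P f -> cintegrable P (fun x => c * f x).
Proof.
move=> [fR fI]; split.
  under [X in rintegrable _ X]eq_fun do rewrite ReM.
  by apply: rintegrableD; [|apply: rintegrableN]; exact: rintegrableZ.
under [X in rintegrable _ X]eq_fun do rewrite ImM.
by apply: rintegrableD; exact: rintegrableZ.
Qed.

Lemma cintD f g : cintegrable P f -> cintegrable P g ->
  cint P (fun x => f x + g x) = cint P f + cint P g.
Proof.
move=> [fR fI] [gR gI]; apply: complexP; rewrite ?ReD ?ImD /=.
  by under [X in rint _ X]eq_fun do rewrite ReD; exact: rintD.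
by under [X in rint _ X]eq_fun do rewrite ImD; exact: rintD.
Qed.

Lemma cintZ (c : R[i]) f : cintegrable P f ->
  cint P (fun x => c * f x) = c * cint P f.
Proof.
move=> [fR fI]; apply: complexP; rewrite ?ReM ?ImM /=.
  under [X in rint _ X]eq_fun do rewrite ReM.
  by rewrite rintB ?rintZ//; exact: rintegrableZ.
under [X in rint _ X]eq_fun do rewrite ImM.
by rewrite rintD ?rintZ//; exact: rintegrableZ.
Qed.

Lemma normr_rint_le b (f : T -> R) : rintegrable P b -> measurable_fun setT f ->
  (forall x, `|f x| <= b x) -> `|rint P f| <= rint P b.
Proof.
move=> ib mf fb; have iF := rintegrable_le ib mf fb.
apply: le_trans (le_normr_Rintegral measurableT iF) _.
apply: le_Rintegral => //.
exact: (integrable_norm iF).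
Qed.

(** The factor 2 comes from bounding the two parts separately. *)
Lemma normc_cint_le b f : rintegrable P b -> cmeas f ->
  (forall x, Normc.normc (f x) <= b x) -> Normc.normc (cint P f) <= 2 * rint P b.
Proof.
move=> ib [mR mI] fb; apply: le_trans (normc_le_ReIm _) _.
rewrite /= mulrDl mul1r lerD//; apply: normr_rint_le => // x;
  apply: le_trans (fb x); [exact: Re_le_normc|exact: Im_le_normc].
Qed.

Lemma rint_cvg (h : nat -> T -> R) (l b : T -> R) :
  (forall n, measurable_fun setT (h n)) -> measurable_fun setT l ->
  rintegrable P b -> (forall n x, `|h n x| <= b x) ->
  (forall x, h n x @[n --> \oo] --> l x) ->
  rint P (h n) @[n --> \oo] --> rint P l.
Proof.
move=> mh ml ib hb hl.
(* The limit inherits the bound [b], so its integral is finite, as the passage from extended to real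
   limits requires. *)
have il : rintegrable P l.
  apply: (rintegrable_le ib) => // x.
  have hx : `|h n x| @[n --> \oo] --> `|l x| by apply: cvg_norm; exact: hl.
  rewrite -(cvg_lim _ hx)//; apply: limr_le; first by apply/cvg_ex; exists `|l x|.
  by apply: nearW => n; exact: hb.
apply: fine_cvg; rewrite fineK; last exact: integrable_fin_num.
have [//||||_ _] := @dominated_convergence _ _ _ P setT measurableT
    (fun n x => (h n x)%:E) (EFin \o l) (EFin \o b) _ _ _ ib.
- by move=> n; exact/measurable_EFinP.
- exact/measurable_EFinP.
- by apply: aeW => x _; apply: cvg_EFin; [exact: nearW|exact: hl].
- by apply: aeW => x n _; rewrite lee_fin.
- by [].
Qed.

Lemma eq_cint f g : f =1 g -> cint P f = cint P g.
Proof. by move=> /funext->. Qed.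

Lemma cint0 : cint P (fun=> 0) = 0.
Proof.
apply: complexP; rewrite /= /rint/=; under eq_integral do rewrite /=;
  by rewrite integral0.
Qed.

End cint_theory.

(** Dominated convergence is a statement on sequences, while continuity and one-sided limits are
    taken along filters. If the limit failed for some [A], each basic set would contain a point
    mapped outside [A], and these points would form a sequence contradicting [gu]. *)
Lemma seq_cvg_filter (X Y : Type) (F : set_system X) (G : set_system Y)
    (B : nat -> set X) (g : X -> Y) :
  Filter F -> (forall n, F (B n)) -> (forall A, F A -> exists n, B n `<=` A) ->
  (forall u : nat -> X, (u n @[n --> \oo] --> F) -> (g (u n) @[n --> \oo] --> G)) ->
  g x @[x --> F] --> G.
Proof.
move=> FF FB basisF gu A GA.
(* Decreasing intersections, so that a sequence with n-th term in [C n] eventually stays in every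
   basic set. *)
pose C n := \bigcap_(i in [set i | (i <= n)%N]) B i.
have FC n : F (C n).
  elim: n => [|n ih].
    by apply: filterS (FB 0%N) => x Bx i /=; rewrite leqn0 => /eqP ->.
  apply: filterS2 ih (FB n.+1) => x Cx Bx i /=.
  by rewrite leq_eqVlt ltnS => /predU1P[->//|]; exact: Cx.
apply: contrapT => nFA.
have /choice[u uP] : forall n, exists x, C n x /\ ~ A (g x).
  move=> n; apply: contrapT => h; apply: nFA.
  rewrite /nbhs/=; apply: (filterS _ (FC n)) => x Cx /=.
  by apply: contrapT => nA; apply: h; exists x.
have uF : u n @[n --> \oo] --> F.
  move=> D FD; have [n BnD] := basisF _ FD.
  exists n => // m /= nm; apply: BnD.
  by have [+ _] := uP m; apply.
have [N _ /(_ N (leqnn N))] := gu _ uF _ GA.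
exact: (uP N).2.
Qed.

Definition countably_based (X : Type) (F : set_system X) :=
  exists B : nat -> set X, (forall n, F (B n)) /\
    forall A, F A -> exists n, B n `<=` A.

Lemma cint_cvg (R : realType) d (T : measurableType d) (P : {measure set T -> \bar R})
    (X : Type) (F : set_system X) (h : X -> T -> R[i]) (l : T -> R[i]) (b : T -> R) :
  Filter F -> countably_based F ->
  (forall x, cmeas (h x)) -> cmeas l -> rintegrable P b ->
  (\forall x \near F, forall y, Normc.normc (h x y) <= b y) ->
  (forall y, (h x y : R[i]^o) @[x --> F] --> (l y : R[i]^o)) ->
  (cint P (h x) : R[i]^o) @[x --> F] --> (cint P l : R[i]^o).
Proof.
move=> FF [B [FB basisF]] mh ml ib hb hl.
apply: (@seq_cvg_filter _ _ F (nbhs (cint P l : R[i]^o)) B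
  (fun x => cint P (h x)) FF FB basisF) => u uF.
(* The bound holds only eventually along [F], hence along the sequence from some [N] on; the
   sequence is shifted by [N]. *)
have [N _ Nu] := uF _ hb.
have hlu y : (h (u (n + N)%N) y : R[i]^o) @[n --> \oo] --> (l y : R[i]^o).
  have := cvg_comp _ _ uF (hl y).
  by rewrite -(cvg_shiftn N).
rewrite -(cvg_shiftn N).
have bu n y : Normc.normc (h (u (n + N)%N) y) <= b y by apply: Nu => /=; exact: leq_addl.
apply/ccvgP; split; apply: (@rint_cvg _ _ _ P (fun n y => _ (h (u (n + N)%N) y)) _ b _ _ ib).
- by move=> n; exact: (mh _).1.
- exact: ml.1.
- by move=> n y; apply: le_trans (bu n y); exact: Re_le_normc.
- by move=> y; have /ccvgP[] := hlu y.
- by move=> n; exact: (mh _).2.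
- exact: ml.2.
- by move=> n y; apply: le_trans (bu n y); exact: Im_le_normc.
- by move=> y; have /ccvgP[] := hlu y.
Qed.

Section countable_bases.
Context {R : realType}.

Lemma harmonic_small (e : R) : 0 < e -> exists n, n.+1%:R^-1 < e.
Proof.
move=> e0; have /cvgrPdist_lt/(_ _ e0)[N _ /(_ N (leqnn N))] := @cvg_harmonic R.
by rewrite /= sub0r normrN ger0_norm ?invr_ge0//; exists N.
Qed.

Lemma countably_based_nbhs (X : pseudoMetricType R) (x : X) :
  countably_based (nbhs x).
Proof.
exists (fun n => ball x n.+1%:R^-1); split.
  by move=> n; apply: nbhsx_ballx; rewrite invr_gt0.
move=> A /nbhs_ballP[e /= e0 eA]; have [n ne] := harmonic_small e0.
by exists n; apply: subset_trans eA; exact/le_ball/ltW.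
Qed.

Lemma countably_based_within (X : Type) (F : set_system X) (D : set X) :
  Filter F -> countably_based F -> countably_based (within D F).
Proof.
move=> FF [B [FB basisF]]; exists (fun n => D `&` B n); split.
  by move=> n; apply: (filterS _ (FB n)) => x Bx Dx.
move=> A FDA; have [n BnA] := basisF _ FDA.
by exists n => x [Dx Bx]; exact: BnA.
Qed.
End countable_bases.

(** * Fubini's theorem for real and complex integrals *)

Section fubini.
Context {R : realType} d1 d2 (T1 : measurableType d1) (T2 : measurableType d2).
Variables (m1 : {sigma_finite_measure set T1 -> \bar R}).
Variables (m2 : {sigma_finite_measure set T2 -> \bar R}).

Lemma rintegrable_prod (a : T1 -> R) (b : T2 -> R) :
  rintegrable m1 a -> rintegrable m2 b ->
  rintegrable (m1 \x m2)%E (fun z => a z.1 * b z.2).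
Proof.
move=> ia ib.
have ma : measurable_fun setT a by move: ia => /measurable_int/measurable_EFinP.
have mb : measurable_fun setT b by move: ib => /measurable_int/measurable_EFinP.
have mab : measurable_fun setT (fun z : T1 * T2 => a z.1 * b z.2).
  by apply: measurable_funM; exact: measurableT_comp.
apply/integrable12ltyP; first exact/measurable_EFinP.
have bE x : (\int[m2]_y `|(a x * b y)%:E|)%E = (`|a x|%:E * \int[m2]_y `|(b y)%:E|)%E.
  rewrite -ge0_integralZl//=.
  - by apply: eq_integral => y _; rewrite normrM EFinM.
  - by apply/measurable_EFinP; exact: measurableT_comp.
under eq_integral do rewrite /= bE.
have /integrableP[_ iboo] := ib; have /integrableP[_ iaoo] := ia.
have bfin : (\int[m2]_y `|(b y)%:E|)%E \is a fin_num.
  by rewrite ge0_fin_numE// integral_ge0.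
rewrite -(fineK bfin) ge0_integralZr//=.
- by rewrite lte_mul_pinfty ?ltry ?ge0_fin_numE ?integral_ge0.
- by apply/measurable_EFinP; exact: measurableT_comp.
- by rewrite lee_fin fine_ge0// integral_ge0.
Qed.

(** The inner integrals of Fubini's theorem are extended reals, finite only almost everywhere.
    [fine] changes them to 0 on a null set, which affects no integral. *)
Lemma fine_rintegrable d (T : measurableType d) (P : {measure set T -> \bar R})
    (G : T -> \bar R) : P.-integrable setT G ->
  rintegrable P (fun x => fine (G x)) /\
  (\int[P]_x G x = \int[P]_x (fine (G x))%:E)%E.
Proof.
move=> iG; have mG := measurable_int _ iG.
have mf : measurable_fun setT (fun x => (fine (G x))%:E).
  by apply/measurable_EFinP; exact: measurableT_comp.
have aeG : {ae P, forall x, setT x -> G x = (fine (G x))%:E}.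
  have := integrable_ae measurableT iG; apply: filterS => x /= /(_ Logic.I).
  by move=> h _; rewrite fineK.
split; last by apply: ae_eq_integral.
apply/integrableP; split => //; have /integrableP[_] := iG.
rewrite (ae_eq_integral (fun x => `|(fine (G x))%:E|%E))//.
- exact: measurableT_comp.
- exact: measurableT_comp.
- by apply: filterS aeG => x h Dx; apply: (congr1 (fun z => `|z|%E)); first [exact: h|exact/esym/h].
Qed.

Lemma rint_fubini1 (f : T1 * T2 -> R) : rintegrable (m1 \x m2)%E f ->
  rintegrable m1 (fun x => rint m2 (fun y => f (x, y))) /\
  rint (m1 \x m2)%E f = rint m1 (fun x => rint m2 (fun y => f (x, y))).
Proof.
move=> iF; have [? e] := fine_rintegrable (integrable_fubini_F iF).
by split=> //; rewrite /rint -(integral12_prod_meas1 iF) e.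
Qed.

Lemma cint_fubini1 (f : T1 * T2 -> R[i]) : cintegrable (m1 \x m2)%E f ->
  cintegrable m1 (fun x => cint m2 (fun y => f (x, y))) /\
  cint (m1 \x m2)%E f = cint m1 (fun x => cint m2 (fun y => f (x, y))).
Proof.
by move=> [/rint_fubini1[? eR] /rint_fubini1[? eI]]; split=> //; apply: complexP.
Qed.

Lemma rint_fubini2 (f : T1 * T2 -> R) : rintegrable (m1 \x m2)%E f ->
  rintegrable m2 (fun y => rint m1 (fun x => f (x, y))) /\
  rint (m1 \x m2)%E f = rint m2 (fun y => rint m1 (fun x => f (x, y))).
Proof.
move=> iF; have mf := measurable_int _ iF.
(* The other order of integration is obtained by exchanging the variables. *)
have iS : (m2 \x m1)%E.-integrable setT (EFin \o (fun z => f (z.2, z.1))).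
  apply/integrable12ltyP; last exact: (integrable21ltyP _ _ mf).1.
  by apply: (measurableT_comp mf); exact: measurable_fun_pair.
have [? e] := fine_rintegrable (integrable_fubini_F iS).
split=> //; rewrite /rint -(integral21_prod_meas1 iF).
by rewrite -e.
Qed.

Lemma cint_fubini2 (f : T1 * T2 -> R[i]) : cintegrable (m1 \x m2)%E f ->
  cintegrable m2 (fun y => cint m1 (fun x => f (x, y))) /\
  cint (m1 \x m2)%E f = cint m2 (fun y => cint m1 (fun x => f (x, y))).
Proof.
by move=> [/rint_fubini2[? eR] /rint_fubini2[? eI]]; split=> //; apply: complexP.
Qed.

End fubini.

Section pushforward.
Context {R : realType} d1 d2 (T1 : measurableType d1) (T2 : measurableType d2).
Variables (phi : T1 -> T2) (P : {measure set T1 -> \bar R}).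
Hypothesis mphi : measurable_fun setT phi.

Lemma rint_pushforward (f : T2 -> R) : measurable_fun setT f ->
  rintegrable P (f \o phi) -> rint (pushforward P phi) f = rint P (f \o phi).
Proof.
move=> mf iF; rewrite /rint integral_pushforward ?preimage_setT//.
exact/measurable_EFinP.
Qed.

Lemma cint_pushforward (f : T2 -> R[i]) : cmeas f ->
  cintegrable P (f \o phi) -> cint (pushforward P phi) f = cint P (f \o phi).
Proof.
move=> [mR mI] [iR iI]; apply: complexP => /=.
  exact: (rint_pushforward mR).
exact: (rint_pushforward mI).
Qed.
End pushforward.

(** * Borel sets and Lebesgue measure on row vectors *)

Section borel_rV.
Context {R : realType}.

Definition box n (a b : 'rV[R]_n) : set 'rV[R]_n :=
  [set x | forall j, a ord0 j < x ord0 j < b ord0 j].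

Lemma ball_box n (x : 'rV[R]_n) (e : R) : 0 < e ->
  ball x e = box (x - const_mx e) (x + const_mx e).
Proof.
move=> e0; apply/seteqP; split => [y [_ xy] j|y xy].
  have := xy ord0 j; rewrite /ball/= !mxE ltr_distl => /andP[h1 h2].
  by apply/andP; split; lra.
split=> // i j; rewrite ord1 /ball/= ltr_distl.
by have := xy j; rewrite !mxE => /andP[h1 h2]; apply/andP; split; lra.
Qed.

(** Balls of the sup norm are boxes, and those with rational centre and radius 1/(k+1) are countable
    in number. Hence boxes generate the Borel sets, and measurability can be checked coordinate by
    coordinate. *)
Lemma open_bigcup_box n (U : set 'rV[R]_n) : open U ->
  U = \bigcup_(p in [set p : 'rV[rat]_n * nat |
        ball (map_mx ratr p.1 : 'rV[R]_n) p.2.+1%:R^-1 `<=` U])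
      ball (map_mx ratr p.1 : 'rV[R]_n) p.2.+1%:R^-1.
Proof.
move=> oU; apply/seteqP; split => [x Ux|x [p pU]]; last exact: pU.
have /nbhs_ballP[e /= e0 eU] : nbhs x U by exact: open_nbhs_nbhs.
(* The rational ball contains [x] and has radius below e/2, so it lies within distance [e] of
   [x]. *)
have [k ke] := harmonic_small (divr_gt0 e0 (ltr0n _ 2)).
have k0 : 0 < k.+1%:R^-1 :> R by rewrite invr_gt0.
have /choice[q qP] : forall j, exists q : rat, `|ratr q - x ord0 j| < k.+1%:R^-1.
  move=> j; have : x ord0 j - k.+1%:R^-1 < x ord0 j + k.+1%:R^-1.
    by rewrite ltrBlDr -addrA ltrDl addr_gt0.
  move=> /rat_in_itvoo[q]; rewrite in_itv/= => /andP[h1 h2].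
  by exists q; rewrite ltr_distl h1 h2.
have xB : ball (map_mx ratr (\row_j q j) : 'rV[R]_n) k.+1%:R^-1 x.
  split=> // i j; rewrite !mxE ord1; exact: qP.
exists (\row_j q j, k) => //= y yB; apply: eU.
have -> : e = (e / 2) + (e / 2) by lra.
apply: (@ball_triangle _ _ (map_mx ratr (\row_j q j) : 'rV[R]_n)).
  by apply: ball_sym; apply: (le_ball (ltW ke)).
exact: (le_ball (ltW ke)).
Qed.

Lemma measurable_box n (a b : 'rV[R]_n) d (T : measurableType d) (f : T -> 'rV[R]_n) :
  (forall j, measurable_fun setT (fun t => f t ord0 j)) ->
  measurable (f @^-1` box a b).
Proof.
move=> mf.
have -> : f @^-1` box a b =
    ~` \bigcup_j ~` ((fun t => f t ord0 j) @^-1` `]a ord0 j, b ord0 j[).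
  rewrite setC_bigcup; apply/seteqP; split => [t ft j _ /=|t ft j].
    by rewrite /setC/=; apply; rewrite in_itv/=; exact: ft.
  by have := ft j Logic.I; rewrite /setC/= => /contrapT; rewrite in_itv.
apply: measurableC; apply: countable_bigcupT_measurable; first exact: countableP.
move=> j; apply: measurableC; rewrite -[X in measurable X]setTI.
exact: mf.
Qed.

Lemma measurable_fun_rV n d (T : measurableType d) (f : T -> 'rV[R]_n) :
  (forall j, measurable_fun setT (fun t => f t ord0 j)) -> measurable_fun setT f.
Proof.
move=> mf; apply: (measurability (@open 'rV[R]_n)) => //.
move=> _ [U oU <-]; rewrite setTI (open_bigcup_box oU).
rewrite preimage_bigcup bigcup_mkcond.
apply: countable_bigcupT_measurable; first exact: countableP.
move=> p; case: ifP => _ //; rewrite ball_box ?invr_gt0//.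
exact: measurable_box.
Qed.

Lemma continuous_measurable_rV n (f : 'rV[R]_n -> R) :
  continuous f -> measurable_fun setT f.
Proof.
move=> cf; apply: (measurability _ (RGenOInfty.measurableE R)).
move=> _ [_ [a ->] <-]; rewrite setTI; apply: sub_sigma_algebra.
by move/continuousP: cf; apply; exact: rray_open.
Qed.

Lemma measurable_coord n (j : 'I_n) : measurable_fun setT (fun x : 'rV[R]_n => x ord0 j).
Proof. by apply: continuous_measurable_rV; exact: coord_continuous. Qed.

Lemma ccontinuousP n (f : 'rV[R]_n -> R[i]) : ccontinuous f <->
  continuous (fun x => complex.Re (f x)) /\ continuous (fun x => complex.Im (f x)).
Proof.
split=> [cf|[cR cI] x]; last by apply/(@ccvgP _ _ (nbhs x)); split; [exact: cR|exact: cI].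
by split=> x; have /ccvgP[] := cf x.
Qed.

Lemma ccontinuous_cmeas n (f : 'rV[R]_n -> R[i]) : ccontinuous f -> cmeas f.
Proof. by move=> /ccontinuousP[? ?]; split; exact: continuous_measurable_rV. Qed.

Lemma measurable_dotv n d (T : measurableType d) (f g : T -> 'rV[R]_n) :
  measurable_fun setT f -> measurable_fun setT g ->
  measurable_fun setT (fun t => dotv (f t) (g t)).
Proof.
move=> mf mg; rewrite /dotv; apply: measurable_sum => j.
by apply: measurable_funM; apply: (measurableT_comp (measurable_coord j)).
Qed.

Lemma box_generates n :
  @measurable _ 'rV[R]_n = <<s [set box p.1 p.2 | p in [set: 'rV[R]_n * 'rV[R]_n]] >>.
Proof.
apply/seteqP; split; apply: smallest_sub.
- exact: smallest_sigma_algebra.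
- move=> U oU; rewrite (open_bigcup_box oU) bigcup_mkcond.
  have := @countable_bigcupT_measurable _ (g_sigma_algebraType [set box p.1 p.2 | p in [set: 'rV[R]_n * 'rV[R]_n]]).
  apply; first exact: countableP.
  move=> p; case: ifP => _; last exact: measurable0.
  apply: sub_sigma_algebra; rewrite ball_box ?invr_gt0//.
  by eexists (_, _).
- exact: smallest_sigma_algebra.
- move=> _ [[a b] _ <-]; have := @measurable_box n a b _ _ idfun.
  by apply => j; exact: measurable_coord.
Qed.

Lemma box_setI_closed n :
  setI_closed [set box p.1 p.2 | p in [set: 'rV[R]_n * 'rV[R]_n]].
Proof.
move=> _ _ [[a b] _ <-] [[a' b'] _ <-] /=.
exists (\row_j Num.max (a ord0 j) (a' ord0 j), \row_j Num.min (b ord0 j) (b' ord0 j)) => //=.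
apply/seteqP; split => [x xab|x [xab xab'] j].
  by split=> j; have := xab j; rewrite !mxE gt_max lt_min => /andP[/andP[? ?] /andP[? ?]];
   apply/andP.
by rewrite !mxE gt_max lt_min; have /andP[-> ->] := xab j; have /andP[-> ->] := xab' j.
Qed.

Definition cube {n} (k : nat) : set 'rV[R]_n := box (const_mx (- k.+1%:R)) (const_mx k.+1%:R).

Lemma cube_cover n : \bigcup_k cube k = [set: 'rV[R]_n].
Proof.
apply/seteqP; split => // x _.
have [k kx] : exists k : nat, forall j, `|x ord0 j| < k.+1%:R.
  exists (\sum_j (Num.truncn `|x ord0 j|))%N => j.
  apply: lt_le_trans (truncnS_gt _) _.
  by rewrite ler_nat ltnS (bigD1 j)//= leq_addr.
by exists k => // j; have := kx j; rewrite ltr_norml !mxE.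
Qed.

(** Boxes form a generating family closed under intersection, and the cubes exhaust the space with
    finite mass: the hypotheses of the uniqueness theorem for measures. *)
Lemma measure_rV_unique n (m1 m2 : {measure set 'rV[R]_n -> \bar R}) :
  (forall a b, m1 (box a b) = m2 (box a b)) ->
  (forall k, (m1 (cube k) < +oo)%E) ->
  forall A, measurable A -> m1 A = m2 A.
Proof.
move=> m12 m1k A mA.
apply: (g_sigma_algebra_measure_unique
  [set box p.1 p.2 | p in [set: 'rV[R]_n * 'rV[R]_n]] _ cube) => //.
- by rewrite box_generates; exact: sub_sigma_algebra.
- by move=> k; eexists (_, _).
- exact: cube_cover.
- exact: box_setI_closed.
- by move=> _ [[a b] _ <-].
- by rewrite -box_generates.
Qed.

End borel_rV.

Import HBNNSimple.
(** [integral] is a supremum over simple functions, and these evaluate the set function only on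
    measurable level sets. This replaces [lebesgue_rV] and [pos_variation], which are bare set
    functions, by genuine measures. *)
Lemma eq_integral_raw (R : realType) d (T : measurableType d) (m1 m2 : set T -> \bar R)
    (f : T -> \bar R) :
  (forall A, measurable A -> m1 A = m2 A) -> integral m1 setT f = integral m2 setT f.
Proof.
move=> m12; rewrite /integral.
suff e (g : T -> \bar R) : [set sintegral m1 h | h in [set h : {nnsfun T >-> R} |
    forall x, ((h x)%:E <= g x)%E]] = [set sintegral m2 h | h in
    [set h : {nnsfun T >-> R} | forall x, ((h x)%:E <= g x)%E]].
  by rewrite !e.
by apply/seteqP; split=> _ [h hg <-]; exists h => //; apply: eq_fsbigr => r _; rewrite m12.
Qed.

Section pfm.
Context {R : realType} d1 d2 (T1 : measurableType d1) (T2 : measurableType d2).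
Variables (P : {measure set T1 -> \bar R}) (phi : T1 -> T2).
Hypothesis mphi : measurable_fun setT phi.
(** The canonical measure on a pushforward depends on the proof of measurability; naming it makes it
    available as a bundled argument. *)
Definition pfm : {measure set T2 -> \bar R} :=
  measure_function_pushforward__canonical__measure_function_Measure P mphi.
Lemma pfmE A : pfm A = P (phi @^-1` A).
Proof. by []. Qed.
End pfm.

Section sigma_finite_measure_of.
Context (R : realType) d (T : measurableType d) (nu : {measure set T -> \bar R}).
Hypothesis sf : sigma_finite setT nu.
Definition sfm : set T -> \bar R := nu.
HB.instance Definition _ := Measure.copy sfm nu.
HB.instance Definition _ := Measure_isSigmaFinite.Build _ _ _ sfm sf.
Definition sfm_pack : {sigma_finite_measure set T -> \bar R} := sfm.
End sigma_finite_measure_of.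

Lemma sigma_finite_measure_of (R : realType) d (T : measurableType d)
    (nu : {measure set T -> \bar R}) (F : nat -> set T) :
  (forall k, measurable (F k)) -> \bigcup_k F k = setT ->
  (forall k, (nu (F k) < +oo)%E) ->
  exists mu : {sigma_finite_measure set T -> \bar R}, forall A, mu A = nu A.
Proof.
move=> mF FT nuF.
have sf : sigma_finite setT nu by exists F.
by exists (sfm_pack sf).
Qed.
Section measurable_blocks.
Context {R : realType}.

Lemma measurable_row_mx m n d (T : measurableType d) (f : T -> 'rV[R]_m) (g : T -> 'rV[R]_n) :
  measurable_fun setT f -> measurable_fun setT g ->
  measurable_fun setT (fun t => row_mx (f t) (g t)).
Proof.
move=> mf mg; apply: measurable_fun_rV => j.
case: (split_ordP j) => k ->.
  under eq_fun do rewrite row_mxEl; exact: (measurableT_comp (measurable_coord k)).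
under eq_fun do rewrite row_mxEr; exact: (measurableT_comp (measurable_coord k)).
Qed.

Lemma measurable_lsubmx m n : measurable_fun setT (fun x : 'rV[R]_(m + n) => lsubmx x).
Proof.
apply: measurable_fun_rV => j; under eq_fun do rewrite mxE; exact: measurable_coord.
Qed.

Lemma measurable_const_mx n d (T : measurableType d) (f : T -> R) :
  measurable_fun setT f -> measurable_fun setT (fun t => const_mx (f t) : 'rV[R]_n).
Proof.
by move=> mf; apply: measurable_fun_rV => j; under eq_fun do rewrite mxE.
Qed.

Lemma measurable_last_coord n : measurable_fun setT (@last_coord R n).
Proof. by rewrite /last_coord; under eq_fun do rewrite mxE; exact: measurable_coord. Qed.

End measurable_blocks.

Section lebesgue_rV_measure.
Context {R : realType}.

Definition cons_rV {m} (p : R * 'rV[R]_m) : 'rV[R]_m.+1 :=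
  row_mx (const_mx p.1 : 'rV[R]_1) p.2.

Lemma measurable_cons_rV m :
  measurable_fun setT (cons_rV : measurableTypeR R * 'rV[R]_m -> _).
Proof.
apply: (@measurable_row_mx _ 1 m _ _ (fun t => const_mx t.1) (fun t => t.2)).
  by apply: measurable_const_mx; exact: measurable_fst.
exact: measurable_snd.
Qed.

Lemma cons_rV0 m (p : R * 'rV[R]_m) : cons_rV p ord0 ord0 = p.1.
Proof.
have := row_mxEl (const_mx p.1 : 'rV[R]_1) p.2 ord0 (ord0 : 'I_1); rewrite [X in _ = X -> _]mxE => <-.
by congr (fun_of_matrix _ _ _); exact: val_inj.
Qed.

Lemma cons_rVS m (p : R * 'rV[R]_m) j : cons_rV p ord0 (lift ord0 j) = p.2 ord0 j.
Proof.
rewrite -(row_mxEr (const_mx p.1 : 'rV[R]_1) p.2 ord0 j).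
by congr (fun_of_matrix _ _ _); exact: val_inj.
Qed.

Lemma cons_rV_box m (a b : 'rV[R]_m.+1) :
  cons_rV @^-1` box a b = `]a ord0 ord0, b ord0 ord0[%classic `*`
    box (\row_j a ord0 (lift ord0 j)) (\row_j b ord0 (lift ord0 j)).
Proof.
apply/seteqP; split => [p pab|p [/=]].
  split => /=; first by rewrite in_itv/=; have := pab ord0; rewrite cons_rV0.
  by move=> j; rewrite !mxE; have := pab (lift ord0 j); rewrite cons_rVS.
rewrite in_itv/= => p1 p2 j; case: (unliftP ord0 j) => [k|] ->.
  by rewrite cons_rVS; have := p2 k; rewrite !mxE.
by rewrite cons_rV0.
Qed.

(** The recursion in [lebesgue_rV] integrates the measures of sections, which is how the product
    measure is defined. *)
Lemma lebesgue_rV_cons m (mu : {sigma_finite_measure set 'rV[R]_m -> \bar R}) :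
  (forall A, measurable A -> lebesgue_rV A = mu A) ->
  forall A : set 'rV[R]_m.+1, measurable A ->
  lebesgue_rV A = pfm (lebesgue_measure \x mu)%E (@measurable_cons_rV m) A.
Proof.
move=> muE A mA; rewrite pfmE /= /product_measure1 /=; apply: eq_integral => t _.
have mB : measurable (cons_rV @^-1` A : set (measurableTypeR R * 'rV[R]_m)).
  by rewrite -[X in measurable X]setTI; exact: measurable_cons_rV.
have -> : [set x : 'rV[R]_m | A (row_mx (const_mx t : 'rV_1) x)] =
    xsection (cons_rV @^-1` A) t.
  by apply/seteqP; split=> x; rewrite /xsection /= inE.
by rewrite muE//; exact: measurable_xsection.
Qed.

(** The bounds on boxes are carried through the induction: finiteness makes the next product
    sigma-finite through the cubes. Positivity is what later shows that a continuous function with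
    vanishing integrals is zero. *)
Lemma lebesgue_rV_is_measure n :
  {mu : {sigma_finite_measure set 'rV[R]_n -> \bar R} |
    (forall A, measurable A -> lebesgue_rV A = mu A) /\
    forall a b : 'rV[R]_n, (mu (box a b) < +oo)%E /\
      ((forall j, a ord0 j < b ord0 j) -> (0 < mu (box a b))%E)}.
Proof.
apply: cid; elim: n => [|m [mu [muE mubox]]].
  have [|//||mu muE] := @sigma_finite_measure_of R _ _ (dirac (0 : 'rV[R]_0)) (fun=> setT).
  - by move=> k; exact: measurableT.
  - by apply/seteqP; split=> // x _; exists 0%N.
  - by move=> k; rewrite /= diracT ltry.
  exists mu; split; first by move=> A _; rewrite muE.
  move=> a b; rewrite muE /= diracE; split; first by case: (_ \in _); rewrite ltry.
  by move=> _; rewrite mem_set ?lte_fin// => -[].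
pose nu := pfm (lebesgue_measure \x mu)%E (@measurable_cons_rV m).
have nubox a b : nu (box a b) = (lebesgue_measure (`]a ord0 ord0, b ord0 ord0[%classic : set R) *
    mu (box (\row_j a ord0 (lift ord0 j)) (\row_j b ord0 (lift ord0 j))))%E.
  rewrite pfmE cons_rV_box.
  apply: (@product_measure1E _ _ (measurableTypeR R) _ _ lebesgue_measure mu) => //.
  by apply: (@measurable_box _ _ _ _ _ _ id) => j; exact: measurable_coord.
have nufin a b : (nu (box a b) < +oo)%E.
  rewrite nubox lebesgue_measure_itv/=; case: ifPn => [|_]; last by rewrite mul0e ltry.
  rewrite lte_fin => ab.
  have [h _] := mubox (\row_j a ord0 (lift ord0 j)) (\row_j b ord0 (lift ord0 j)).
  by rewrite -EFinB lte_mul_pinfty// lee_fin subr_ge0 ltW.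
have [|||mu' mu'E] := @sigma_finite_measure_of R _ _ nu cube.
- by move=> k; apply: (@measurable_box _ _ _ _ _ _ id) => j; exact: measurable_coord.
- exact: cube_cover.
- by move=> k; exact: nufin.
exists mu'; split => [A mA|a b]; first by rewrite mu'E (lebesgue_rV_cons muE).
rewrite mu'E; split=> [//|ab]; rewrite nubox lebesgue_measure_itv/= lte_fin ab -EFinB.
rewrite mule_gt0//; first by rewrite lte_fin subr_gt0.
by apply: (mubox _ _).2 => j; rewrite !mxE.
Qed.

Definition leb n : {sigma_finite_measure set 'rV[R]_n -> \bar R} :=
  sval (lebesgue_rV_is_measure n).

Lemma lebE n A : measurable A -> lebesgue_rV A = leb n A.
Proof. exact: (svalP (lebesgue_rV_is_measure n)).1. Qed.

Lemma leb_cons m (A : set 'rV[R]_m.+1) : measurable A ->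
  leb m.+1 A = pfm (lebesgue_measure \x leb m)%E (@measurable_cons_rV m) A.
Proof. by move=> mA; rewrite -lebE// (lebesgue_rV_cons (@lebE m)). Qed.

Lemma leb_box_gt0 n (a b : 'rV[R]_n) :
  (forall j, a ord0 j < b ord0 j) -> (0 < leb n (box a b))%E.
Proof. exact: ((svalP (lebesgue_rV_is_measure n)).2 a b).2. Qed.

Lemma leb_box_lty n (a b : 'rV[R]_n) : (leb n (box a b) < +oo)%E.
Proof. exact: ((svalP (lebesgue_rV_is_measure n)).2 a b).1. Qed.

Lemma cint_leb n (f : 'rV[R]_n -> R[i]) : cint (@lebesgue_rV R n) f = cint (leb n) f.
Proof.
by apply: complexP; rewrite /= /rint; congr fine; apply: eq_integral_raw => A;
  exact: lebE.
Qed.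

End lebesgue_rV_measure.

Section leb_fubini.
Context {R : realType}.

Lemma rintegrable_eq_measure d (T : measurableType d) (m1 m2 : {measure set T -> \bar R})
    (f : T -> R) : (forall A, measurable A -> m1 A = m2 A) ->
  rintegrable m1 f -> rintegrable m2 f.
Proof.
move=> m12 /integrableP[mf foo]; apply/integrableP; split=> //.
by rewrite -(eq_integral_raw _ m12).
Qed.

Lemma rint_eq_measure d (T : measurableType d) (m1 m2 : set T -> \bar R)
    (f : T -> R) : (forall A, measurable A -> m1 A = m2 A) ->
  rint m1 f = rint m2 f.
Proof. by move=> m12; rewrite /rint (eq_integral_raw _ m12). Qed.

Lemma cint_eq_measure d (T : measurableType d) (m1 m2 : set T -> \bar R)
    (f : T -> R[i]) : (forall A, measurable A -> m1 A = m2 A) ->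
  cint m1 f = cint m2 f.
Proof. by move=> m12; rewrite /cint !(rint_eq_measure _ m12). Qed.

Lemma rintegrable_pfm d1 d2 (T1 : measurableType d1) (T2 : measurableType d2)
    (P : {measure set T1 -> \bar R}) (phi : T1 -> T2) (mphi : measurable_fun setT phi)
    (f : T2 -> R) : measurable_fun setT f ->
  rintegrable (pfm P mphi) f <-> rintegrable P (f \o phi).
Proof.
move=> mf; have mfphi : measurable_fun setT (f \o phi) by exact: measurableT_comp.
have e : (\int[pfm P mphi]_x `|(f x)%:E| = \int[P]_x `|((f \o phi) x)%:E|)%E.
  rewrite ge0_integral_pushforward ?preimage_setT//.
  by apply: measurableT_comp => //; exact/measurable_EFinP.
split=> /integrableP[_ h]; apply/integrableP; split.
- exact/measurable_EFinP.
- by rewrite -e.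
- exact/measurable_EFinP.
- by rewrite e.
Qed.

Lemma rintegrable_leb_cons m (f : 'rV[R]_m.+1 -> R) : measurable_fun setT f ->
  rintegrable (leb m.+1) f <->
  rintegrable (lebesgue_measure \x leb m)%E (fun p => f (cons_rV p)).
Proof.
move=> mf; rewrite -(rintegrable_pfm _ (@measurable_cons_rV R m) mf).
by split; apply: rintegrable_eq_measure => A mA; [exact: leb_cons|exact/esym/leb_cons].
Qed.

Lemma cint_leb_cons m (f : 'rV[R]_m.+1 -> R[i]) : cintegrable (leb m.+1) f ->
  cint (leb m.+1) f =
  cint (@lebesgue_measure R) (fun t => cint (leb m) (fun x => f (cons_rV (t, x)))).
Proof.
move=> fi; have mf := cintegrable_cmeas fi.
have fi' : cintegrable (lebesgue_measure \x leb m)%E (fun p => f (cons_rV p)).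
  by case: fi => fR fI; split; [exact: (rintegrable_leb_cons mf.1).1|exact: (rintegrable_leb_cons mf.2).1].
rewrite (cint_eq_measure _ (@leb_cons R m)) (cint_pushforward (@measurable_cons_rV R m))//.
by have [_ ->] := cint_fubini1 fi'.
Qed.

Lemma weight_ge1 n (x : 'rV[R]_n) : 1 <= weight x.
Proof. by rewrite /weight lerDl sumr_ge0// => j _; rewrite -expr2 sqr_ge0. Qed.

Lemma weight_gt0 n (x : 'rV[R]_n) : 0 < weight x.
Proof. exact: lt_le_trans ltr01 (weight_ge1 x). Qed.

Lemma contD (X : topologicalType) (f g : X -> R) :
  continuous f -> continuous g -> continuous (fun x => f x + g x).
Proof.
by move=> cf cg x; exact: (@cvgD _ _ _ (nbhs x) (nbhs_filter x) f g _ _ (cf x) (cg x)).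
Qed.

Lemma contM (X : topologicalType) (f g : X -> R) :
  continuous f -> continuous g -> continuous (fun x => f x * g x).
Proof.
by move=> cf cg x; exact: (@cvgM _ _ (nbhs x) (nbhs_filter x) f g _ _ (cf x) (cg x)).
Qed.

Lemma continuous_dotv n : continuous (fun y : 'rV[R]_n => dotv y y).
Proof.
rewrite /dotv; elim: (index_enum _) => [|j s ih].
  by under eq_fun do rewrite big_nil; exact: cst_continuous.
under eq_fun do rewrite big_cons; apply: contD => //.
by apply: contM; exact: coord_continuous.
Qed.

Lemma continuous_weightX n N : continuous (fun x : 'rV[R]_n => weight x ^+ N).
Proof.
move=> x; apply: (@continuous_comp _ _ _ (@weight R n) (fun r => r ^+ N)); last exact: exprn_continuous.
by apply: (@contD _ (cst 1)); [exact: cst_continuous|exact: continuous_dotv].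
Qed.

Lemma weight_cons m (p : R * 'rV[R]_m) : weight (cons_rV p) = p.1 ^+ 2 + weight p.2.
Proof.
rewrite /weight /dotv big_ord_recl cons_rV0 -expr2 addrCA; congr (_ + (_ + _)).
by apply: eq_bigr => j _; rewrite cons_rVS.
Qed.

Lemma rintegrable_oneDsqrV : rintegrable (@lebesgue_measure R) (fun t : R => (1 + t ^+ 2)^-1).
Proof.
have cf : continuous (fun t : R => (1 + t ^+ 2)^-1) := continuous_oneDsqrV.
have f0 (t : R) : 0 <= (1 + t ^+ 2)^-1 by rewrite invr_ge0 addr_ge0// sqr_ge0.
apply/integrableP; split; first by apply/measurable_EFinP; exact: continuous_measurable_fun.
have -> : (\int[@lebesgue_measure R]_x `|((1 + x ^+ 2)^-1)%:E| =
    \int[@lebesgue_measure R]_x ((1 + x ^+ 2)^-1)%:E)%E.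
  by apply: eq_integral => x _; rewrite /= ger0_norm.
rewrite ge0_symfun_integralT//; last by move=> x /=; rewrite sqrrN.
rewrite -set_itvcy integral0y_oneDsqr; exact: ltry.
Qed.

(** One power per dimension: 1 + |x|^2 dominates each 1 + x_j^2, so the inverse power is bounded by
    a product of integrable functions of one variable. *)
Lemma rintegrable_weight n : rintegrable (leb n) (fun x : 'rV[R]_n => weight x ^- n).
Proof.
elim: n => [|m ih].
  under [X in rintegrable _ X]eq_fun do rewrite expr0 invr1.
  apply: measurable_bounded_integrable => //; last first.
    by exists 1; split=> // M M1 x _; rewrite normr1 ltW.
  have -> : [set: 'rV[R]_0] = box 0 0 by apply/seteqP; split=> // x _ [].
  exact: leb_box_lty.
have mw : measurable_fun setT (fun x : 'rV[R]_m.+1 => weight x ^- m.+1).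
  apply: continuous_measurable_rV => x.
  apply: (@cvgV _ _ (nbhs x)); first by rewrite lt0r_neq0// exprn_gt0// weight_gt0.
  exact: continuous_weightX.
apply/rintegrable_leb_cons => //.
apply: (rintegrable_le (rintegrable_prod rintegrable_oneDsqrV ih)).
  exact: (measurableT_comp mw (@measurable_cons_rV R m)).
move=> [t x] /=; rewrite weight_cons ger0_norm/=; last first.
  by rewrite invr_ge0 exprn_ge0// addr_ge0 ?sqr_ge0// ltW// weight_gt0.
rewrite -invfM lef_pV2 ?posrE ?mulr_gt0 ?exprn_gt0 ?weight_gt0//; last 2 first.
- by apply: lt_le_trans (weight_gt0 x) _; rewrite lerDr sqr_ge0.
- by apply: lt_le_trans ltr01 _; rewrite lerDl sqr_ge0.
rewrite [leRHS]exprS; apply: ler_pM.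
- by rewrite addr_ge0// sqr_ge0.
- by rewrite exprn_ge0// ltW// weight_gt0.
- by rewrite addrC lerD2l weight_ge1.
- have w0 : 0 <= weight x by exact/ltW/weight_gt0.
  have t0 := sqr_ge0 t.
  apply: lerXn2r; first by rewrite nnegrE.
    by rewrite nnegrE addr_ge0.
  by rewrite lerDr.
Qed.

End leb_fubini.

(** * Calculus of one real variable *)

Section line_calculus.
Context {R : realType}.
Local Notation mu := (@lebesgue_measure R).

Definition cis_derive (u : R -> R[i]) (t : R) (l : R[i]) :=
  is_derive t (1 : R) (fun s => complex.Re (u s)) (complex.Re l) /\
  is_derive t (1 : R) (fun s => complex.Im (u s)) (complex.Im l).

Lemma cis_deriveD u v t a b : cis_derive u t a -> cis_derive v t b ->
  cis_derive (fun s => u s + v s) t (a + b).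
Proof.
move=> [uR uI] [vR vI]; split.
  rewrite ReD; under eq_fun do rewrite ReD; exact: is_deriveD.
rewrite ImD; under eq_fun do rewrite ImD; exact: is_deriveD.
Qed.

Lemma cis_deriveM u v t a b : cis_derive u t a -> cis_derive v t b ->
  cis_derive (fun s => u s * v s) t (a * v t + u t * b).
Proof.
move=> [uR uI] [vR vI]; split.
  under eq_fun do rewrite ReM.
  apply: is_derive_eq (is_deriveB (is_deriveM uR vR) (is_deriveM uI vI)) _.
  by rewrite ReD !ReM /GRing.scale/=; ring.
under eq_fun do rewrite ImM.
apply: is_derive_eq (is_deriveD (is_deriveM uR vI) (is_deriveM uI vR)) _.
by rewrite ImD !ImM /GRing.scale/=; ring.
Qed.

Lemma cis_derive_cst c t : cis_derive (fun=> c) t 0.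
Proof. by split; exact: is_derive_cst. Qed.

Lemma cis_derive_real (f : R -> R) t l : is_derive t (1 : R) f l ->
  cis_derive (fun s => (f s)%:C) t l%:C.
Proof. by move=> h; split => //=; exact: is_derive_cst. Qed.

Lemma cis_derive_cexpi (a t : R) :
  cis_derive (fun s => cexpi (a * s)) t ((0 +i* a) * cexpi (a * t)).
Proof.
have d : is_derive t (1 : R) ( *%R a) a.
  by apply: is_derive_eq; rewrite /GRing.scale/= mulr1.
split => /=.
  apply: is_derive_eq (is_derive1_comp (is_derive_cos _) d) _.
  by rewrite mul0r sub0r mulNr mulrC.
apply: is_derive_eq (is_derive1_comp (is_derive_sin _) d) _.
by rewrite mul0r add0r mulrC.
Qed.

Lemma cis_derive_continuous u t l : cis_derive u t l -> (u s : R[i]^o) @[s --> t] --> (u t : R[i]^o).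
Proof.
move=> [uR uI]; apply/ccvgP; split.
  by apply: differentiable_continuous; apply/derivable1_diffP.
by apply: differentiable_continuous; apply/derivable1_diffP.
Qed.

Lemma measurable_fun_if_in d (T : measurableType d) (A : set T) (f : T -> R) :
  measurable A -> measurable_fun setT f ->
  measurable_fun setT (fun x => if x \in A then f x else 0).
Proof.
move=> mA mf; have [+ _] := cmeas_if mA (cmeas_real mf).
by congr (measurable_fun _ _); apply/funext => x; case: ifP.
Qed.

(** The fundamental theorem on the compact intervals [a n, b n], followed by dominated convergence
    as they exhaust [D]. The line and both half-lines are covered at once. *)
Lemma rint_FTC_lim (u u' : R -> R) (D : set R) (a b : nat -> R) (l : R) :
  (forall t, is_derive t (1 : R) u (u' t)) -> continuous u' ->
  measurable D -> (forall n, a n < b n) -> (forall n, `[a n, b n] `<=` D) ->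
  (forall t, D t -> \forall n \near \oo, t \in `[a n, b n]) ->
  rintegrable mu (fun t => if t \in D then u' t else 0) ->
  u (b n) - u (a n) @[n --> \oo] --> l ->
  rint mu (fun t => if t \in D then u' t else 0) = l.
Proof.
move=> du cu' mD ab abD Dab iu ul.
have mu' : measurable_fun setT u' by exact: continuous_measurable_fun.
pose h n t := if t \in `[a n, b n]%classic then u' t else 0.
have rh n : rint mu (h n) = u (b n) - u (a n).
  have cwu : {within `[a n, b n], continuous u'} by exact: continuous_subspaceT.
  have du' t : derivable u t (1 : R) by [].
  have := @continuous_FTC2 _ u' u (a n) (b n) (ab n) cwu.
  rewrite /rint => FTC.
  have -> : (\int[mu]_x (h n x)%:E = \int[mu]_(x in `[a n, b n]) (u' x)%:E)%E.
    rewrite [RHS]integral_mkcond; apply: eq_integral => x _.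
    by rewrite /h /restrict; case: ifP.
  have cu x : u y @[y --> x] --> u x.
    by apply: differentiable_continuous; apply/derivable1_diffP.
  rewrite FTC// => [|t _]; last by rewrite derive1E derive_val.
  by split; [|apply: cvg_at_right_filter|apply: cvg_at_left_filter].
have : rint mu (h n) @[n --> \oo] --> rint mu (fun t => if t \in D then u' t else 0).
  apply: (@rint_cvg _ _ _ mu h _ (fun t => `|if t \in D then u' t else 0|)).
  - by move=> n; apply: measurable_fun_if_in.
  - exact: measurable_fun_if_in.
  - exact: (integrable_norm iu).
  - move=> n x; rewrite /h; case: ifPn => [|_]; last by rewrite normr0.
    by rewrite inE => /abD xD; rewrite mem_set.
  - move=> t; rewrite /h; case: ifPn => [|tD].
      rewrite inE => /Dab[N _ NP]; apply: (cvg_near_cst (u' t)).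
      by exists N => // n /= /NP; rewrite /mkset => tn; rewrite mem_set.
    apply: (cvg_near_cst 0); apply: nearW => n.
    by case: ifP => //; rewrite inE => /abD tD'; rewrite mem_set in tD.
under eq_fun do rewrite rh.
by move=> /(cvg_unique _ ul) ->.
Qed.

Lemma measurable_translation (c : R) :
  measurable_fun setT (fun t : measurableTypeR R => t + c : measurableTypeR R).
Proof. by apply: measurable_funD. Qed.

Lemma lebesgue_measure_translation (c : R) (A : set R) : measurable A ->
  pfm mu (measurable_translation c) A = mu A.
Proof.
move=> mA; apply/esym; apply: (lebesgue_measure_unique (mu := pfm mu (measurable_translation c))) => //=.
move=> _ [[a b]] _ <-; rewrite /pushforward.
have -> : (fun t : R => t + c) @^-1` `]a, b] = `]a - c, b - c]%classic.
  by apply/seteqP; split => t /=; rewrite !in_itv/= ltrBlDr lerBrDr.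
rewrite lebesgue_measure_itv/= (lebesgue_measure_itv `]a - c, b - c])/= !lte_fin ltrD2r; case: ifP => // _.
by rewrite -!EFinB; congr EFin; ring.
Qed.

Lemma cint_translation (c : R) (f : R -> R[i]) :
  cmeas (f : measurableTypeR R -> R[i]) -> cintegrable mu (fun t => f (t + c)) ->
  cint mu (fun t => f (t + c)) = cint mu f.
Proof.
move=> mf fi; transitivity (cint (pfm mu (measurable_translation c)) f).
  by rewrite (cint_pushforward (measurable_translation c)).
by apply: cint_eq_measure => A mA; exact: lebesgue_measure_translation.
Qed.

Lemma exp_decay1 (k : R) : 0 < k -> exists C : R, forall r, 0 <= r ->
  expR (- (k * r)) * (1 + r ^+ 2) <= C.
Proof.
(* From e^(kr) >= (1 + kr/2)^2 >= 1 + (kr)^2/4 and (1 + 4/k^2) (1 + (kr)^2/4) >= 1 + r^2. *)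
move=> k0; exists (1 + 4 / k ^+ 2) => r r0.
rewrite expRN mulrC ler_pdivrMr ?expR_gt0//.
have h1 : 1 + k * r / 2 <= expR (k * r / 2) by exact: expR_ge1Dx.
have h2 : expR (k * r) = expR (k * r / 2) ^+ 2 by rewrite -expRM_natr; congr expR; field.
have kr0 : 0 <= k * r by rewrite mulr_ge0// ltW.
have h3 : 1 + (k * r) ^+ 2 / 4 <= expR (k * r).
  rewrite h2; apply: le_trans (_ : (1 + k * r / 2) ^+ 2 <= _).
    by rewrite sqrrD expr1n mul1r expr_div_n; nra.
  by rewrite lerXn2r ?nnegrE ?expR_ge0// addr_ge0// divr_ge0.
apply: le_trans (_ : (1 + 4 / k ^+ 2) * (1 + (k * r) ^+ 2 / 4) <= _); last first.
  by rewrite ler_wpM2l// addr_ge0// divr_ge0// sqr_ge0.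
have -> : (1 + 4 / k ^+ 2) * (1 + (k * r) ^+ 2 / 4) =
    1 + r ^+ 2 + (4 / k ^+ 2 + (k * r) ^+ 2 / 4).
  by field; rewrite gt_eqF.
by rewrite lerDl addr_ge0// divr_ge0// ?sqr_ge0.
Qed.

Lemma exp_decay (k : R) (M : nat) : 0 < k -> exists C : R, forall r, 0 <= r ->
  expR (- (k * r)) * (1 + r ^+ 2) ^+ M <= C.
Proof.
move=> k0; case: M => [|M].
  by exists 1 => r r0; rewrite expr0 mulr1 expR_le1 oppr_le0 mulr_ge0// ltW.
(* The rate is shared equally among the M + 1 factors 1 + r^2. *)
have kM : 0 < k / M.+1%:R by rewrite divr_gt0.
have [C CP] := exp_decay1 kM; exists (C ^+ M.+1) => r r0.
have -> : expR (- (k * r)) = expR (- (k / M.+1%:R * r)) ^+ M.+1.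
  by rewrite -expRM_natr; congr expR; field; rewrite ?pnatr_eq0 ?gt_eqF//.
rewrite -exprMn lerXn2r ?nnegrE ?mulr_ge0 ?expR_ge0 ?addr_ge0 ?sqr_ge0//.
- by apply: le_trans (CP r r0); rewrite mulr_ge0 ?expR_ge0 ?addr_ge0 ?sqr_ge0.
- exact: CP.
Qed.

End line_calculus.

(** * Complex Radon measures *)

Section bounded_sets.
Context {R : realType} {n : nat}.
Implicit Types A B : set 'rV[R]_n.

Lemma bounded_borelS A B : measurable B -> B `<=` A -> bounded_borel A -> bounded_borel B.
Proof. by move=> mB BA [mA [M AM]]; split=> //; exists M => x /BA; exact: AM. Qed.

Lemma bounded_borelU A B : bounded_borel A -> bounded_borel B -> bounded_borel (A `|` B).
Proof.
move=> [mA [M AM]] [mB [N BN]]; split; first exact: measurableU.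
exists (Num.max M N) => x [/AM|/BN] h; rewrite le_max h ?orbT//.
Qed.

Lemma bounded_borel0 : bounded_borel (set0 : set 'rV[R]_n).
Proof. by split=> //; exists 0. Qed.

Lemma dotv_ge0 (x : 'rV[R]_n) : 0 <= dotv x x.
Proof. by rewrite sumr_ge0// => j _; rewrite -expr2 sqr_ge0. Qed.

Lemma sqr_coord_le (x : 'rV[R]_n) j : x ord0 j ^+ 2 <= dotv x x.
Proof.
rewrite /dotv (bigD1 j)//= -expr2 lerDl sumr_ge0// => i _.
by rewrite -expr2 sqr_ge0.
Qed.

Lemma measurable_cube k : measurable (cube k : set 'rV[R]_n).
Proof.
by apply: (@measurable_box _ _ _ _ _ _ id) => j; exact: measurable_coord.
Qed.

Lemma bounded_borel_box (a b : 'rV[R]_n) : bounded_borel (box a b).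
Proof.
split; first by apply: (@measurable_box _ _ _ _ _ _ id) => j; exact: measurable_coord.
exists (\sum_j (`|a ord0 j| + `|b ord0 j|) ^+ 2) => x xab; apply: ler_sum => j _.
have /andP[h1 h2] := xab j; rewrite -expr2 -real_normK ?num_real//.
have h : `|x ord0 j| <= `|a ord0 j| + `|b ord0 j|.
  rewrite ler_norml; apply/andP; split.
    have := ler_norm (- a ord0 j); rewrite normrN; have := normr_ge0 (b ord0 j); lra.
  have := ler_norm (b ord0 j); have := normr_ge0 (a ord0 j); lra.
by apply: lerXn2r; rewrite ?nnegrE ?addr_ge0.
Qed.

Lemma bounded_borel_cube k : bounded_borel (cube k : set 'rV[R]_n).
Proof. exact: bounded_borel_box. Qed.

Lemma subset_cube (i j : nat) : (i <= j)%N -> cube i `<=` (cube j : set 'rV[R]_n).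
Proof.
move=> ij x xi k; have := xi k; rewrite !mxE => /andP[h1 h2].
have h : i.+1%:R <= j.+1%:R :> R by rewrite ler_nat.
by apply/andP; split; lra.
Qed.

Lemma bounded_borel_sub_cube A : bounded_borel A -> exists k, A `<=` cube k.
Proof.
move=> [_ [M AM]]; exists (Num.truncn `|M|) => x /AM xM j; rewrite !mxE -ltr_norml.
rewrite ltNge; apply/negP => kx; have := truncnS_gt `|M|; have := ler_norm M.
have := sqr_coord_le x j; rewrite -real_normK ?num_real//.
have : 1 <= (Num.truncn `|M|).+1%:R :> R by rewrite ler1n.
by move: kx; set k : R := _.+1%:R; set a := `|x ord0 j|; nra.
Qed.

Definition annulus (k : nat) : set 'rV[R]_n := seqDU cube k.

Lemma measurable_annulus k : measurable (annulus k).
Proof.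
apply: measurableD; first exact: measurable_cube.
by apply: bigsetU_measurable => i _; exact: measurable_cube.
Qed.

Lemma bounded_borel_annulus k : bounded_borel (annulus k).
Proof.
apply: bounded_borelS (bounded_borel_cube k); first exact: measurable_annulus.
by move=> x [].
Qed.

End bounded_sets.

Definition real_radon (R : realType) n (m : set 'rV[R]_n -> R) :=
  forall F : nat -> set 'rV[R]_n, (forall k, measurable (F k)) -> trivIset setT F ->
  bounded_borel (\bigcup_k F k) ->
  \sum_(k < p) m (F k) @[p --> \oo] --> m (\bigcup_k F k).

Section real_radon_theory.
Context {R : realType} {n : nat} (m : set 'rV[R]_n -> R) (rm : real_radon m).

(** The partial sums for the constant sequence of empty sets converge, and one further term does not
    change their limit. *)
Lemma real_radon0 : m set0 = 0.
Proof.
have h : \sum_(k < p) m set0 @[p --> \oo] --> m set0.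
  have := @rm (fun=> set0); rewrite (bigcup0 (fun _ _ => erefl)); apply => //.
    by apply/trivIsetP => i j _ _ _; rewrite setI0.
  exact: bounded_borel0.
have h1 : \sum_(k < p.+1) m set0 @[p --> \oo] --> m set0 by rewrite (cvg_shiftS (fun p => \sum_(k < p) m set0)).
have h2 : \sum_(k < p.+1) m set0 @[p --> \oo] --> m set0 + m set0.
  under eq_fun do rewrite big_ord_recr/=.
  by apply: cvgD => //; exact: cvg_cst.
have e := cvg_unique (@Rhausdorff R) h1 h2.
by apply: (addrI (m set0)); rewrite addr0 -e.
Qed.

Lemma real_radonU A B : bounded_borel A -> bounded_borel B -> A `&` B = set0 ->
  m (A `|` B) = m A + m B.
Proof.
move=> bA bB AB; have := @rm (bigcup2 A B); rewrite bigcup2E => /(_ _ _ _) h.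
have {}h : \sum_(k < p) m (bigcup2 A B k) @[p --> \oo] --> m (A `|` B).
  apply: h; last exact: bounded_borelU.
  - by move=> [|[|k]] //=; [exact: bA.1|exact: bB.1].
  - apply/trivIsetP => -[|[|i]] [|[|j]] _ _ //=; rewrite ?set0I ?setI0//.
    by rewrite setIC.
rewrite -(cvg_shiftn 2) in h.
have e : (fun p => \sum_(k < p + 2) m (bigcup2 A B k)) = cst (m A + m B).
  apply/funext => p; rewrite addn2 2!big_ord_recl/= big1 ?addr0// => i _.
  by rewrite /= real_radon0.
have h' : \sum_(k < p + 2) m (bigcup2 A B k) @[p --> \oo] --> m A + m B.
  by rewrite e; exact: cvg_cst.
exact: (cvg_unique (@Rhausdorff R) h h').
Qed.

Lemma real_radon_sum (F : nat -> set 'rV[R]_n) p : (forall k, bounded_borel (F k)) ->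
  trivIset setT F ->
  bounded_borel (\big[setU/set0]_(k < p) F k) /\
  m (\big[setU/set0]_(k < p) F k) = \sum_(k < p) m (F k).
Proof.
move=> bF tF; elim: p => [|p [ihb ih]].
  by rewrite !big_ord0 real_radon0; split=> //; exact: bounded_borel0.
rewrite !big_ord_recr/=; split; first exact: bounded_borelU.
rewrite real_radonU ?ih//.
apply/seteqP; split=> // x []; rewrite -bigcup_mkord => -[k /= kp Fk] Fp.
have /trivIsetP/(_ k p Logic.I Logic.I) := tF.
by rewrite (ltn_eqF kp) => /(_ isT) e; suff : set0 x by []; rewrite -e.
Qed.

Lemma real_radonN : real_radon (fun A => - m A).
Proof.
move=> F mF tF bF; under eq_fun do rewrite sumrN.
by apply: cvgN; exact: rm.
Qed.

(** Values of [m] on unbounded sets are meaningless, so [m] itself is not a charge. Its restriction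
    to a bounded annulus is one, and Hahn's theorem applies there. *)
Definition ann_charge k (A : set 'rV[R]_n) : \bar R := (m (A `&` annulus k))%:E.

Let ann_charge0 k : ann_charge k set0 = 0%E.
Proof. by rewrite /ann_charge set0I real_radon0. Qed.

Let ann_charge_fin k A : measurable A -> ann_charge k A \is a fin_num.
Proof. by []. Qed.

Let ann_charge_sigma k : semi_sigma_additive (ann_charge k).
Proof.
move=> F mF tF mUF.
have -> : (fun p => \sum_(0 <= i < p) ann_charge k (F i))%E =
    (fun p => (\sum_(i < p) m (F i `&` annulus k))%:E).
  by apply/funext => p; rewrite /ann_charge sumEFin big_mkord.
apply: cvg_EFin; first exact: nearW.
rewrite /ann_charge setI_bigcupl; apply: rm.
- by move=> i; apply: measurableI => //; exact: measurable_annulus.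
- exact: trivIset_setIr.
- rewrite -setI_bigcupl; apply: bounded_borelS (bounded_borel_annulus k) => //.
  by apply: measurableI => //; exact: measurable_annulus.
Qed.

HB.instance Definition _ k := isCharge.Build _ _ _ (ann_charge k)
  (ann_charge0 k) (@ann_charge_fin k) (@ann_charge_sigma k).

(** The measure is the sum over the annuli of the Jordan positive parts. It dominates [m] on bounded
    sets, which meet finitely many annuli, and it is approached by the values of [m] on finite
    unions of Hahn positive sets. So it is the supremum defining [pos_variation]. *)
Lemma pos_variation_measure : {P : {measure set 'rV[R]_n -> \bar R} |
  (forall A, measurable A -> pos_variation m A = P A) /\
  forall A, bounded_borel A -> (P A < +oo)%E}.
Proof.
apply: cid.
have /choice[PN hPN] : forall k, exists PN, hahn_decomposition (ann_charge k) PN.1 PN.2.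
  by move=> k; have [P [N h]] := Hahn_decomposition (ann_charge k); exists (P, N).
pose J k : {measure set 'rV[R]_n -> \bar R} := jordan_pos (hPN k).
pose P := mseries J 0.
have mPN k : measurable (PN k).1 by have [[]] := hPN k.
have JE k A : measurable A -> J k A = (m (A `&` (PN k).1 `&` annulus k))%:E.
  by move=> mA; have := jordan_posE (hPN k) A; rewrite cjordan_posE /crestr0 mem_set.
have annJ k A : measurable A -> ((m (A `&` annulus k))%:E <= J k A)%E.
  move=> mA; rewrite -[leLHS]/(ann_charge k A) (jordan_decomp (hPN k) mA).
  by rewrite /cadd/= cscaleN1 geeDl// oppe_le0.
have cubeE K : cube K = \big[setU/set0]_(k < K.+1) annulus k :> set 'rV[R]_n.
  rewrite /annulus -(bigsetU_seqDU cube K.+1) -bigcup_mkord.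
  apply/seteqP; split => [x xK|x [k /= kK]]; first by exists K => /=.
  by apply: subset_cube; rewrite -ltnS.
have mJ_bounded K A : measurable A -> A `<=` cube K ->
    (m A)%:E = (\sum_(k < K.+1) (m (A `&` annulus k))%:E)%E.
  move=> mA AK; rewrite sumEFin; congr EFin.
  have bF k : bounded_borel (A `&` annulus k).
    apply: bounded_borelS (bounded_borel_annulus k) => //.
    by apply: measurableI => //; exact: measurable_annulus.
  have tF : trivIset setT (fun k => A `&` annulus k).
    by apply: trivIset_setIl; exact: trivIset_seqDU.
  have [_ <-] := real_radon_sum K.+1 bF tF.
  by rewrite -big_distrr/= -cubeE; congr m; apply/esym/setIidPl.
have Psum K A : measurable A -> (\sum_(k < K) J k A <= P A)%E.
  move=> mA; rewrite /P /mseries -(big_mkord xpredT (fun k => J k A)).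
  exact: nneseries_lim_ge.
exists P; split=> [A mA|A bA].
  apply/eqP; rewrite eq_le; apply/andP; split.
    apply: ge_ereal_sup => _ [B [bB BA] <-].
    have [K BK] := bounded_borel_sub_cube bB.
    rewrite (mJ_bounded K)//; last exact: bB.1.
    apply: le_trans (Psum K.+1 A mA); apply: lee_sum => k _.
    apply: le_trans (annJ k B bB.1) _.
    by apply: le_measure; rewrite ?inE//; exact: bB.1.
  (* A partial sum over [K] annuli is the value of [m] on a bounded subset of [A]: the union of the
     Hahn positive parts of [A]. *)
  rewrite /P /mseries; apply: lime_le; first exact: is_cvg_nneseries.
  apply: nearW => K; rewrite big_mkord.
  under eq_bigr do rewrite JE//.
  pose F k := A `&` (PN k).1 `&` annulus k.
  have bF k : bounded_borel (F k).
    apply: bounded_borelS (bounded_borel_annulus k); last by move=> x [].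
    by apply: measurableI; [exact: measurableI|exact: measurable_annulus].
  have tF : trivIset setT F by apply: trivIset_setIl; exact: trivIset_seqDU.
  have [bU mU] := real_radon_sum K bF tF.
  rewrite sumEFin -mU; apply: ereal_sup_ubound => /=.
  exists (\big[setU/set0]_(k < K) F k) => //; split => //.
  by rewrite -bigcup_mkord => x [k _ [[]]].
have [K AK] := bounded_borel_sub_cube bA.
(* A bounded set misses all but finitely many annuli, so its mass is a finite sum of finite
   terms. *)
have J0 k : (K < k)%N -> J k A = 0%E.
  move=> Kk; rewrite JE ?bA.1//; last exact: bA.1.
  have -> : A `&` (PN k).1 `&` annulus k = set0; last by rewrite real_radon0.
  apply/seteqP; split=> // x [[Ax _] [_]]; apply.
  by rewrite -bigcup_mkord; exists K => //=; exact: AK.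
have PA : P A = (\sum_(k < K.+1) J k A)%E.
  rewrite /P /mseries (nneseries_split 0 K.+1)// add0n big_mkord eseries0 ?adde0//.
  by move=> i Ki _; exact: J0.
have PAoo : (P A < +oo)%E.
  rewrite PA; under eq_bigr do rewrite (JE _ _ bA.1).
  by rewrite sumEFin ltry.
exact: PAoo.
Qed.

Lemma real_radonD A B : bounded_borel A -> measurable B -> B `<=` A ->
  m (A `\` B) = m A - m B.
Proof.
move=> bA mB BA; have bB := bounded_borelS mB BA bA.
have mAB : measurable (A `\` B) by apply: measurableD => //; exact: bA.1.
have bAB : bounded_borel (A `\` B) by apply: bounded_borelS bA => // x [].
have {2}-> : A = A `\` B `|` B by rewrite setUC setDUK.
rewrite (real_radonU bAB bB) ?addrK//.
by apply/seteqP; split=> // x [[]].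
Qed.

End real_radon_theory.

(** Complements exchange the two suprema: - m B = m (A \ B) - m A for B inside A. One inequality
    follows, and applying it to - m gives the other. *)
Lemma pos_variation_decomp (R : realType) n (m : set 'rV[R]_n -> R) A :
  real_radon m -> bounded_borel A ->
  pos_variation (fun A => - m A) A = (pos_variation m A - (m A)%:E)%E.
Proof.
move=> rm bA.
have h (m' : set 'rV[R]_n -> R) : real_radon m' ->
    (pos_variation (fun A => (- m' A)%R) A <= pos_variation m' A - (m' A)%:E)%E.
  move=> rm'; apply: ge_ereal_sup => _ [B [bB BA] <-].
  rewrite leeBrDr// -EFinD addrC -(real_radonD rm' bA bB.1 BA).
  apply: ereal_sup_ubound; exists (A `\` B) => //; split; last by move=> x [].
  apply: bounded_borelS (bA); last by move=> x [].
  by apply: measurableD; [exact: bA.1|exact: bB.1].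
apply/eqP; rewrite eq_le h//=.
have := h _ (real_radonN rm).
have -> : (fun A => - - m A) = m by apply/funext => B; rewrite opprK.
by rewrite EFinN oppeK leeBlDr.
Qed.

(** * Measures with a density *)

Section density.
Context {R : realType} d (T : measurableType d) (P : {measure set T -> \bar R}).
Variables (w : T -> R) (mw : measurable_fun setT w) (w0 : forall x, 0 <= w x).
Local Open Scope ereal_scope.

Definition dens (A : set T) : \bar R := \int[P]_(x in A) (w x)%:E.

Let dens0 : dens set0 = 0. Proof. by rewrite /dens integral_set0. Qed.

Let dens_ge0 A : 0 <= dens A.
Proof. by apply: integral_ge0 => x _; rewrite lee_fin. Qed.

Let mwE (D : set T) : measurable_fun D (EFin \o w).
Proof. by apply/measurable_EFinP; exact: measurable_funTS. Qed.

Let dens_sigma_additive : semi_sigma_additive dens.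
Proof.
move=> F mF tF mUF; rewrite /dens ge0_integral_bigcup//; last by move=> x _; rewrite lee_fin.
by apply: is_cvg_nneseries => n _ _; exact: dens_ge0.
Qed.

HB.instance Definition _ := isMeasure.Build _ _ _ dens
  dens0 dens_ge0 dens_sigma_additive.

Definition densm : {measure set T -> \bar R} := dens.

Import HBNNSimple.

(** By monotone convergence it is enough to treat simple functions, where the level sets bring back
    the definition of [dens]. *)
Lemma ge0_integral_densm (f : T -> \bar R) : (forall x, 0 <= f x) ->
  measurable_fun setT f ->
  \int[densm]_x f x = \int[P]_x (f x * (w x)%:E).
Proof.
move=> f0 mf; pose h := nnsfun_approx measurableT mf.
have hf x : EFin (h n x) @[n --> \oo] --> f x.
  by apply: cvg_nnsfun_approx.
transitivity (limn (fun n => \int[densm]_x (EFin \o h n) x)).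
  rewrite -monotone_convergence//.
  - by apply: eq_integral => x _; apply/esym/cvg_lim => //; exact: hf.
  - by move=> n; apply/measurable_EFinP.
  - by move=> n x _; rewrite lee_fin.
  - by move=> x _ a b ab; rewrite lee_fin; exact/lefP/nd_nnsfun_approx.
transitivity (limn (fun n => \int[P]_x ((h n x)%:E * (w x)%:E))); last first.
  rewrite -monotone_convergence//.
  - apply: eq_integral => x _; apply/cvg_lim => //.
    by apply: cvgeZr => //; exact: hf.
  - by move=> n; apply: emeasurable_funM => //; apply/measurable_EFinP.
  - by move=> n x _; rewrite mule_ge0// lee_fin.
  - move=> x _ a b ab; rewrite lee_wpmul2r ?lee_fin//.
    exact/lefP/nd_nnsfun_approx.
congr (limn _); apply/funext => n.
transitivity (\sum_(r \in range (h n)) r%:E * densm (h n @^-1` [set r])).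
  by rewrite -sintegralE -integralT_nnsfun.
have mind r : measurable_fun setT (fun x => (r * \1_(h n @^-1` [set r]) x)%:E).
  by apply/measurable_EFinP; exact: measurable_funM.
transitivity (\int[P]_x (\sum_(r \in range (h n)) (r * \1_(h n @^-1` [set r]) x)%:E * (w x)%:E)).
  rewrite ge0_integral_fsum//; last 2 first.
  - by move=> r; apply: emeasurable_funM.
  - by move=> r x _; apply: mule_ge0; [exact: nnfun_muleindic_ge0|rewrite lee_fin].
  apply: eq_fsbigr => r; rewrite inE => -[t _ rE].
  under eq_integral do rewrite EFinM -muleA.
  rewrite ge0_integralZl//.
  - under eq_integral do rewrite muleC.
    rewrite (eq_integral ((fun x => (w x)%:E) \_ (h n @^-1` [set r]))); last first.
      by move=> x xE; rewrite epatch_indic.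
    by rewrite /densm/= /dens -[in RHS]integral_mkcond.
  - by apply: emeasurable_funM => //; exact/measurable_EFinP.
  - by move=> x _; rewrite mule_ge0 ?lee_fin.
  - by rewrite -rE lee_fin.
apply: eq_integral => x _; rewrite -ge0_mule_fsuml => [|y]; last exact: nnfun_muleindic_ge0.
by rewrite fsumEFin// -fimfunE.
Qed.

Lemma rintegrable_densm (f : T -> R) : measurable_fun setT f ->
  rintegrable P (fun x => f x * w x)%R -> rintegrable densm f.
Proof.
move=> mf /integrableP[_ foo]; apply/integrableP; split; first exact/measurable_EFinP.
rewrite ge0_integral_densm//=; last by do 2 apply: measurableT_comp => //.
apply: le_lt_trans foo; rewrite le_eqVlt; apply/orP; left; apply/eqP.
by apply: eq_integral => x _; rewrite /= -EFinM normrM (ger0_norm (w0 _)).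
Qed.

Lemma rint_densm (f : T -> R) : measurable_fun setT f ->
  rintegrable P (fun x => f x * w x)%R ->
  rint densm f = rint P (fun x => f x * w x)%R.
Proof.
move=> mf ifw; rewrite /rint integralE [in RHS]integralE; congr (fine (_ - _)).
  rewrite ge0_integral_densm//; last by apply: measurable_funepos; exact/measurable_EFinP.
  by apply: eq_integral => x _; rewrite !funeposE -!EFin_max -EFinM maxr_pMl ?mul0r.
rewrite ge0_integral_densm//; last by apply: measurable_funeneg; exact/measurable_EFinP.
by apply: eq_integral => x _; rewrite !funenegE -!EFinN -!EFin_max -EFinM maxr_pMl ?mul0r ?mulNr.
Qed.

End density.

Section difference_of_measures.
Context {R : realType} {n : nat}.
Variables (m : set 'rV[R]_n -> R) (p q : {measure set 'rV[R]_n -> \bar R}).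
Hypotheses (pfin : forall A, bounded_borel A -> (p A < +oo)%E)
  (qfin : forall A, bounded_borel A -> (q A < +oo)%E)
  (mpq : forall A, bounded_borel A -> m A = fine (p A) - fine (q A)).

Lemma bounded_borel_series (r : {measure set 'rV[R]_n -> \bar R}) (F : nat -> set 'rV[R]_n) :
  (forall A, bounded_borel A -> (r A < +oo)%E) ->
  (forall k, measurable (F k)) -> trivIset setT F -> bounded_borel (\bigcup_k F k) ->
  \sum_(k < i) fine (r (F k)) @[i --> \oo] --> fine (r (\bigcup_k F k)).
Proof.
move=> rfin mF tF bF.
have -> : (fun i => \sum_(k < i) fine (r (F k))) =
    (fun i => fine (\sum_(0 <= k < i) r (F k))%E).
  apply/funext => i; rewrite -[LHS]/(fine (\sum_(k < i) fine (r (F k)))%:E); congr fine.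
  rewrite -sumEFin big_mkord; apply: eq_bigr => k _.
  rewrite fineK// ge0_fin_numE// rfin//; apply: bounded_borelS (bF) => //.
  exact: bigcup_sup.
apply: fine_cvg; rewrite fineK ?ge0_fin_numE ?rfin//.
by apply: measure_semi_sigma_additive => //; exact: bF.1.
Qed.

Lemma real_radon_difference : real_radon m.
Proof.
move=> F mF tF bF; rewrite mpq//.
have -> : (fun i => \sum_(k < i) m (F k)) =
    (fun i => \sum_(k < i) fine (p (F k)) - \sum_(k < i) fine (q (F k))).
  apply/funext => i; rewrite -sumrB; apply: eq_bigr => k _; apply: mpq.
  by apply: bounded_borelS (bF) => //; exact: bigcup_sup.
by apply: cvgB; exact: bounded_borel_series.
Qed.

(** [signed_int] uses the Jordan parts of [m], which may be strictly smaller than [p] and [q]. They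
    satisfy m^+ + q = m^- + p, and integrating this identity and rearranging gives the claim.
    Integrability passes to the Jordan parts because they lie below [p] and [q]. *)
Lemma signed_int_difference (f : 'rV[R]_n -> R) :
  rintegrable p f -> rintegrable q f -> signed_int m f = rint p f - rint q f.
Proof.
move=> ip iq; have rm := real_radon_difference.
have [Pm [PmE Pmfin]] := pos_variation_measure rm.
have [Nm [NmE Nmfin]] := pos_variation_measure (real_radonN rm).
have mf : measurable_fun setT (EFin \o f) by exact: measurable_int ip.
have Pp A : measurable A -> (Pm A <= p A)%E.
  move=> mA; rewrite -PmE//; apply: ge_ereal_sup => _ [B [bB BA] <-].
  apply: le_trans (_ : p B <= _)%E; last by apply: le_measure; rewrite ?inE//; exact: bB.1.
  rewrite mpq// -[leRHS]fineK ?ge0_fin_numE ?pfin// lee_fin gerBl.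
  by rewrite fine_ge0.
have Nq A : measurable A -> (Nm A <= q A)%E.
  move=> mA; rewrite -NmE//; apply: ge_ereal_sup => _ [B [bB BA] <-].
  apply: le_trans (_ : q B <= _)%E; last by apply: le_measure; rewrite ?inE//; exact: bB.1.
  rewrite mpq// -[leRHS]fineK ?ge0_fin_numE ?qfin// lee_fin opprB gerBl.
  by rewrite fine_ge0.
have bal A : bounded_borel A -> measure_add Pm q A = measure_add Nm p A.
  move=> bA; rewrite !measure_addE -NmE ?(pos_variation_decomp rm bA)//; last exact: bA.1.
  rewrite -PmE//; last exact: bA.1.
  rewrite -[q A]fineK ?ge0_fin_numE ?qfin// -[p A]fineK ?ge0_fin_numE ?pfin//.
  have := Pmfin _ bA; rewrite -PmE; last exact: bA.1.
  have : (0 <= pos_variation m A)%E by rewrite PmE//; exact: bA.1.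
  case: (pos_variation m A) => [r| |]// _ _.
  by rewrite (mpq bA) -!EFinD; congr EFin; ring.
have iP : rintegrable Pm f.
  apply/integrableP; split=> //; have /integrableP[_] := ip.
  apply: le_lt_trans; apply: ge0_le_measure_integral => //.
  exact: measurableT_comp.
have iN : rintegrable Nm f.
  apply/integrableP; split=> //; have /integrableP[_] := iq.
  apply: le_lt_trans; apply: ge0_le_measure_integral => //.
  exact: measurableT_comp.
(* Written with sums, the identity has no infinite differences; boxes then extend it from bounded
   sets to all Borel sets. *)
have balT A : measurable A -> measure_add Pm q A = measure_add Nm p A.
  apply: measure_rV_unique => [a b|k]; first by apply: bal; exact: bounded_borel_box.
  rewrite -[X in (X < _)%E]/(measure_add Pm q (cube k)) measure_addE lte_add_pinfty//.
    by apply: Pmfin; exact: bounded_borel_cube.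
  by apply: qfin; exact: bounded_borel_cube.
have : rint Pm f + rint q f = rint Nm f + rint p f.
  rewrite /rint -!fineD ?integrable_fin_num//.
  rewrite -!integral_measure_add//.
  by rewrite (eq_integral_raw _ balT).
rewrite /signed_int (rint_eq_measure f PmE) (rint_eq_measure f NmE).
by move/eqP; rewrite addrC -subr_eq => /eqP <-; ring.
Qed.

End difference_of_measures.

(* The encoding of complex Radon measures used throughout: mu is the image under
   pi of the complex measure u P.  Unlike mu itself, P and u are defined globally,
   so Fubini's theorem and dominated convergence apply. *)
Definition presentation (R : realType) n d (Y : measurableType d)
    (P : {measure set Y -> \bar R}) (pi : Y -> 'rV[R]_n) (u : Y -> R[i]) (N : nat)
    (mu : set 'rV[R]_n -> R[i]) :=
  [/\ measurable_fun setT pi, cmeas u,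
      rintegrable P (fun y => Normc.normc (u y) * weight (pi y) ^- N) &
      forall A, bounded_borel A -> mu A = cint P (fun y => if pi y \in A then u y else 0)].

Section presentation_theory.
Context {R : realType} {n : nat} d (Y : measurableType d).
Variables (P : {measure set Y -> \bar R}) (pi : Y -> 'rV[R]_n) (N : nat).
Hypothesis mpi : measurable_fun setT pi.

Section real_part.
Variable (v : Y -> R).
Hypotheses (mv : measurable_fun setT v)
  (iv : rintegrable P (fun y => `|v y| * weight (pi y) ^- N)).

Definition vpos y := Num.max (v y) 0.
Definition vneg y := Num.max (- v y) 0.
Lemma vpos_ge0 y : 0 <= vpos y. Proof. by rewrite le_max lexx orbT. Qed.
Lemma vneg_ge0 y : 0 <= vneg y. Proof. by rewrite le_max lexx orbT. Qed.
Lemma measurable_vpos : measurable_fun setT vpos.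
Proof. exact: measurable_maxr. Qed.
Lemma measurable_vneg : measurable_fun setT vneg.
Proof. by apply: measurable_maxr => //; exact: measurable_funN. Qed.
Lemma vposBneg y : vpos y - vneg y = v y.
Proof. by rewrite /vpos /vneg; case: (lerP (v y) 0); case: (lerP (- v y) 0); lra. Qed.
Lemma vpos_le y : vpos y <= `|v y|.
Proof. by rewrite /vpos ge_max ler_norm normr_ge0. Qed.
Lemma vneg_le y : vneg y <= `|v y|.
Proof. by rewrite /vneg ge_max -normrN ler_norm normr_ge0. Qed.

Definition ppos := pfm (densm P measurable_vpos vpos_ge0) mpi.
Definition pneg := pfm (densm P measurable_vneg vneg_ge0) mpi.

End real_part.

Lemma rintegrable_pfm_densm (w : Y -> R) (mw : measurable_fun setT w)
    (w0 : forall y, 0 <= w y) (f : 'rV[R]_n -> R) : measurable_fun setT f ->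
  rintegrable P (fun y => f (pi y) * w y) ->
  rintegrable (pfm (densm P mw w0) mpi) f /\
  rint (pfm (densm P mw w0) mpi) f = rint P (fun y => f (pi y) * w y).
Proof.
move=> mf ifw; have mfpi : measurable_fun setT (f \o pi) by exact: measurableT_comp.
have h : rintegrable (densm P mw w0) (f \o pi) by exact: rintegrable_densm.
split; first exact/rintegrable_pfm.
by rewrite (rint_pushforward mpi)// rint_densm.
Qed.

End presentation_theory.

Import HBNNSimple.

Section raw_integral.
Context {R : realType} d (T : measurableType d).
Local Open Scope ereal_scope.

Lemma sintegral_raw (m : set T -> \bar R) (h : {nnsfun T >-> R}) : m set0 = 0 ->
  sintegral m h = \sum_(x \in range h) x%:E * m (h @^-1` [set x]).
Proof.
move=> m0; rewrite sintegralET (fsbig_widen (range h) setT)//= => x [_ Nfx] /=.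
by rewrite preimage10// m0 mule0.
Qed.

(** [total_variation] and [pos_variation] enter integrals as bare set functions; the comparison is
    made on the level sets of simple functions. The value 0 on the empty set discards the empty
    level sets. *)
Lemma le_integral_raw (m1 m2 : set T -> \bar R) (f : T -> \bar R) :
  m1 set0 = 0 -> m2 set0 = 0 ->
  (forall A, measurable A -> 0 <= m1 A) -> (forall A, measurable A -> m1 A <= m2 A) ->
  (forall x, 0 <= f x) -> integral m1 setT f <= integral m2 setT f.
Proof.
move=> m10 m20 m1ge m12 f0.
rewrite /integral patch_setT.
have -> : f^\- = cst 0 by apply/funext => x; rewrite funenegE max_r// leeNl oppe0.
have z (m : set T -> \bar R) : m set0 = 0 -> ereal_sup [set sintegral m h | h in
    [set h : {nnsfun T >-> R} | forall x, ((h x)%:E <= cst 0 x)%E]] = 0.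
  move=> m0; suff -> : [set sintegral m h | h in [set h : {nnsfun T >-> R} |
      forall x, ((h x)%:E <= cst 0 x)%E]] = [set 0] by rewrite ereal_sup1.
  have s0 (h : {nnsfun T >-> R}) : (forall x, h x = 0%R) -> sintegral m h = 0.
    move=> h0; rewrite sintegral_raw// fsbig1// => r [x _ <-].
    by rewrite h0 mul0e.
  apply/seteqP; split=> [_ [h /= h0 <-]|_ ->].
    by apply: s0 => x; apply/eqP; rewrite eq_le; have := h0 x; rewrite lee_fin => -> /=.
  by exists nnsfun0; [move=> x /=|exact: s0].
rewrite !z// !sube0; apply: ge_ereal_sup => _ [h hf <-].
apply: le_ereal_sup_tmp; exists (sintegral m2 h); first by exists h.
rewrite !sintegral_raw//; apply: lee_fsum => // r [t _ <-].
by rewrite lee_wpmul2l ?lee_fin// m12.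
Qed.

End raw_integral.

Lemma measurable_weightV (R : realType) n N :
  measurable_fun setT (fun x : 'rV[R]_n => weight x ^- N).
Proof.
apply: continuous_measurable_rV => x.
apply: (@cvgV _ _ (nbhs x)); first by rewrite lt0r_neq0// exprn_gt0// weight_gt0.
exact: continuous_weightX.
Qed.

Lemma weightV_ge0 (R : realType) n N (x : 'rV[R]_n) : 0 <= weight x ^- N.
Proof. by rewrite invr_ge0 exprn_ge0// ltW// weight_gt0. Qed.

Section presentation_mint.
Context {R : realType} {n : nat} d (Y : measurableType d).
Variables (P : {measure set Y -> \bar R}) (pi : Y -> 'rV[R]_n) (N : nat).
Hypothesis mpi : measurable_fun setT pi.

Lemma measurable_fun_restrict (A : set 'rV[R]_n) (w : Y -> R) :
  measurable A -> measurable_fun setT w ->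
  measurable_fun setT (fun y => if pi y \in A then w y else 0).
Proof.
move=> mA mw; have mB : measurable (pi @^-1` A).
  by rewrite -[X in measurable X]setTI; exact: mpi.
by have := measurable_fun_if_in mB mw; congr (measurable_fun _ _).
Qed.

Lemma rintegrable_restrict (A : set 'rV[R]_n) (w v : Y -> R) :
  bounded_borel A -> measurable_fun setT w ->
  rintegrable P (fun y => v y * weight (pi y) ^- N) -> (forall y, `|w y| <= v y) ->
  rintegrable P (fun y => if pi y \in A then w y else 0).
Proof.
move=> [mA [M AM]] mw iv wv.
(* On [A] the weight is at most 1 + |M|, so the factor (1 + |M|)^N makes up for the inverse power of
   the weight. *)
apply: (rintegrable_le (rintegrableZ ((1 + `|M|) ^+ N) iv)).
  exact: measurable_fun_restrict.
move=> y; have v0 : 0 <= v y by exact: le_trans (normr_ge0 _) (wv y).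
have wN0 : 0 < weight (pi y) ^+ N by rewrite exprn_gt0// weight_gt0.
case: ifPn => [|_]; last first.
  rewrite normr0; apply: mulr_ge0; first by rewrite exprn_ge0// addr_ge0.
  by apply: mulr_ge0 => //; exact: weightV_ge0.
rewrite inE => /AM yM; apply: le_trans (wv y) _.
rewrite mulrCA ler_peMr// ler_pdivlMr// mul1r.
have wM : weight (pi y) <= 1 + `|M| by rewrite lerD2l (le_trans yM)// ler_norm.
apply: lerXn2r => //; first exact/ltW/weight_gt0.
exact: addr_ge0.
Qed.

Lemma pfm_densm_bounded (A : set 'rV[R]_n) (w : Y -> R) (mw : measurable_fun setT w)
    (w0 : forall y, 0 <= w y) :
  measurable A -> rintegrable P (fun y => if pi y \in A then w y else 0) ->
  pfm (densm P mw w0) mpi A = (rint P (fun y => if pi y \in A then w y else 0))%:E.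
Proof.
move=> mA iw; rewrite /rint fineK; last exact: integrable_fin_num.
rewrite pfmE /densm /= /dens integral_mkcond; apply: eq_integral => y _.
by rewrite /restrict/= ; case: ifPn; case: ifPn => //; rewrite !inE notin_setE.
Qed.

Section real_presentation.
Variables (v : Y -> R) (m : set 'rV[R]_n -> R).
Hypotheses (mv : measurable_fun setT v)
  (iv : rintegrable P (fun y => `|v y| * weight (pi y) ^- N))
  (mE : forall A, bounded_borel A -> m A = rint P (fun y => if pi y \in A then v y else 0)).

Let p := ppos P mpi mv.
Let q := pneg P mpi mv.

Let ip A : bounded_borel A -> rintegrable P (fun y => if pi y \in A then vpos v y else 0).
Proof.
move=> bA; apply: rintegrable_restrict iv _ => //; first exact: measurable_vpos.
by move=> y; rewrite ger0_norm ?vpos_ge0// vpos_le.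
Qed.

Let iq A : bounded_borel A -> rintegrable P (fun y => if pi y \in A then vneg v y else 0).
Proof.
move=> bA; apply: rintegrable_restrict iv _ => //; first exact: measurable_vneg.
by move=> y; rewrite ger0_norm ?vneg_ge0// vneg_le.
Qed.

Let pfin A : bounded_borel A -> (p A < +oo)%E.
Proof. by move=> bA; rewrite /p /ppos pfm_densm_bounded ?ltry//; [exact: bA.1|exact: ip]. Qed.

Let qfin A : bounded_borel A -> (q A < +oo)%E.
Proof. by move=> bA; rewrite /q /pneg pfm_densm_bounded ?ltry//; [exact: bA.1|exact: iq]. Qed.

Let mpq A : bounded_borel A -> m A = fine (p A) - fine (q A).
Proof.
move=> bA; rewrite mE// /p /q /ppos /pneg !pfm_densm_bounded;
  [|exact: bA.1|exact: iq|exact: bA.1|exact: ip].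
rewrite /= -rintB; [|exact: ip|exact: iq].
by congr rint; apply/funext => y; case: ifP => _; rewrite ?vposBneg ?subr0.
Qed.

Lemma presentation_real_radon : real_radon m.
Proof. exact: real_radon_difference pfin qfin mpq. Qed.

(** The images of the positive and negative parts of [v] P need not be mutually singular, as [pi]
    may identify points. [signed_int_difference] allows any such pair. *)
Lemma presentation_signed_int (f : 'rV[R]_n -> R) : measurable_fun setT f ->
  rintegrable P (fun y => `|f (pi y)| * `|v y|) ->
  signed_int m f = rint P (fun y => f (pi y) * v y).
Proof.
move=> mf ifv; have mfpi : measurable_fun setT (f \o pi) by exact: measurableT_comp.
have ip' : rintegrable P (fun y => f (pi y) * vpos v y).
  apply: (rintegrable_le ifv).
    by apply: measurable_funM => //; exact: measurable_vpos.
  by move=> y; rewrite normrM ler_wpM2l// (ger0_norm (vpos_ge0 v y)) vpos_le.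
have iq' : rintegrable P (fun y => f (pi y) * vneg v y).
  apply: (rintegrable_le ifv).
    by apply: measurable_funM => //; exact: measurable_vneg.
  by move=> y; rewrite normrM ler_wpM2l// (ger0_norm (vneg_ge0 v y)) vneg_le.
have [hp hpE] := rintegrable_pfm_densm mpi (measurable_vpos mv) (vpos_ge0 v) mf ip'.
have [hq hqE] := rintegrable_pfm_densm mpi (measurable_vneg mv) (vneg_ge0 v) mf iq'.
rewrite (signed_int_difference pfin qfin mpq hp hq) hpE hqE -rintB//.
by congr rint; apply/funext => y; rewrite -mulrBr vposBneg.
Qed.

End real_presentation.
End presentation_mint.

Section presentation_slow_growing.
Context {R : realType} {n : nat} d (Y : measurableType d).
Variables (P : {measure set Y -> \bar R}) (pi : Y -> 'rV[R]_n) (u : Y -> R[i]) (N : nat).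
Variables (mu : set 'rV[R]_n -> R[i]).
Hypothesis pmu : presentation P pi u N mu.

Let mpi : measurable_fun setT pi. Proof. by case: pmu. Qed.
Let mu_ : cmeas u. Proof. by case: pmu. Qed.
Let iu : rintegrable P (fun y => Normc.normc (u y) * weight (pi y) ^- N).
Proof. by case: pmu. Qed.

Let iR : rintegrable P (fun y => `|complex.Re (u y)| * weight (pi y) ^- N).
Proof.
apply: (rintegrable_le iu).
  apply: measurable_funM; first by apply: measurableT_comp => //; exact: mu_.1.
  exact: (measurableT_comp (measurable_weightV _)).
by move=> y; rewrite normrM normr_id (ger0_norm (weightV_ge0 _ _)) ler_wpM2r ?weightV_ge0 ?Re_le_normc.
Qed.
Let iI : rintegrable P (fun y => `|complex.Im (u y)| * weight (pi y) ^- N).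
Proof.
apply: (rintegrable_le iu).
  apply: measurable_funM; first by apply: measurableT_comp => //; exact: mu_.2.
  exact: (measurableT_comp (measurable_weightV _)).
by move=> y; rewrite normrM normr_id (ger0_norm (weightV_ge0 _ _)) ler_wpM2r ?weightV_ge0 ?Im_le_normc.
Qed.

Let mR A : bounded_borel A -> complex.Re (mu A) =
  rint P (fun y => if pi y \in A then complex.Re (u y) else 0).
Proof.
move=> bA; have [_ _ _ ->//] := pmu; rewrite /=; congr rint; apply/funext => y.
by case: ifP.
Qed.
Let mI A : bounded_borel A -> complex.Im (mu A) =
  rint P (fun y => if pi y \in A then complex.Im (u y) else 0).
Proof.
move=> bA; have [_ _ _ ->//] := pmu; rewrite /=; congr rint; apply/funext => y.
by case: ifP.
Qed.

(** The passage from [mint], assembled from Jordan parts, to a single integral against [P]. Each of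
    the four products of parts is dominated by |f| |u|. *)
Lemma presentation_mint (f : 'rV[R]_n -> R[i]) : cmeas f ->
  rintegrable P (fun y => Normc.normc (f (pi y)) * Normc.normc (u y)) ->
  mint mu f = cint P (fun y => f (pi y) * u y).
Proof.
move=> mf ifu.
have le (a b : Y -> R) : (forall y, `|a y| <= Normc.normc (f (pi y))) ->
    (forall y, `|b y| <= Normc.normc (u y)) -> measurable_fun setT a ->
    measurable_fun setT b -> rintegrable P (fun y => a y * b y) /\
    rintegrable P (fun y => `|a y| * `|b y|).
  move=> af bu ma mb; split; apply: (rintegrable_le ifu).
  - exact: measurable_funM.
  - by move=> y; rewrite normrM ler_pM.
  - by apply: measurable_funM; exact: measurableT_comp.
  - by move=> y; rewrite normrM !normr_id ler_pM.
have mfpi := cmeas_comp mpi mf.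
have [iRR iRR'] := le _ _ (fun y => Re_le_normc (f (pi y))) (fun y => Re_le_normc (u y)) mfpi.1 mu_.1.
have [iRI iRI'] := le _ _ (fun y => Re_le_normc (f (pi y))) (fun y => Im_le_normc (u y)) mfpi.1 mu_.2.
have [iIR iIR'] := le _ _ (fun y => Im_le_normc (f (pi y))) (fun y => Re_le_normc (u y)) mfpi.2 mu_.1.
have [iII iII'] := le _ _ (fun y => Im_le_normc (f (pi y))) (fun y => Im_le_normc (u y)) mfpi.2 mu_.2.
rewrite /mint (presentation_signed_int mpi mu_.1 iR mR mf.1)//.
rewrite (presentation_signed_int mpi mu_.1 iR mR mf.2)//.
rewrite (presentation_signed_int mpi mu_.2 iI mI mf.1)//.
rewrite (presentation_signed_int mpi mu_.2 iI mI mf.2)//.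
apply: complexP => /=.
  by rewrite -rintB//; congr rint; apply/funext => y; rewrite ReM.
rewrite -rintD//; congr rint; apply/funext => y; rewrite ImM addrC.
by [].
Qed.

Lemma Re_sum (I : Type) (s : seq I) (F : I -> R[i]) :
  complex.Re (\sum_(i <- s) F i) = \sum_(i <- s) complex.Re (F i).
Proof. by elim: s => [|i s ih]; rewrite ?big_nil// !big_cons ReD ih. Qed.

Lemma Im_sum (I : Type) (s : seq I) (F : I -> R[i]) :
  complex.Im (\sum_(i <- s) F i) = \sum_(i <- s) complex.Im (F i).
Proof. by elim: s => [|i s ih]; rewrite ?big_nil// !big_cons ImD ih. Qed.

(** The image [Q] of the measure 2 |u| P dominates the total variation and integrates the inverse
    power of the weight; the 2 is the one of [normc_cint_le]. *)
Lemma presentation_slow_growing : slow_growing mu.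
Proof.
split.
  move=> F mF tF bF; apply/ccvgP; split.
    under eq_fun do rewrite Re_sum.
    exact: (presentation_real_radon mpi mu_.1 iR mR).
  under eq_fun do rewrite Im_sum.
  exact: (presentation_real_radon mpi mu_.2 iI mI).
exists N.
have m2u : measurable_fun setT (fun y => 2 * Normc.normc (u y)).
  by apply: measurable_funM => //; exact: measurable_normc.
have u20 y : 0 <= 2 * Normc.normc (u y) by rewrite mulr_ge0// normc_ge0.
pose Q := pfm (densm P m2u u20) mpi.
have muQ A : bounded_borel A -> ((Normc.normc (mu A))%:E <= Q A)%E.
  move=> bA; have iA : rintegrable P (fun y => if pi y \in A then Normc.normc (u y) else 0).
    apply: (rintegrable_restrict mpi bA (measurable_normc mu_) iu) => y.
    by rewrite ger0_norm// normc_ge0.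
  have e : (fun y => if pi y \in A then 2 * Normc.normc (u y) else 0) =
      (fun y => 2 * (if pi y \in A then Normc.normc (u y) else 0)).
    by apply/funext => y; case: ifP => _; rewrite ?mulr0.
  rewrite /Q pfm_densm_bounded; [|exact: bA.1|by rewrite e; exact: rintegrableZ].
  rewrite lee_fin e rintZ//; have [_ _ _ ->//] := pmu.
  apply: normc_cint_le => //.
    have mB : measurable (pi @^-1` A).
      by rewrite -[X in measurable X]setTI; apply: mpi => //; exact: bA.1.
    by have := cmeas_if mB mu_; congr cmeas.
  by move=> y; case: ifP => _; rewrite ?Normc.normc0.
have TVQ A : measurable A -> (total_variation mu A <= Q A)%E.
  move=> mA; apply: ge_ereal_sup => _ [p [F [bF FA tF ->]]].
  rewrite -sumEFin; apply: le_trans (_ : \sum_(k < p) Q (F k) <= _)%E.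
    by apply: lee_sum => k _; exact: muQ.
  rewrite -measure_bigsetU//; last first.
  - by move=> k; have [] := bF k.
  apply: le_measure; rewrite ?inE//.
    by apply: bigsetU_measurable => k _; have [] := bF k.
  by rewrite -bigcup_mkord; apply: bigcup_sub => k _; exact: FA.
have TV0 A : (0 <= total_variation mu A)%E.
  apply: ereal_sup_ubound; exists 0%N, (fun=> set0); split=> //.
  - by move=> _; exact: bounded_borel0.
  - by move=> _; exact: sub0set.
- by apply/trivIsetP => i j _ _ _; rewrite setI0.
  - by rewrite big_ord0.
have TVset0 : total_variation mu set0 = 0%E.
  by apply/eqP; rewrite eq_le TV0 andbT -[leRHS](measure0 Q) TVQ.
have wN0 (x : 'rV[R]_n) := weightV_ge0 N x.
apply: le_lt_trans (le_integral_raw TVset0 (measure0 Q) (fun A _ => TV0 A) TVQ _) _ => //.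
have mw := @measurable_weightV R n N.
have iw : rintegrable P (fun y => weight (pi y) ^- N * (2 * Normc.normc (u y))).
  have := rintegrableZ 2 iu; congr rintegrable; apply/funext => y; ring.
have [/integrable_lty h _] := rintegrable_pfm_densm mpi m2u u20 mw iw.
exact: h.
Qed.

End presentation_slow_growing.

Lemma rint_measure_add (R : realType) d (T : measurableType d)
    (m1 m2 : {measure set T -> \bar R}) (h : T -> R) :
  rintegrable m1 h -> rintegrable m2 h ->
  rintegrable (measure_add m1 m2) h /\
  rint (measure_add m1 m2) h = rint m1 h + rint m2 h.
Proof.
move=> i1 i2; have mh := measurable_int _ i1; split.
  apply/integrableP; split=> //; rewrite ge0_integral_measure_add//; last exact: measurableT_comp.
  by have /integrableP[_ h1] := i1; have /integrableP[_ h2] := i2; rewrite lte_add_pinfty.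
rewrite /rint -fineD ?integrable_fin_num//; congr fine.
by rewrite -integral_measure_add.
Qed.

Section presentation_existence.
Context {R : realType} {n : nat}.
Variables (mu : set 'rV[R]_n -> R[i]) (sg : slow_growing mu).

Let mR A := complex.Re (mu A).
Let mI A := complex.Im (mu A).

Let rR : real_radon mR.
Proof.
move=> F mF tF bF; have /ccvgP[+ _] := sg.1 F mF tF bF.
by under eq_fun do rewrite Re_sum.
Qed.

Let rI : real_radon mI.
Proof.
move=> F mF tF bF; have /ccvgP[_] := sg.1 F mF tF bF.
by under eq_fun do rewrite Im_sum.
Qed.

Lemma total_variation0 : total_variation mu set0 = 0%E.
Proof.
have mu0 : mu set0 = 0.
  by apply: complexP; [exact: (real_radon0 rR)|exact: (real_radon0 rI)].
apply/eqP; rewrite eq_le; apply/andP; split.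
  apply: ge_ereal_sup => _ [p [F [bF F0 tF ->]]].
  rewrite lee_fin big1// => k _.
  by have -> : F k = set0 by [apply/seteqP; split=> // x /F0]; rewrite mu0 Normc.normc0.
apply: ereal_sup_ubound; exists 0%N, (fun=> set0); split=> //.
- by move=> _; exact: bounded_borel0.
- by move=> _; exact: sub0set.
- by apply/trivIsetP => i j _ _ _; rewrite setI0.
- by rewrite big_ord0.
Qed.

Lemma pos_variation_le_total (m : set 'rV[R]_n -> R) A :
  (forall B, m B <= Normc.normc (mu B)) ->
  (pos_variation m A <= total_variation mu A)%E.
Proof.
move=> mmu; apply: ge_ereal_sup => _ [B [bB BA] <-].
apply: le_trans (_ : (Normc.normc (mu B))%:E <= _)%E; first by rewrite lee_fin.
apply: ereal_sup_ubound; exists 1%N, (bigcup2 B set0); split=> //.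
- by move=> [|[|k]] //=; exact: bounded_borel0.
- by move=> [|[|k]] //= x.
- by apply/trivIsetP => -[|[|i]] [|[|j]] _ _ //=; rewrite ?set0I ?setI0.
- by rewrite big_ord1.
Qed.

(* Four Jordan parts, as one measure on four copies of R^n weighted by 1, -1, i, -i. *)
Definition jordan_weight (y : ('rV[R]_n * bool * bool)%type) : R[i] :=
  (if y.1.2 then 1 else -1) * (if y.2 then (0 +i* 1) else 1).

(** Each Jordan part of the real and imaginary parts lies below the total variation, hence
    integrates weight^-N. The four parts may charge the same points with different coefficients, so
    a single density exists only on separate copies of the space. *)
Lemma slow_growing_presentation :
  exists (P : {sigma_finite_measure set ('rV[R]_n * bool * bool)%type -> \bar R}) (N : nat),
  presentation P (fun y => y.1.1) jordan_weight N mu.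
Proof.
have [N hN] := sg.2.
have real_parts m : real_radon m -> (forall B, `|m B| <= Normc.normc (mu B)) ->
  exists p q : {measure set 'rV[R]_n -> \bar R}, [/\
    (forall A, bounded_borel A -> (p A < +oo)%E),
    (forall A, bounded_borel A -> (q A < +oo)%E),
    (forall A, bounded_borel A -> m A = fine (p A) - fine (q A)),
    rintegrable p (fun x => weight x ^- N) &
    rintegrable q (fun x => weight x ^- N)].
  move=> rm mle.
  have [p [pE pfin]] := pos_variation_measure rm.
  have [q [qE qfin]] := pos_variation_measure (real_radonN rm).
  have fin (r : {measure set 'rV[R]_n -> \bar R}) :
      (forall A, measurable A -> r A <= total_variation mu A)%E ->
      rintegrable r (fun x => weight x ^- N).
    move=> rTV; apply/integrableP; split; first by apply/measurable_EFinP; exact: measurable_weightV.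
    apply: le_lt_trans hN; under eq_integral do rewrite /= (ger0_norm (weightV_ge0 _ _)).
    apply: le_integral_raw => //; last by move=> x; rewrite lee_fin weightV_ge0.
    exact: total_variation0.
  exists p, q; split=> //.
  - move=> A bA; have := pos_variation_decomp rm bA.
    rewrite pE ?qE; [|exact: bA.1|exact: bA.1].
    rewrite -[in LHS](@fineK _ (q A)) ?ge0_fin_numE ?qfin//.
    rewrite -[X in (_ = X - _)%E](@fineK _ (p A)) ?ge0_fin_numE ?pfin//.
    by move=> [->]; ring.
  - apply: fin => A mA; rewrite -pE//; apply: pos_variation_le_total => B.
    by rewrite (le_trans (ler_norm _)).
  - apply: fin => A mA; rewrite -qE//; apply: pos_variation_le_total => B.
    by rewrite (le_trans (ler_norm _))// normrN.
have [p1 [p2 [fp1 fp2 ep ip1 ip2]]] := real_parts _ rR (fun B => Re_le_normc (mu B)).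
have [p3 [p4 [fp3 fp4 eq ip3 ip4]]] := real_parts _ rI (fun B => Im_le_normc (mu B)).
pose inj (b c : bool) (x : 'rV[R]_n) := (x, b, c).
have minj b c : measurable_fun setT (inj b c).
  by apply: measurable_fun_pair => //; exact: measurable_fun_pair.
pose Q : {measure set ('rV[R]_n * bool * bool)%type -> \bar R} :=
  measure_add (measure_add (pfm p1 (minj true false)) (pfm p2 (minj false false)))
    (measure_add (pfm p3 (minj true true)) (pfm p4 (minj false true))).
have rintQ (h : ('rV[R]_n * bool * bool)%type -> R) : measurable_fun setT h ->
    rintegrable p1 (fun x => h (x, true, false)) ->
    rintegrable p2 (fun x => h (x, false, false)) ->
    rintegrable p3 (fun x => h (x, true, true)) ->
    rintegrable p4 (fun x => h (x, false, true)) ->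
    rintegrable Q h /\ rint Q h =
      rint p1 (fun x => h (x, true, false)) + rint p2 (fun x => h (x, false, false)) +
      (rint p3 (fun x => h (x, true, true)) + rint p4 (fun x => h (x, false, true))).
  move=> mh i1 i2 i3 i4.
  have [j1 e1] := rint_measure_add ((rintegrable_pfm p1 (minj true false) mh).2 i1)
    ((rintegrable_pfm p2 (minj false false) mh).2 i2).
  have [j2 e2] := rint_measure_add ((rintegrable_pfm p3 (minj true true) mh).2 i3)
    ((rintegrable_pfm p4 (minj false true) mh).2 i4).
  have [j3 e3] := rint_measure_add j1 j2.
  split=> //; rewrite /Q e3 e1 e2.
  by rewrite !(rint_pushforward (minj _ _)).
have QE A : measurable A -> Q A = (p1 (inj true false @^-1` A) + p2 (inj false false @^-1` A) +
    (p3 (inj true true @^-1` A) + p4 (inj false true @^-1` A)))%E.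
  by move=> mA; apply: etrans (measure_addE _ _ _) _; congr (_ + _)%E; apply: etrans (measure_addE _ _ _) _.
have mpi : measurable_fun setT (fun y : ('rV[R]_n * bool * bool)%type => y.1.1).
  exact: (measurableT_comp measurable_fst measurable_fst).
have mcube k : measurable ((fun y : ('rV[R]_n * bool * bool)%type => y.1.1) @^-1` cube k).
  by rewrite -[X in measurable X]setTI; apply: mpi => //; exact: measurable_cube.
have [|||P PQ] := @sigma_finite_measure_of R _ _ Q (fun k => (fun y => y.1.1) @^-1` cube k).
- exact: mcube.
- by rewrite -preimage_bigcup cube_cover preimage_setT.
- move=> k; rewrite QE//; have bk := @bounded_borel_cube R n k.
  by rewrite !lte_add_pinfty ?fp1 ?fp2 ?fp3 ?fp4.
have QP A : measurable A -> Q A = P A by move=> _; rewrite PQ.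
have cif (g : ('rV[R]_n * bool * bool)%type -> bool) (a b : R[i]) : measurable_fun setT g ->
    cmeas (fun y => if g y then a else b).
  move=> mg; split.
    by under eq_fun do rewrite (fun_if (@complex.Re R)); exact: measurable_fun_ifT.
  by under eq_fun do rewrite (fun_if (@complex.Im R)); exact: measurable_fun_ifT.
have mjw : cmeas jordan_weight.
  apply: cmeasM; apply: cif; last exact: measurable_snd.
  exact: (measurableT_comp measurable_snd measurable_fst).
have iA (p : {measure set 'rV[R]_n -> \bar R}) A (c : R) : measurable A -> (p A < +oo)%E ->
    rintegrable p (fun x => if x \in A then c else 0) /\
    rint p (fun x => if x \in A then c else 0) = c * fine (p A).
  move=> mA pA.
  have e : (fun x => if x \in A then c else 0) = (fun x => c * (\1_A x : R)).
    by apply/funext => x; rewrite indicE; case: (x \in A); rewrite ?mulr1 ?mulr0.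
  have i1 : rintegrable p (\1_A : _ -> R).
    apply/integrableP; split; first by apply/measurable_EFinP; exact: measurable_indic.
    by rewrite (eq_integral (EFin \o \1_A)) ?integral_indic ?setIT// => x _; rewrite /= ger0_norm.
  by split; rewrite e; [exact: rintegrableZ|rewrite rintZ// /rint integral_indic// setIT].
exists P, N; split => //.
- apply: (rintegrable_eq_measure QP).
  (* The density has modulus 1, so integrability is that of the weight against the four parts. *)
  have nw b c (x : 'rV[R]_n) : Normc.normc (jordan_weight (x, b, c)) = 1.
    rewrite /jordan_weight Normc.normcM /=.
    by case: b; case: c; rewrite /= ?expr0n ?expr1n ?sqrrN ?expr1n ?oppr0 ?expr0n /= ?addr0 ?add0r sqrtr1 mul1r.
  have e b c : (fun x => weight x ^- N) = (fun x => Normc.normc (jordan_weight (x, b, c)) * weight (x, b, c).1.1 ^- N).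
    by apply/funext => x; rewrite nw mul1r.
  apply: (rintQ _ _ _ _ _ _).1.
  + apply: measurable_funM; first exact: measurable_normc.
    exact: (measurableT_comp (measurable_weightV _) mpi).
  + by move: ip1; rewrite (e true false).
  + by move: ip2; rewrite (e false false).
  + by move: ip3; rewrite (e true true).
  + by move: ip4; rewrite (e false true).
- move=> A bA; have mA := bA.1.
  have mB : measurable ((fun y : ('rV[R]_n * bool * bool)%type => y.1.1) @^-1` A).
    by rewrite -[X in measurable X]setTI; apply: mpi.
  have mr : cmeas (fun y : ('rV[R]_n * bool * bool)%type => if y.1.1 \in A then jordan_weight y else 0).
    by have := cmeas_if mB mjw; congr cmeas.
  rewrite (cint_eq_measure _ (fun A mA => esym (QP A mA))).
  (* [pr] stands for [Re] or [Im], and [a], [b], [c], [e] for its values at 1, -1, i, -i. *)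
  have part (pr : R[i] -> R) (a b c e : R) (mpr : measurable_fun setT (fun y => pr (if y.1.1 \in A then jordan_weight y else 0))) :
    pr 0 = 0 -> (forall x, pr (jordan_weight (x, true, false)) = a) ->
    (forall x, pr (jordan_weight (x, false, false)) = b) ->
    (forall x, pr (jordan_weight (x, true, true)) = c) ->
    (forall x, pr (jordan_weight (x, false, true)) = e) ->
    rint Q (fun y => pr (if y.1.1 \in A then jordan_weight y else 0)) =
    a * fine (p1 A) + b * fine (p2 A) + (c * fine (p3 A) + e * fine (p4 A)).
    move=> pr0 ha hb hc he.
    have E w (k : R) b1 b2 : (forall x, w (jordan_weight (x, b1, b2)) = k) -> w 0 = 0 ->
        (fun x : 'rV[R]_n => w (if (x, b1, b2).1.1 \in A then jordan_weight (x, b1, b2) else 0)) =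
        (fun x => if x \in A then k else 0).
      by move=> wk w0; apply/funext => x /=; case: ifP; rewrite ?wk ?w0.
    have [||||_ ->] := rintQ _ mpr.
    + by have := (iA p1 A a mA (fp1 _ bA)).1; rewrite -(E pr a true false ha pr0).
    + by have := (iA p2 A b mA (fp2 _ bA)).1; rewrite -(E pr b false false hb pr0).
    + by have := (iA p3 A c mA (fp3 _ bA)).1; rewrite -(E pr c true true hc pr0).
    + by have := (iA p4 A e mA (fp4 _ bA)).1; rewrite -(E pr e false true he pr0).
    congr (_ + _ + (_ + _)).
    + by rewrite -(iA p1 A a mA (fp1 _ bA)).2 -(E pr a true false ha pr0).
    + by rewrite -(iA p2 A b mA (fp2 _ bA)).2 -(E pr b false false hb pr0).
    + by rewrite -(iA p3 A c mA (fp3 _ bA)).2 -(E pr c true true hc pr0).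
    + by rewrite -(iA p4 A e mA (fp4 _ bA)).2 -(E pr e false true he pr0).
  apply: complexP => /=.
    rewrite -[LHS]/(mR A) ep// (part (@complex.Re R) 1 (-1) 0 0 mr.1)//.
    + by ring.
    + by move=> x; rewrite /jordan_weight /=; ring.
    + by move=> x; rewrite /jordan_weight /=; ring.
    + by move=> x; rewrite /jordan_weight /=; ring.
    + by move=> x; rewrite /jordan_weight /=; ring.
  rewrite -[LHS]/(mI A) eq// (part (@complex.Im R) 0 0 1 (-1) mr.2)//.
  + by ring.
  + by move=> x; rewrite /jordan_weight /=; ring.
  + by move=> x; rewrite /jordan_weight /=; ring.
  + by move=> x; rewrite /jordan_weight /=; ring.
  + by move=> x; rewrite /jordan_weight /=; ring.
Qed.

End presentation_existence.

(** * Schwartz functions *)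

Section coordinates.
Context {R : realType}.

Definition setc n (x : 'rV[R]_n) (j : 'I_n) (t : R) : 'rV[R]_n :=
  \row_k (if k == j then t else x ord0 k).

Lemma setcE n (x : 'rV[R]_n) j t k : setc x j t ord0 k = if k == j then t else x ord0 k.
Proof. by rewrite mxE. Qed.

Lemma row_ext n (x y : 'rV[R]_n) : (forall k, x ord0 k = y ord0 k) -> x = y.
Proof. by move=> h; apply/matrixP => i j; rewrite !ord1. Qed.

Lemma setc_id n (x : 'rV[R]_n) j : setc x j (x ord0 j) = x.
Proof. by apply: row_ext => k; rewrite setcE; case: eqP => [->|]. Qed.

Lemma setc_setc n (x : 'rV[R]_n) j s t : setc (setc x j s) j t = setc x j t.
Proof. by apply: row_ext => k; rewrite !setcE; case: eqP. Qed.

Lemma setcC n (x : 'rV[R]_n) i j s t : i != j ->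
  setc (setc x i s) j t = setc (setc x j t) i s.
Proof.
by move=> ij; apply: row_ext => k; rewrite !setcE; case: eqP => [->|//]; rewrite eq_sym (negbTE ij).
Qed.

Lemma add_delta n (x : 'rV[R]_n) j h : x + h *: delta_mx ord0 j = setc x j (x ord0 j + h).
Proof.
apply: row_ext => k; rewrite setcE !mxE eqxx /=; case: eqP => [->|_].
  by rewrite mulr1.
by rewrite mulr0 addr0.
Qed.

Lemma weight_setc n (x : 'rV[R]_n) j t : 1 + t ^+ 2 <= weight (setc x j t).
Proof. by rewrite /weight lerD2l; have := sqr_coord_le (setc x j t) j; rewrite setcE eqxx. Qed.

(** Two powers of the weight give joint integrability in two coordinates, as Fubini's theorem
    demands when transforms in two coordinates are exchanged. *)
Lemma weight_setc2 n (x : 'rV[R]_n) i j s t : i != j ->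
  (1 + s ^+ 2) * (1 + t ^+ 2) <= weight (setc (setc x i s) j t) ^+ 2.
Proof.
move=> ij; set z := setc _ _ _.
have h : 1 + s ^+ 2 + t ^+ 2 <= weight z.
  rewrite /weight -addrA lerD2l /dotv (bigD1 j)//= (bigD1 i)//= /z !setcE !eqxx (negbTE ij).
  set S := \sum_(_ | _) _; have : 0 <= S by rewrite sumr_ge0// => k _; rewrite -expr2 sqr_ge0.
  by rewrite -!expr2; lra.
have s0 := sqr_ge0 s; have t0 := sqr_ge0 t.
apply: le_trans (_ : (1 + s ^+ 2 + t ^+ 2) ^+ 2 <= _); first by nra.
by apply: lerXn2r => //; rewrite nnegrE; [nra|exact/ltW/weight_gt0].
Qed.

Lemma continuous_rV n (X : topologicalType) (f : X -> 'rV[R]_n) :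
  (forall k, continuous (fun t => f t ord0 k)) -> continuous f.
Proof.
move=> cf t A /nbhs_ballP[e /= e0 eA].
have : nbhs t [set s | forall k, ball (f t ord0 k) e (f s ord0 k)].
  by apply: filter_forall => k; apply: (cf k t); exact: nbhsx_ballx.
by apply: filterS => s h; apply: eA; split=> // i k; rewrite !ord1.
Qed.

Lemma continuous_setc n (x : 'rV[R]_n) j : continuous (fun t : R => setc x j t).
Proof.
apply: continuous_rV => k; under eq_fun do rewrite setcE.
by case: (k == j); [move=> t; exact: cvg_id|exact: cst_continuous].
Qed.

Lemma continuous_setc_l n j (t : R) : continuous (fun x : 'rV[R]_n => setc x j t).
Proof.
apply: continuous_rV => k; under eq_fun do rewrite setcE.
by case: (k == j); [exact: cst_continuous|exact: coord_continuous].
Qed.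

End coordinates.

Section partial_derivatives.
Context {R : realType} {n : nat}.
Implicit Types (f g : 'rV[R]_n -> R[i]) (j : 'I_n).

(** A relational form of [partial] that carries differentiability and value together, so the rules
    of calculus compose. *)
Definition pd f j x l := cis_derive (line_fun f j x) 0 l.

Lemma pd_has_partial f j x l : pd f j x l -> has_partial f j x /\ partial j f x = l.
Proof.
move=> [dR dI]; split; first by split; [case: dR|case: dI].
by apply: complexP; rewrite /partial /= derive1E derive_val.
Qed.

Lemma has_partial_pd f j x : has_partial f j x -> pd f j x (partial j f x).
Proof.
by move=> [dR dI]; split; apply: DeriveDef;
  [exact: dR|rewrite /partial /= derive1E|exact: dI|rewrite /partial /= derive1E].
Qed.

Lemma pdD f g j x a b : pd f j x a -> pd g j x b -> pd (fun y => f y + g y) j x (a + b).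
Proof. exact: cis_deriveD. Qed.

Lemma pdM f g j x a b : pd f j x a -> pd g j x b ->
  pd (fun y => f y * g y) j x (a * g x + f x * b).
Proof.
move=> df dg; have := cis_deriveM df dg.
by rewrite /line_fun scale0r addr0.
Qed.

Lemma pd_cst c j x : pd (fun=> c) j x 0.
Proof. exact: cis_derive_cst. Qed.

Lemma pd_coord i j x : pd (fun y => (y ord0 i)%:C) j x (if i == j then 1 else 0).
Proof.
have d : is_derive (0 : R) (1 : R) (fun h => (x + h *: delta_mx ord0 j) ord0 i) ((i == j)%:R : R).
  have -> : (fun h : R => (x + h *: delta_mx ord0 j) ord0 i) = (fun h => x ord0 i + (i == j)%:R * h).
    by apply/funext => h; rewrite !mxE eqxx mulrC.
  have d : is_derive (0 : R) (1 : R) ( *%R ((i == j)%:R : R)) ((i == j)%:R : R).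
    by apply: is_derive_eq; rewrite /GRing.scale/= mulr1.
  by have := is_deriveD (is_derive_cst (x ord0 i) (0 : R) (1 : R)) d; rewrite add0r.
by have := cis_derive_real d; rewrite /pd /line_fun; case: (i == j).
Qed.

Lemma pd_setc f f' j x : (forall y, pd f j y (f' y)) ->
  forall t, cis_derive (fun s => f (setc x j s)) t (f' (setc x j t)).
Proof.
move=> df t; have [dR dI] := df (setc x j t).
have shift (h : R -> R) (l : R) : is_derive (0 : R) (1 : R) (fun s => h (t + s)) l -> is_derive t (1 : R) h l.
  move=> dh.
  have dt : is_derive t (1 : R) (fun s : R => s - t) (1 : R).
    by apply: is_derive_eq; rewrite subr0.
  have dh' : is_derive (t - t) (1 : R) (fun s => h (t + s)) l by rewrite subrr.
  have := @is_derive1_comp _ (fun s => h (t + s)) (fun s => s - t) t l 1 dh' dt; rewrite mulr1; congr is_derive.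
  by apply/funext => s /=; congr h; ring.
split; apply: shift.
  by move: dR; congr is_derive; apply/funext => s;
    rewrite /line_fun add_delta setc_setc setcE eqxx.
by move: dI; congr is_derive; apply/funext => s;
  rewrite /line_fun add_delta setc_setc setcE eqxx.
Qed.

Lemma schwartz_partial f j : schwartz f -> schwartz (partial j f).
Proof.
(* [foldr] applies the last index of the list to [f] before all others. *)
move=> sf s; have := sf (rcons s j).
by rewrite /partials foldr_rcons.
Qed.

End partial_derivatives.

(** * Schwartz families and their multipliers *)

Section schwartz_families.
Context {R : realType}.

(** What is asked of the sequences bounding the seminorms: all constructions below produce bounds
    that are linear in the given ones. One proof then yields both stability of the Schwartz space
    and sequential continuity. *)
Definition seq_ideal (I : set (nat -> R)) :=
  [/\ forall a b, I a -> I b -> I (fun k => a k + b k),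
      forall c a, I a -> I (fun k => c * a k) & exists a, I a].

Variable (I : set (nat -> R)).
Hypothesis idI : seq_ideal I.

Definition family n := nat -> 'rV[R]_n -> R[i].

Definition decays n (phi : family n) := forall N, exists2 a, I a &
  forall k x, weight x ^+ N * Normc.normc (phi k x) <= a k.

Definition schwartz_class n (C : set (family n)) := forall phi, C phi ->
  [/\ forall k, ccontinuous (phi k), decays phi &
      forall j, exists2 psi, C psi & forall k x, pd (phi k) j x (psi k x)].

(* With I all sequences, resp. the null sequences, the members of SF are the
   sequences of Schwartz functions, resp. those converging to 0 in S.  The class is
   coinductive: to show membership, exhibit any class closed under derivation. *)
Definition SF n (phi : family n) := exists2 C, schwartz_class C & C phi.

Lemma SF_class n (C : set (family n)) : schwartz_class C -> forall phi, C phi -> SF phi.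
Proof. by move=> sC phi Cphi; exists C. Qed.

Lemma SF_schwartz_class n : schwartz_class (@SF n).
Proof.
move=> phi [C sC Cphi]; have [cphi dphi pphi] := sC _ Cphi; split=> // j.
by have [psi Cpsi h] := pphi j; exists psi => //; exists C.
Qed.

Lemma decaysD n (phi psi : family n) : decays phi -> decays psi ->
  decays (fun k x => phi k x + psi k x).
Proof.
move=> dphi dpsi N; have [a Ia ha] := dphi N; have [b Ib hb] := dpsi N.
exists (fun k => a k + b k); first by case: idI => + _ _; apply.
move=> k x; apply: le_trans (lerD (ha k x) (hb k x)).
by rewrite -mulrDr ler_wpM2l ?normcDle// exprn_ge0// ltW// weight_gt0.
Qed.

Definition growth_class n (D : set ('rV[R]_n -> R[i])) := forall m, D m ->
  [/\ ccontinuous m, poly_bounded m &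
      forall j, exists2 m', D m' & forall x, pd m j x (m' x)].

(** The classical space O_M of multipliers of the Schwartz space: smooth functions all of whose
    derivatives grow polynomially, again described coinductively. *)
Definition OM n (m : 'rV[R]_n -> R[i]) := exists2 D, growth_class D & D m.

Lemma ccontD n (f g : 'rV[R]_n -> R[i]) : ccontinuous f -> ccontinuous g ->
  ccontinuous (fun x => f x + g x).
Proof.
move=> /ccontinuousP[fR fI] /ccontinuousP[gR gI]; apply/ccontinuousP; split.
  by under eq_fun do rewrite ReD; exact: contD.
by under eq_fun do rewrite ImD; exact: contD.
Qed.

Lemma ccontM n (f g : 'rV[R]_n -> R[i]) : ccontinuous f -> ccontinuous g ->
  ccontinuous (fun x => f x * g x).
Proof.
move=> /ccontinuousP[fR fI] /ccontinuousP[gR gI]; apply/ccontinuousP; split.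
  under eq_fun do rewrite ReM; move=> x.
  apply: (@cvgB _ _ _ (nbhs x) (nbhs_filter x) (fun y => complex.Re (f y) * complex.Re (g y))
    (fun y => complex.Im (f y) * complex.Im (g y)));
  exact: contM.
by under eq_fun do rewrite ImM; apply: contD; exact: contM.
Qed.

(** Leibniz's rule turns a product into a sum of two products, so a class of products closed under
    derivation must contain sums. *)
Inductive mul_closure n : family n -> Prop :=
| mul_closure1 m phi : OM m -> SF phi -> mul_closure (fun k x => m x * phi k x)
| mul_closureD phi psi : mul_closure phi -> mul_closure psi ->
    mul_closure (fun k x => phi k x + psi k x).

Lemma mul_closure_schwartz n : schwartz_class (@mul_closure n).
Proof.
move=> phi; elim => {phi} [m phi [D gD Dm] sphi|phi psi _ [c1 d1 p1] _ [c2 d2 p2]].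
  have [cphi dphi pphi] := SF_schwartz_class sphi.
  have [cm [C [M mC]] pm] := gD _ Dm; split.
  - by move=> k; exact: (ccontM cm (cphi k)).
  (* A factor of growth of order [M] costs [M] powers of decay. *)
  - move=> N; have [a Ia ha] := dphi (N + M)%N.
    exists (fun k => C * a k); first by case: idI => _ + _; apply.
    move=> k x; rewrite Normc.normcM.
    have wx := ltW (weight_gt0 x).
    have C0 : 0 <= C.
      have := le_trans (normc_ge0 _) (mC x); rewrite pmulr_lge0// exprn_gt0//.
      exact: weight_gt0.
    have h : C * (weight x ^+ (N + M) * Normc.normc (phi k x)) <= C * a k by exact: ler_wpM2l.
    apply: le_trans h.
    apply: le_trans (_ : weight x ^+ N * ((C * weight x ^+ M) * Normc.normc (phi k x)) <= _).
      by rewrite ler_wpM2l ?exprn_ge0// ler_wpM2r ?normc_ge0.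
    by rewrite le_eqVlt; apply/orP; left; apply/eqP; rewrite exprD; ring.
  - move=> j; have [m' Dm' dm] := pm j; have [psi spsi dpsi] := pphi j.
    exists (fun k x => m' x * phi k x + m x * psi k x).
      by apply: mul_closureD; apply: mul_closure1 => //; exists D.
    by move=> k x; exact: pdM.
split.
- by move=> k; exact: ccontD.
- exact: decaysD.
- move=> j; have [psi1 C1 h1] := p1 j; have [psi2 C2 h2] := p2 j.
  exists (fun k x => psi1 k x + psi2 k x); first exact: mul_closureD.
  by move=> k x; exact: pdD.
Qed.

Lemma SF_mul n m (phi : family n) : OM m -> SF phi -> SF (fun k x => m x * phi k x).
Proof. by move=> om sphi; apply: SF_class (@mul_closure_schwartz n) _ _; exact: mul_closure1. Qed.

Lemma SF_add n (phi psi : family n) : SF phi -> SF psi -> SF (fun k x => phi k x + psi k x).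
Proof.
move=> sphi spsi; apply: (@SF_class n [set chi | exists phi psi, [/\ SF phi, SF psi &
    chi = fun k x => phi k x + psi k x]]); last by exists phi, psi.
move=> _ [p1 [p2 [/SF_schwartz_class[c1 d1 q1] /SF_schwartz_class[c2 d2 q2] ->]]]; split.
- by move=> k; exact: ccontD.
- exact: decaysD.
- move=> j; have [psi1 C1 h1] := q1 j; have [psi2 C2 h2] := q2 j.
  exists (fun k x => psi1 k x + psi2 k x); first by exists psi1, psi2.
  by move=> k x; exact: pdD.
Qed.

Lemma OM_cst n (c : R[i]) : OM (fun _ : 'rV[R]_n => c).
Proof.
exists [set m | exists c, m = fun=> c]; last by exists c.
move=> _ [{}c ->]; split.
- by apply/ccontinuousP; split; exact: cst_continuous.
- by exists (Normc.normc c), 0%N => x; rewrite expr0 mulr1.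
- by move=> j; exists (fun=> 0); [exists 0|move=> x; exact: pd_cst].
Qed.

Lemma OM_coord n (i : 'I_n) : OM (fun x : 'rV[R]_n => (x ord0 i)%:C).
Proof.
exists [set m | (exists c, m = fun=> c) \/ m = fun x : 'rV[R]_n => (x ord0 i)%:C]; last by right.
move=> _ [[c ->]|->]; split.
- by apply/ccontinuousP; split; exact: cst_continuous.
- by exists (Normc.normc c), 0%N => x; rewrite expr0 mulr1.
- by move=> j; exists (fun=> 0); [left; exists 0|move=> x; exact: pd_cst].
- by apply/ccontinuousP; split => /=; [exact: coord_continuous|exact: cst_continuous].
- exists 1, 1%N => x; rewrite mul1r expr1 normc_real.
  have := sqr_coord_le x i; rewrite -real_normK ?num_real// /weight.
  by have := normr_ge0 (x ord0 i); nra.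
- move=> j; exists (fun=> if i == j then 1 else 0); last by move=> x; exact: pd_coord.
  by left; exists (if i == j then 1 else 0).
Qed.

Lemma SF_scale n c (phi : family n) : SF phi -> SF (fun k x => c * phi k x).
Proof. by move=> sphi; apply: SF_mul sphi; exact: OM_cst. Qed.

Lemma SF_coord n i (phi : family n) : SF phi -> SF (fun k x => (x ord0 i)%:C * phi k x).
Proof. by move=> sphi; apply: SF_mul sphi; exact: OM_coord. Qed.

Lemma SF_sum n (J : Type) (s : seq J) (phi : J -> family n) :
  (exists psi : family n, SF psi) ->
  (forall j, SF (phi j)) -> SF (fun k x => \sum_(j <- s) phi j k x).
Proof.
move=> [psi spsi] sphi; elim: s => [|j s ih].
  have := SF_scale 0 spsi; congr SF; apply/funext => k; apply/funext => x.
  by rewrite big_nil mul0r.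
have := SF_add (sphi j) ih; congr SF; apply/funext => k; apply/funext => x.
by rewrite big_cons.
Qed.

Lemma SF_partial n j (phi : family n) : SF phi ->
  SF (fun k => partial j (phi k)) /\ forall k x, pd (phi k) j x (partial j (phi k) x).
Proof.
move=> /SF_schwartz_class[_ _ /(_ j)[psi spsi h]].
have e : (fun k => partial j (phi k)) = psi.
  by apply/funext => k; apply/funext => x; have [] := pd_has_partial (h k x).
rewrite e; split; first exact: spsi.
by move=> k x; have [_ ->] := pd_has_partial (h k x).
Qed.

Lemma SF_schwartz n (phi : family n) k : SF phi -> schwartz (phi k).
Proof.
move=> sphi s; suff : exists2 psi, SF psi & partials s (phi k) = psi k.
  move=> [psi /SF_schwartz_class[c d p] ->]; split => //.
    by move=> j x; have [q _ h] := p j; have [] := pd_has_partial (h k x).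
  by move=> N; have [a _ ha] := d N; exists (a k).
elim: s => [|j s [psi spsi e]]; first by exists phi.
exists (fun k => partial j (psi k)); first exact: (SF_partial j spsi).1.
by rewrite /= e.
Qed.

End schwartz_families.

Section schwartz_SF.
Context {R : realType}.

Definition all_seq : set (nat -> R) := setT.
Definition null_seq : set (nat -> R) := [set a | a k @[k --> \oo] --> 0].

Lemma all_seq_ideal : seq_ideal all_seq.
Proof. by split=> //; exists (fun=> 0). Qed.

Lemma null_seq_ideal : seq_ideal null_seq.
Proof.
split.
- by move=> a b ha hb; rewrite /null_seq/= -(addr0 0); exact: cvgD.
- by move=> c a ha; rewrite /null_seq/= -(mulr0 c); apply: cvgM => //; exact: cvg_cst.
- by exists (fun=> 0); exact: cvg_cst.
Qed.

Lemma schwartz_SF n (f : 'rV[R]_n -> R[i]) : schwartz f -> SF all_seq (fun=> f).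
Proof.
move=> sf; apply: (@SF_class _ _ _ [set phi | exists2 g, schwartz g & phi = fun=> g]); last by exists f.
move=> _ [g sg ->]; have [c h d] := sg [::]; split=> //.
- by move=> N; have [C hC] := d N; exists (fun=> C) => // k x; exact: hC.
- move=> j; exists (fun=> partial j g); first by exists (partial j g); [exact: schwartz_partial|reflexivity].
  by move=> k x; apply: has_partial_pd; exact: h.
Qed.

Lemma schwartz_cvg0_SF n (phi : nat -> 'rV[R]_n -> R[i]) :
  (forall k, schwartz (phi k)) -> schwartz_cvg0 phi -> SF null_seq phi.
Proof.
move=> sphi cphi; apply: (@SF_class _ _ _ [set phi | (forall k, schwartz (phi k)) /\ schwartz_cvg0 phi]) => //.
move=> psi [spsi cpsi]; split.
- by move=> k; have [] := spsi k [::].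
- move=> N.
  have hs k : has_sup [set weight x ^+ N * Normc.normc (psi k x) | x in [set: 'rV[R]_n]].
    have [_ _ /(_ N)[C hC]] := spsi k [::]; split; last by exists C => _ [x _ <-]; exact: hC.
    by exists (weight (0 : 'rV[R]_n) ^+ N * Normc.normc (psi k 0)), 0.
  (* The seminorms themselves are the bounds: finite because each function is Schwartz, null because
     the sequence tends to 0. *)
  exists (fun k => sup [set weight x ^+ N * Normc.normc (psi k x) | x in [set: 'rV[R]_n]]).
    apply/cvgrPdist_le => e e0; have := cpsi [::] N e e0.
    apply: filterS => k hk; rewrite sub0r normrN ger0_norm.
      by apply: ge_sup; [exact: (hs k).1|move=> _ [x _ <-]; exact: hk].
    apply: le_trans (_ : weight (0 : 'rV[R]_n) ^+ N * Normc.normc (psi k 0) <= _).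
      by rewrite mulr_ge0 ?normc_ge0// exprn_ge0// ltW// weight_gt0.
    by apply: sup_upper_bound => //; exists 0.
  by move=> k x; apply: sup_upper_bound => //; exists x.
- move=> j; exists (fun k => partial j (psi k)).
    split; first by move=> k; exact: schwartz_partial.
    move=> s M e e0; apply: filterS (cpsi (rcons s j) M e e0) => k h x.
    by have := h x; rewrite /partials foldr_rcons.
  by move=> k x; apply: has_partial_pd; have [_ h _] := spsi k [::]; exact: h.
Qed.

End schwartz_SF.

(** * Fourier inversion on the line *)

Section line_integrals.
Context {R : realType}.
Local Notation mu := (@lebesgue_measure R).
Implicit Types (u : R -> R[i]).

Lemma countably_based_oo : countably_based \oo.
Proof.
exists (fun n => [set m | (n <= m)%N]); split.
  by move=> n; exists n.
by move=> A [N _ NA]; exists N.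
Qed.

Definition ccont u := continuous (fun t => complex.Re (u t)) /\ continuous (fun t => complex.Im (u t)).

Lemma ccont_cmeas u : ccont u -> cmeas (u : measurableTypeR R -> R[i]).
Proof. by move=> [cR cI]; split; exact: continuous_measurable_fun. Qed.

Lemma ccont_deriv u u' : (forall t, cis_derive u t (u' t)) -> ccont u.
Proof.
by move=> du; split=> t; have [dR dI] := du t;
  apply: differentiable_continuous; apply/derivable1_diffP.
Qed.

Lemma ccontM1 u v : ccont u -> ccont v -> ccont (fun t => u t * v t).
Proof.
move=> [uR uI] [vR vI]; split.
  under eq_fun do rewrite ReM; move=> t.
  apply: (@cvgB _ _ _ (nbhs t) (nbhs_filter t) (fun y => complex.Re (u y) * complex.Re (v y))
    (fun y => complex.Im (u y) * complex.Im (v y)));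
  exact: contM.
by under eq_fun do rewrite ImM; apply: contD; exact: contM.
Qed.

Definition decay2 u C := forall t, (1 + t ^+ 2) * Normc.normc (u t) <= C.

Lemma one_add_sqr_gt0 (t : R) : 0 < 1 + t ^+ 2.
Proof. by rewrite ltr_pwDl// sqr_ge0. Qed.

Lemma decay2_le u C : decay2 u C -> forall t, Normc.normc (u t) <= C * (1 + t ^+ 2)^-1.
Proof. by move=> uC t; rewrite ler_pdivlMr ?one_add_sqr_gt0// mulrC. Qed.

Lemma cintegrable_decay2 u C : cmeas (u : measurableTypeR R -> R[i]) -> decay2 u C -> cintegrable mu u.
Proof.
move=> mu_ uC; apply: (cintegrable_le (rintegrableZ C (@rintegrable_oneDsqrV R))) => //.
exact: decay2_le.
Qed.

(** The integral of the dominating function 1/(1 + t^2), with the factor 2 of [normc_cint_le]. *)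
Definition cauchy_mass : R := 2 * rint mu (fun t : R => (1 + t ^+ 2)^-1).

Lemma normc_cint_decay2 u C : cmeas (u : measurableTypeR R -> R[i]) -> decay2 u C ->
  Normc.normc (cint mu u) <= cauchy_mass * C.
Proof.
move=> mu_ uC.
apply: le_trans (normc_cint_le (rintegrableZ C (@rintegrable_oneDsqrV R)) mu_ (decay2_le uC)) _.
rewrite le_eqVlt; apply/orP; left; apply/eqP.
rewrite (rintZ _ (@rintegrable_oneDsqrV R)) /cauchy_mass; set I := rint _ _; ring.
Qed.

Lemma cint_FTC_lim (u u' : R -> R[i]) (D : set R) (a b : nat -> R) (l : R[i]) :
  (forall t, cis_derive u t (u' t)) -> ccont u' ->
  measurable D -> (forall n, a n < b n) -> (forall n, `[a n, b n] `<=` D) ->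
  (forall t, D t -> \forall n \near \oo, t \in `[a n, b n]) ->
  cintegrable mu (fun t => if t \in D then u' t else 0) ->
  (u (b n) - u (a n) : R[i]^o) @[n --> \oo] --> (l : R[i]^o) ->
  cint mu (fun t => if t \in D then u' t else 0) = l.
Proof.
move=> du [cR cI] mD ab abD Dab [iR iI] /ccvgP[lR lI].
apply: complexP => /=.
  have e : (fun t => complex.Re (if t \in D then u' t else 0)) = (fun t => if t \in D then complex.Re (u' t) else 0).
    by apply/funext => t; case: ifP.
  rewrite e; rewrite e in iR.
  apply: (rint_FTC_lim (u := fun t => complex.Re (u t)) _ _ mD ab abD Dab) => //.
    by move=> t; have [] := du t.
  by under eq_fun do rewrite -ReN -ReD.
have e : (fun t => complex.Im (if t \in D then u' t else 0)) = (fun t => if t \in D then complex.Im (u' t) else 0).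
  by apply/funext => t; case: ifP.
rewrite e; rewrite e in iI.
apply: (rint_FTC_lim (u := fun t => complex.Im (u t)) _ _ mD ab abD Dab) => //.
  by move=> t; have [] := du t.
by under eq_fun do rewrite -ImN -ImD.
Qed.

Lemma itv_exhaust (y t : R) : \forall n \near \oo, t \in `[y - n.+1%:R, y + n.+1%:R].
Proof.
exists (Num.truncn `|t - y|) => // n /= hn; rewrite in_itv/= -ler_distl.
apply: le_trans (ltW (truncnS_gt _)) _.
by rewrite ler_nat ltnS.
Qed.

Lemma cvg_decay (v : nat -> R[i]) C :
  (forall n, (1 + n.+1%:R ^+ 2) * Normc.normc (v n) <= C) ->
  (v n : R[i]^o) @[n --> \oo] --> (0 : R[i]^o).
Proof.
move=> vC; apply/cvgrPdist_le => -[r r'] r0.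
have [r'0 {}r0] : r' = 0 /\ 0 < r by move: r0; rewrite ltcE/= => /andP[/eqP].
rewrite r'0; exists (Num.truncn (`|C| / r)) => // n /= hn.
rewrite sub0r normrN -[(_ +i* 0)%C]/(r%:C).
have -> : `|v n : R[i]^o| = (Normc.normc (v n))%:C by [].
rewrite lecR; have := vC n; have := normc_ge0 (v n).
have : `|C| <= n.+1%:R * r.
  rewrite -ler_pdivrMr//; apply: le_trans (ltW (truncnS_gt _)) _.
  by rewrite ler_nat ltnS.
have := ler_norm C; have : 1 <= n.+1%:R :> R by rewrite ler1n.
set N := n.+1%:R; set w := Normc.normc _; move=> N1 h1 h2 w0 h3.
rewrite leNgt; apply/negP => rw; nra.
Qed.

(* The form in which integration by parts is used. *)
Lemma cint_derive0 (u u' : R -> R[i]) C C' : (forall t, cis_derive u t (u' t)) ->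
  ccont u' -> decay2 u C -> decay2 u' C' -> cint mu u' = 0.
Proof.
move=> du cu' uC uC'.
have e : u' = (fun t => if t \in setT then u' t else 0).
  by apply/funext => t; rewrite mem_set.
have iu' : cintegrable mu u' := cintegrable_decay2 (ccont_cmeas cu') uC'.
rewrite e; apply: (cint_FTC_lim (a := fun n => 0 - n.+1%:R) (b := fun n => 0 + n.+1%:R) du) => //.
- by move=> n; rewrite ltrD2l -subr_gt0 opprK addr_gt0.
- by move=> t _; exact: itv_exhaust.
- by rewrite -e.
rewrite -[X in _ --> X](subr0 (0 : R[i]^o)).
apply: (@cvgB _ (R[i]^o)); apply: (@cvg_decay _ C) => n.
  by have := uC (0 + n.+1%:R); rewrite add0r.
by have := uC (0 - n.+1%:R); rewrite sub0r sqrrN.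
Qed.

Lemma cderive_under_integral d (T : measurableType d) (P : {measure set T -> \bar R})
    (f f' : R -> T -> R[i]) (G : T -> R) (a : R) :
  (forall x, cintegrable P (f x)) ->
  (forall x y, cis_derive (f ^~ y) x (f' x y)) ->
  rintegrable P G ->
  (forall x y, x \in `]a - 1, a + 1[ -> Normc.normc (f' x y) <= G y) ->
  cis_derive (fun x => cint P (f x)) a (cint P (f' a)).
Proof.
move=> iF df iG hG.
have aI : [set` `]a - 1, a + 1[] a by rewrite /= in_itv/=; lra.
have G0 y : 0 <= G y by apply: le_trans (normc_ge0 _) (hG a y aI).
have aux (pr : R[i] -> R) : (forall z, `|pr z| <= Normc.normc z) ->
    (forall x, rintegrable P (fun y => pr (f x y))) ->
    (forall x y, is_derive x (1 : R) (fun s => pr (f s y)) (pr (f' x y))) ->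
    is_derive a (1 : R) (fun x => rint P (fun y => pr (f x y))) (rint P (fun y => pr (f' a y))).
  move=> hpr ipr dpr.
  have d1 x y : partial1of2 (fun x y => pr (f x y)) x y = pr (f' x y).
    by rewrite partial1of2E derive_val.
  have der := @derivable_under_integral R _ T P (fun x y => pr (f x y)) setT measurableT
    a (a - 1) (a + 1) aI (fun x _ => ipr x) _ G G0 iG _.
  have val := @differentiation_under_integral R _ T P (fun x y => pr (f x y)) setT measurableT
    a (a - 1) (a + 1) aI (fun x _ => ipr x) _ G G0 iG _.
  apply: DeriveDef.
    apply: der => [x y _ _|x y xI _]; first by have [] := dpr x y.
    by rewrite d1; apply: le_trans (hpr _) _; exact: hG.
  rewrite -derive1E val => [|x y _ _|x y xI _].
  - by apply: eq_Rintegral => y _; rewrite d1.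
  - by have [] := dpr x y.
  - by rewrite d1; apply: le_trans (hpr _) _; exact: hG.
split => /=.
  apply: (aux (@complex.Re R)) => [z|x|x y]; first exact: Re_le_normc.
    exact: (iF x).1.
  exact: (df x y).1.
apply: (aux (@complex.Im R)) => [z|x|x y]; first exact: Im_le_normc.
  exact: (iF x).2.
exact: (df x y).2.
Qed.

End line_integrals.

(** * The complex exponential on half-lines and the Poisson kernel *)

Section complex_exponential.
Context {R : realType}.
Local Notation mu := (@lebesgue_measure R).

Definition cexp (z : R[i]) : R[i] := (expR (complex.Re z))%:C * cexpi (complex.Im z).

Lemma normc_cexp z : Normc.normc (cexp z) = expR (complex.Re z).
Proof. by rewrite Normc.normcM normc_cexpi mulr1 normc_real ger0_norm// expR_ge0. Qed.

Lemma cexpD z w : cexp (z + w) = cexp z * cexp w.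
Proof. by rewrite /cexp ReD ImD expRD cexpiD rmorphM /=; ring. Qed.

Lemma cis_derive_cexp (z : R[i]) t : cis_derive (fun s => cexp (s%:C * z)) t (z * cexp (t%:C * z)).
Proof.
have e : (fun s => cexp (s%:C * z)) =
    (fun s => (expR (complex.Re z * s))%:C * cexpi (complex.Im z * s)).
  by apply/funext => s; rewrite /cexp ReM ImM /= !mul0r subr0 addr0 !(mulrC s).
have dr : is_derive t (1 : R) (fun s => expR (complex.Re z * s)) (complex.Re z * expR (complex.Re z * t)).
  have d : is_derive t (1 : R) ( *%R (complex.Re z)) (complex.Re z).
    by apply: is_derive_eq; rewrite /GRing.scale/= mulr1.
  by have := is_derive1_comp (is_derive_expR _) d; rewrite mulrC.
rewrite e; have := cis_deriveM (cis_derive_real dr) (cis_derive_cexpi (complex.Im z) t).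
have -> : cexp (t%:C * z) = (expR (complex.Re z * t))%:C * cexpi (complex.Im z * t).
  by rewrite -[LHS]/((fun s => cexp (s%:C * z)) t) e.
congr cis_derive; rewrite rmorphM /=.
set E := (expR _)%:C; set W := cexpi _.
have {3}-> : z = (complex.Re z)%:C + (0 +i* complex.Im z) by case: (z) => p q; apply: complexP; rewrite /= ?addr0 ?add0r.
by ring.
Qed.

Lemma exp_half_line_decay (z : R[i]) : 0 < complex.Re z -> exists C, forall s, 0 <= s ->
  (1 + s ^+ 2) * Normc.normc (cexp (s%:C * - z)) <= C.
Proof.
move=> z0; have [C hC] := exp_decay1 z0; exists C => s s0.
rewrite normc_cexp mulrC ReM /= mul0r subr0 ReN mulrN mulrC [s * _]mulrC mulrC.
exact: hC.
Qed.

Lemma cexp0 : cexp 0 = 1.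
Proof. by rewrite /cexp /= expR0 cexpi0 mulr1. Qed.

Lemma ccont_cexp (z : R[i]) : ccont (fun s => cexp (s%:C * z)).
Proof. by apply: ccont_deriv => t; exact: cis_derive_cexp. Qed.

(** The antiderivative - e^(-zs)/z vanishes at infinity because Re z > 0. The lemma serves twice:
    for the Poisson kernel, and for writing 1/(i w + g) as a Laplace integral. *)
Lemma cexp_half_line (z : R[i]) : 0 < complex.Re z ->
  cintegrable mu (fun s => if s \in `[0, +oo[%classic then cexp (s%:C * (- z)) else 0) /\
  cint mu (fun s => if s \in `[0, +oo[%classic then cexp (s%:C * (- z)) else 0) = z^-1.
Proof.
move=> z0; have [C hC] := exp_half_line_decay z0.
have z_neq0 : z != 0 by apply/eqP => ze; move: z0; rewrite ze ltxx.
have C0 : 0 <= C.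
  by apply: le_trans (hC 0 (lexx 0)); rewrite mulr_ge0 ?normc_ge0// ltW// one_add_sqr_gt0.
have iE : cintegrable mu (fun s => if s \in `[0, +oo[%classic then cexp (s%:C * (- z)) else 0).
  apply: (@cintegrable_decay2 _ _ C).
    by apply: cmeas_if; [exact: measurable_itv|exact/ccont_cmeas/ccont_cexp].
  move=> s; case: ifPn => [|_]; last by rewrite Normc.normc0 mulr0.
  by rewrite inE/= in_itv/= andbT => s0; exact: hC.
split=> //.
apply: (cint_FTC_lim (u := fun s => (- z^-1) * cexp (s%:C * (- z)))
  (a := fun n => 0 - 0) (b := fun n => 0 + n.+1%:R)) => //.
- move=> t; have := cis_deriveM (cis_derive_cst (- z^-1) t) (cis_derive_cexp (- z) t).
  by rewrite mul0r add0r mulrA mulrNN mulVf// mul1r.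
- exact: ccont_cexp.
- by move=> n; rewrite subr0 add0r.
- by move=> n t /=; rewrite !in_itv/= subr0 => /andP[-> _].
- move=> t /=; rewrite in_itv/= andbT => t0.
  apply: filterS (itv_exhaust 0 t) => n; rewrite !in_itv/= => /andP[_ ->].
  by rewrite subr0 t0.
- rewrite -[X in _ --> X](_ : 0 - (- z^-1) = _ :> R[i]^o); last by rewrite sub0r opprK.
  apply: (@cvgB _ (R[i]^o)).
    apply: (@cvg_decay _ _ (Normc.normc (- z^-1) * C)) => n.
    rewrite Normc.normcM mulrCA ler_wpM2l ?normc_ge0//.
    by have := hC (0 + n.+1%:R); rewrite !add0r; apply.
  rewrite subr0 mul0r cexp0 mulr1; exact: cvg_cst.
Qed.

Lemma cexp_neg_half_line (z : R[i]) : 0 < complex.Re z ->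
  cintegrable mu (fun s => if s \in `]-oo, 0[%classic then cexp (s%:C * z) else 0) /\
  cint mu (fun s => if s \in `]-oo, 0[%classic then cexp (s%:C * z) else 0) = z^-1.
Proof.
move=> z0; have [C hC] := exp_half_line_decay z0.
have z_neq0 : z != 0 by apply/eqP => ze; move: z0; rewrite ze ltxx.
have C0 : 0 <= C.
  by apply: le_trans (hC 0 (lexx 0)); rewrite mulr_ge0 ?normc_ge0// ltW// one_add_sqr_gt0.
have hC' s : s <= 0 -> (1 + s ^+ 2) * Normc.normc (cexp (s%:C * z)) <= C.
  move=> s0; have := hC (- s); rewrite oppr_ge0 sqrrN => /(_ s0).
  by rewrite rmorphN mulrNN.
have iE : cintegrable mu (fun s => if s \in `]-oo, 0[%classic then cexp (s%:C * z) else 0).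
  apply: (@cintegrable_decay2 _ _ C).
    by apply: cmeas_if; [exact: measurable_itv|exact/ccont_cmeas/ccont_cexp].
  move=> s; case: ifPn => [|_]; last by rewrite Normc.normc0 mulr0.
  by rewrite inE/= in_itv/= => /ltW s0; exact: hC'.
split=> //.
have du t : cis_derive (fun s => z^-1 * cexp (s%:C * z)) t (cexp (t%:C * z)).
  have := cis_deriveM (cis_derive_cst z^-1 t) (cis_derive_cexp z t).
  by rewrite mul0r add0r mulrA mulVf// mul1r.
(* The right end -1/(n+2) increases to 0 and exhausts the half-line open at 0; n + 2 instead of n +
   1 keeps it above the left end -1 when n = 0. *)
apply: (cint_FTC_lim (u := fun s => z^-1 * cexp (s%:C * z))
  (a := fun n => 0 - n.+1%:R) (b := fun n => - n.+2%:R^-1)) => //.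
- exact: ccont_cexp.
- move=> n; rewrite sub0r ltrN2; apply: lt_le_trans (_ : 1 <= _); last by rewrite ler1n.
  by rewrite invf_lt1// ltr1n.
- by move=> n t /=; rewrite !in_itv/= => /andP[_ h]; apply: le_lt_trans h _; rewrite oppr_lt0 invr_gt0.
- move=> t /=; rewrite in_itv/= => t0.
  have t0' : 0 < - t by rewrite oppr_gt0.
  have [N hN] := harmonic_small t0'.
  have h : \forall n \near \oo, (N <= n)%N by exists N.
  apply: filterS2 (itv_exhaust 0 t) h => n; rewrite !in_itv/= => /andP[-> _] Nn /=.
  rewrite lerNr; apply: le_trans (ltW hN).
  by rewrite lef_pV2 ?posrE// ler_nat ltnS leqW.
- rewrite -[X in _ --> X]subr0; apply: (@cvgB _ (R[i]^o)); last first.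
    apply: (@cvg_decay _ _ (Normc.normc (z^-1) * C)) => n.
    rewrite Normc.normcM mulrCA ler_wpM2l ?normc_ge0//.
    by have := hC' (0 - n.+1%:R); rewrite !sub0r sqrrN; apply; rewrite oppr_le0.
  have c0 := cis_derive_continuous (du 0).
  rewrite mul0r cexp0 mulr1 in c0.
  apply: (cvg_comp (fun n => - n.+2%:R^-1) (fun s => z^-1 * cexp (s%:C * z))); last exact: c0.
  rewrite -oppr0; apply: cvgN.
  have := @cvg_harmonic R; rewrite -(cvg_shiftS (@harmonic R)).
  exact.
Qed.

(** Cutting at xi = 0 leaves two exponentials, with integrals 1/(eps - ib) and 1/(eps + ib). *)
Lemma poisson_kernel (eps b : R) : 0 < eps ->
  cintegrable mu (fun xi => (expR (- (eps * `|xi|)))%:C * cexpi (xi * b)) /\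
  cint mu (fun xi => (expR (- (eps * `|xi|)))%:C * cexpi (xi * b)) =
  (2 * eps / (eps ^+ 2 + b ^+ 2))%:C.
Proof.
move=> e0.
have z1 : 0 < complex.Re (eps +i* (- b)) by [].
have z2 : 0 < complex.Re (eps +i* b) by [].
have [i1 c1] := cexp_half_line z1; have [i2 c2] := cexp_neg_half_line z2.
have -> : (fun xi => (expR (- (eps * `|xi|)))%:C * cexpi (xi * b)) =
  (fun s => (if s \in `[0, +oo[%classic then cexp (s%:C * (- (eps +i* (- b)))) else 0) +
    (if s \in `]-oo, 0[%classic then cexp (s%:C * (eps +i* b)) else 0)).
  apply/funext => s; have [s0|s0] := leP 0 s.
    rewrite mem_set/= ?in_itv/= ?s0// memNset/= ?in_itv/= ?ltNge ?s0// addr0.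
    rewrite /cexp ReM ImM /= !mul0r subr0 addr0 ger0_norm// opprK.
    by congr ((expR _)%:C * _); ring.
  rewrite memNset/= ?in_itv/= ?leNgt ?s0// mem_set/= ?in_itv/= ?s0// add0r.
  rewrite /cexp ReM ImM /= !mul0r subr0 addr0 ltr0_norm//.
  by congr ((expR _)%:C * _); ring.
split; first exact: cintegrableD.
rewrite cintD// c1 c2.
have d0 : eps ^+ 2 + b ^+ 2 != 0 by rewrite gt_eqF// ltr_pwDl ?sqr_ge0// exprn_gt0.
have n1 : (eps +i* (- b)) != 0 by apply/eqP => -[h _]; rewrite h ltxx in e0.
have n2 : (eps +i* b) != 0 by apply/eqP => -[h _]; rewrite h ltxx in e0.
apply: complexP => /=; rewrite ?sqrrN; field; exact: d0.
Qed.

End complex_exponential.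

Section inversion.
Context {R : realType}.
Local Notation mu := (@lebesgue_measure R).
Implicit Types (u : R -> R[i]).

Definition poisson (eps r : R) : R := 2 * eps / (eps ^+ 2 + r ^+ 2).

Lemma poisson_den_gt0 (eps r : R) : 0 < eps -> 0 < eps ^+ 2 + r ^+ 2.
Proof. by move=> e0; rewrite ltr_pwDl ?sqr_ge0// exprn_gt0. Qed.

Lemma poisson_ge0 (eps r : R) : 0 < eps -> 0 <= poisson eps r.
Proof. by move=> e0; rewrite /poisson divr_ge0 ?mulr_ge0 ?(ltW e0)// ltW// poisson_den_gt0. Qed.

(** Peetre's inequality: the difference of the two sides is 1 plus a sum of squares. *)
Lemma peetre1 (y t : R) : 1 + t ^+ 2 <= 2 * (1 + y ^+ 2) * (1 + (t - y) ^+ 2).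
Proof.
have e : 2 * (1 + y ^+ 2) * (1 + (t - y) ^+ 2) =
  (1 + t ^+ 2) + (1 + (2 * y - t) ^+ 2 + 2 * (y * (t - y)) ^+ 2) by ring.
rewrite e; have := sqr_ge0 (2 * y - t); have := sqr_ge0 (y * (t - y)); lra.
Qed.

Lemma continuous_poisson (eps y : R) : 0 < eps -> continuous (fun t => poisson eps (t - y)).
Proof.
move=> e0 t; rewrite /poisson; apply: (@cvgM _ _ (nbhs t)); first exact: cvg_cst.
apply: (@cvgV _ _ (nbhs t)); first by rewrite gt_eqF// poisson_den_gt0.
have ct : continuous (fun t => t - y) by move=> s; apply: cvgB; [exact: cvg_id|exact: cvg_cst].
have c : continuous (fun t => eps ^+ 2 + (t - y) * (t - y)).
  by apply: contD; [exact: cst_continuous|exact: contM].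
exact: c.
Qed.

(** The antiderivative is 2 atan ((t - y)/eps), whose total increase is 2 pi for every eps. *)
Lemma poisson_mass (eps y : R) : 0 < eps ->
  cintegrable mu (fun t => (poisson eps (t - y))%:C) /\
  cint mu (fun t => (poisson eps (t - y))%:C) = (2 * pi)%:C.
Proof.
move=> e0.
have cp : ccont (fun t => (poisson eps (t - y))%:C).
  by split => /=; [exact: continuous_poisson|exact: cst_continuous].
have ip : cintegrable mu (fun t => (poisson eps (t - y))%:C).
  (* With r = t - y, (1 + r^2) times the kernel is at most 2 eps + 2/eps; Peetre's inequality moves
     the weight from r to t at the price of 2 (1 + y^2). *)
  apply: (@cintegrable_decay2 _ _ (2 * (1 + y ^+ 2) * (2 * eps + 2 / eps))); first exact: ccont_cmeas.
  move=> t; rewrite normc_real ger0_norm ?poisson_ge0//.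
  have := peetre1 y t; set r := t - y; move=> h.
  have k : (1 + r ^+ 2) * poisson eps r <= 2 * eps + 2 / eps.
    rewrite /poisson mulrA ler_pdivrMr ?poisson_den_gt0//.
    have -> : (2 * eps + 2 / eps) * (eps ^+ 2 + r ^+ 2) =
      (1 + r ^+ 2) * (2 * eps) + (2 * eps ^+ 3 + 2 / eps * r ^+ 2) by field; rewrite gt_eqF.
    rewrite lerDl; apply: addr_ge0; first by rewrite mulr_ge0// exprn_ge0// ltW.
    by rewrite mulr_ge0 ?sqr_ge0// divr_ge0// ltW.
  have y0 : 0 <= 2 * (1 + y ^+ 2) by rewrite mulr_ge0// ltW// one_add_sqr_gt0.
  apply: le_trans (_ : 2 * (1 + y ^+ 2) * (1 + r ^+ 2) * poisson eps r <= _).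
    by rewrite ler_wpM2r// poisson_ge0.
  by rewrite -mulrA ler_wpM2l.
split=> //.
have e : (fun t => (poisson eps (t - y))%:C) = (fun t => if t \in setT then (poisson eps (t - y))%:C else 0).
  by apply/funext => t; rewrite mem_set.
rewrite e; apply: (cint_FTC_lim (u := fun t => (2 * atan ((t - y) / eps))%:C)
  (a := fun n => y - n.+1%:R) (b := fun n => y + n.+1%:R)) => //.
- move=> t; apply: cis_derive_real.
  have d1 : is_derive t (1 : R) (fun s : R => (s - y) / eps) (eps^-1).
    have -> : (fun s : R => (s - y) / eps) = (fun s => eps^-1 * s + - (y / eps)).
      by apply/funext => s; rewrite mulrBl mulrC.
    have d : is_derive t (1 : R) ( *%R eps^-1) eps^-1.
      by apply: is_derive_eq; rewrite /GRing.scale/= mulr1.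
    by have := is_deriveD d (is_derive_cst (- (y / eps)) t (1 : R)); rewrite addr0.
  have d2 := @is_derive1_comp _ (@atan R) (fun s : R => (s - y) / eps) t _ _ (is_derive1_atan ((t - y) / eps)) d1.
  have := is_deriveM (is_derive_cst (2 : R) t (1 : R)) d2.
  rewrite /GRing.scale/= mulr0 addr0; congr is_derive.
  have h1 : 0 < eps ^+ 2 + (t - y) ^+ 2 := poisson_den_gt0 _ e0.
  have h2 : 0 < 1 + ((t - y) / eps) ^+ 2 := one_add_sqr_gt0 _.
  rewrite /poisson; field; rewrite !gt_eqF//=.
- by move=> n; rewrite ltrD2l -subr_gt0 opprK addr_gt0.
- by move=> t _; exact: itv_exhaust.
- by rewrite -e.
- have -> : (fun n => (2 * atan ((y + n.+1%:R - y) / eps))%:C - (2 * atan ((y - n.+1%:R - y) / eps))%:C) =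
     (fun n => (4 * atan (n.+1%:R / eps))%:C).
    apply/funext => n; rewrite -rmorphB; congr (_%:C).
    have -> : y + n.+1%:R - y = n.+1%:R by ring.
    have -> : y - n.+1%:R - y = - n.+1%:R by ring.
    by rewrite mulNr atanN; ring.
  apply/ccvgP; split => /=; last exact: cvg_cst.
  have -> : 2 * pi = 4 * (pi / 2) :> R by field.
  apply: cvgM; first exact: cvg_cst.
  apply: (cvg_comp (fun n => n.+1%:R / eps) (@atan R)); last exact: cvgy_atan.
  apply/cvgryPge => A; exists (Num.truncn (`|A| * eps)) => // n /= hn.
  rewrite ler_pdivlMr//; apply: le_trans (_ : `|A| * eps <= _).
    by rewrite ler_wpM2r ?(ltW e0)// ler_norm.
  apply: le_trans (ltW (truncnS_gt _)) _.
  by rewrite ler_nat ltnS.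
Qed.

Lemma cvg0D (T : Type) (F : set_system T) (h : T -> R[i]) (w : R[i]) : Filter F ->
  (h x : R[i]^o) @[x --> F] --> (0 : R[i]^o) ->
  (h x + w : R[i]^o) @[x --> F] --> (w : R[i]^o).
Proof.
have aux (k : T -> R) (r : R) : Filter F -> k x @[x --> F] --> (0 : R) -> (k x + r) @[x --> F] --> r.
  move=> FF k0; rewrite -[X in _ --> X]add0r; apply: cvgD => //; exact: cvg_cst.
by move=> FF /ccvgP[/= hR hI]; apply/ccvgP; split;
  [under eq_fun do rewrite ReD|under eq_fun do rewrite ImD]; exact: aux.
Qed.

Lemma ccvg_ext (T : Type) (F : set_system T) (h k : T -> R[i]) (w : R[i]) :
  (forall x, h x = k x) -> (h x : R[i]^o) @[x --> F] --> (w : R[i]^o) ->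
  (k x : R[i]^o) @[x --> F] --> (w : R[i]^o).
Proof. by move=> /funext ->. Qed.

(** The mean value theorem is applied to each part, whence the factor 2. *)
Lemma lipschitz_cis u u' L : (forall t, cis_derive u t (u' t)) ->
  (forall t, Normc.normc (u' t) <= L) ->
  forall s t, Normc.normc (u s - u t) <= 2 * L * `|s - t|.
Proof.
move=> du uL.
have aux (pr : R[i] -> R) : (forall z, `|pr z| <= Normc.normc z) ->
    (forall t, is_derive t (1 : R) (fun s => pr (u s)) (pr (u' t))) ->
    forall s t, `|pr (u s) - pr (u t)| <= L * `|s - t|.
  move=> hpr dpr.
  have h s t : s <= t -> `|pr (u t) - pr (u s)| <= L * `|t - s|.
    move=> st; have cu : {within `[s, t], continuous (fun s => pr (u s))}.
      apply: continuous_subspaceT => x; apply: differentiable_continuous.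
      by apply/derivable1_diffP; have [] := dpr x.
    have [c _ ->] := MVT_segment st (fun x _ => dpr x) cu.
    by rewrite normrM ler_wpM2r// (le_trans (hpr _)).
  move=> s t; have [st|/ltW ts] := leP s t; last exact: h.
  by rewrite distrC [X in _ * X]distrC; exact: h.
move=> s t; apply: le_trans (normc_le_ReIm _) _.
rewrite ReD ImD ReN ImN -mulrA mulrDl mul1r lerD//.
  by apply: (aux (@complex.Re R)) => [z|x]; [exact: Re_le_normc|exact: (du x).1].
by apply: (aux (@complex.Im R)) => [z|x]; [exact: Im_le_normc|exact: (du x).2].
Qed.

(** Since all kernels have mass 2 pi, it remains to show that the integral of u(t) - u(y) against
    them tends to 0. Pointwise this holds because the kernel vanishes in the limit off [y] and the
    difference vanishes at [y]; the work lies in one dominating function for all n. *)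
Lemma poisson_identity u u' C L (y : R) : (forall t, cis_derive u t (u' t)) ->
  decay2 u C -> (forall t, Normc.normc (u' t) <= L) ->
  (cint mu (fun t => u t * (poisson n.+1%:R^-1 (t - y))%:C) : R[i]^o) @[n --> \oo] -->
  ((2 * pi)%:C * u y : R[i]^o).
Proof.
move=> du uC uL.
have e0 n : 0 < n.+1%:R^-1 :> R by rewrite invr_gt0.
have cu := ccont_deriv du.
have cp n : ccont (fun t => (poisson n.+1%:R^-1 (t - y))%:C).
  by split => /=; [exact: continuous_poisson|exact: cst_continuous].
have C0 : 0 <= C by apply: le_trans (uC 0); rewrite mulr_ge0 ?normc_ge0// ltW// one_add_sqr_gt0.
have uC' t : Normc.normc (u t) <= C.
  apply: le_trans (uC t); rewrite ler_peMl ?normc_ge0// lerDl sqr_ge0 //.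
have L0 : 0 <= L := le_trans (normc_ge0 _) (uL 0).
pose v t := u t - u y.
have cv : ccont v.
  apply: (@ccont_deriv _ _ u') => t.
  by have := cis_deriveD (du t) (cis_derive_cst (- u y) t); rewrite addr0.
(* Near [y] the Lipschitz bound 2 L |t - y| tames the peak of the kernel; far away the bound 2 C and
   the decay of the kernel suffice. Adding the two regimes gives the constant. *)
pose b t := (4 * L + 8 * C) * (2 * (1 + y ^+ 2)) * (1 + t ^+ 2)^-1.
have vb n t : Normc.normc (v t * (poisson n.+1%:R^-1 (t - y))%:C) <= b t.
  rewrite Normc.normcM normc_real ger0_norm ?poisson_ge0//.
  have h1 : Normc.normc (v t) <= 2 * L * `|t - y| := lipschitz_cis du uL t y.
  have h2 : Normc.normc (v t) <= 2 * C.
    apply: le_trans (normcDle _ _) _; rewrite normcN mulrDl mul1r lerD//.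
  have n1 : n.+1%:R^-1 <= 1 :> R by rewrite invf_le1// ler1n.
  have := e0 n; move: h1 h2 n1; rewrite /b /poisson; have := peetre1 y t.
  have y0 := one_add_sqr_gt0 y; have t0 := one_add_sqr_gt0 t.
  set w := Normc.normc _; set eps := n.+1%:R^-1; set r := t - y => h1 h2 h3 n1 ep.
  have d0 : 0 < eps ^+ 2 + r ^+ 2 := poisson_den_gt0 _ ep.
  rewrite ler_pdivlMr// mulrAC mulrA ler_pdivrMr//.
  have w0 : 0 <= w := normc_ge0 _.
  (* The term without r^2 uses 2 |r| eps <= eps^2 + r^2, the term with r^2 uses r^2 <= eps^2 + r^2
     and eps <= 1. *)
  have key : (1 + r ^+ 2) * (w * (2 * eps)) <= (4 * L + 8 * C) * (eps ^+ 2 + r ^+ 2).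
    have k1 : w * eps <= L * (eps ^+ 2 + r ^+ 2).
      apply: le_trans (_ : 2 * L * `|r| * eps <= _); first by rewrite ler_wpM2r// ltW.
      have := sqr_ge0 (`|r| - eps); rewrite sqrrB real_normK ?num_real//.
      have : 2 * L * `|r| * eps = L * (`|r| * eps *+ 2) by rewrite mulr2n; ring.
      move=> -> h; apply: ler_wpM2l => //; lra.
    have k2 : r ^+ 2 * (w * eps) <= 2 * C * (eps ^+ 2 + r ^+ 2).
      rewrite mulrC; apply: ler_pM; rewrite ?sqr_ge0 ?mulr_ge0 ?(ltW ep)//.
        by rewrite -[X in _ <= X]mulr1 ler_pM// ltW.
      by rewrite lerDr sqr_ge0.
    have D0 := mulr_ge0 L0 (ltW d0); have D1 := mulr_ge0 C0 (ltW d0).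
    have -> : (1 + r ^+ 2) * (w * (2 * eps)) = 2 * (w * eps) + 2 * (r ^+ 2 * (w * eps)) by ring.
    move: k1 k2 D0 D1; set D := eps ^+ 2 + r ^+ 2; rewrite mulrDl -!mulrA; lra.
  have -> : (4 * L + 8 * C) * (2 * (1 + y ^+ 2)) * (eps ^+ 2 + r ^+ 2) =
    (2 * (1 + y ^+ 2)) * ((4 * L + 8 * C) * (eps ^+ 2 + r ^+ 2)) by ring.
  apply: le_trans (_ : 2 * (1 + y ^+ 2) * ((1 + r ^+ 2) * (w * (2 * eps))) <= _); last first.
    by rewrite ler_wpM2l// mulr_ge0// ltW.
  have -> : w * (1 + t ^+ 2) * (2 * eps) = (1 + t ^+ 2) * (w * (2 * eps)) by ring.
  rewrite mulrA; apply: ler_wpM2r => //.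
  by rewrite !mulr_ge0// ltW.
have v0 : (cint mu (fun t => v t * (poisson n.+1%:R^-1 (t - y))%:C) : R[i]^o) @[n --> \oo] --> (0 : R[i]^o).
  rewrite -(cint0 mu).
  apply: (@cint_cvg _ _ _ mu _ \oo (fun n t => v t * (poisson n.+1%:R^-1 (t - y))%:C) (cst 0) b) => //.
  - exact: countably_based_oo.
  - by move=> n; apply: ccont_cmeas; exact: ccontM1.
  - by apply: rintegrableZ; exact: rintegrable_oneDsqrV.
  - exact: nearW.
  - move=> t; have [->|ty] := eqVneq t y.
      rewrite /v subrr; under eq_fun do rewrite mul0r; exact: cvg_cst.
    have r0 : 0 < (t - y) ^+ 2 by rewrite exprn_even_gt0//= subr_eq0.
    rewrite -[X in _ --> X](mulr0 (v t : R[i]^o)).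
    apply: (@cvgM _ _ \oo _ (cst (v t : R[i]^o)) (fun n => (poisson n.+1%:R^-1 (t - y))%:C : R[i]^o)).
      exact: cvg_cst.
    apply/ccvgP; split; last exact: cvg_cst.
    have h : (fun n => 2 / (t - y) ^+ 2 * n.+1%:R^-1 : R) @ \oo --> (0 : R).
      rewrite -[X in _ --> X](mulr0 (2 / (t - y) ^+ 2)); apply: cvgM; [exact: cvg_cst|exact: cvg_harmonic].
    apply: (squeeze_cvgr _ (cvg_cst 0) h); apply: nearW => n.
    rewrite poisson_ge0//= /poisson mulrAC ler_wpM2r ?(ltW (e0 n))//.
    by rewrite ler_wpM2l// lef_pV2 ?posrE ?poisson_den_gt0// lerDr sqr_ge0.
have -> : (fun n => cint mu (fun t => u t * (poisson n.+1%:R^-1 (t - y))%:C)) =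
    (fun n => cint mu (fun t => v t * (poisson n.+1%:R^-1 (t - y))%:C) + (2 * pi)%:C * u y).
  apply/funext => n; have [ip pE] := poisson_mass y (e0 n).
  rewrite -pE [X in _ + X]mulrC -cintZ// -cintD//.
  - by apply: eq_cint => t; rewrite /v; ring.
  - apply: (cintegrable_le (rintegrableZ _ (@rintegrable_oneDsqrV R))) (vb n).
    by apply: ccont_cmeas; exact: ccontM1.
  - exact: cintegrableZ.
exact: cvg0D.
Qed.

End inversion.

Section inversion_theorem.
Context {R : realType}.
Local Notation mu := (@lebesgue_measure R).

(** The outer integral is regularised by e^(-eps |xi|). Fubini's theorem turns it into the integral
    of [u] against the Poisson kernel, and the regularisation is removed by the decay of [uh]. The
    sign [s], 1 or -1, treats both transforms at once. *)
Lemma fourier_inversion1 (u u' uh : R -> R[i]) C L C' (s y : R) : s ^+ 2 = 1 ->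
  (forall t, cis_derive u t (u' t)) ->
  decay2 u C -> (forall t, Normc.normc (u' t) <= L) ->
  (forall xi, uh xi = cint mu (fun t => cexpi (- s * (xi * t)) * u t)) ->
  decay2 uh C' ->
  cint mu (fun xi => cexpi (s * (y * xi)) * uh xi) =
  (2 * pi)%:C * u y.
Proof.
move=> s1 du uC uL uhE uhC.
have cu := ccont_deriv du.
have C0 : 0 <= C by apply: le_trans (uC 0); rewrite mulr_ge0 ?normc_ge0// ltW// one_add_sqr_gt0.
have e0 n : 0 < n.+1%:R^-1 :> R by rewrite invr_gt0.
have s_bound xi t : Normc.normc (cexpi (- s * (xi * t)) * u t) <= C * (1 + t ^+ 2)^-1.
  by rewrite Normc.normcM normc_cexpi mul1r; exact: decay2_le.
have mexp (e : R) : measurable_fun setT (fun xi : R => expR (- (e * `|xi|))).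
  apply: continuous_measurable_fun => x; apply: continuous_comp; last exact: continuous_expR.
  by apply: cvgN; apply: cvgM; [exact: cvg_cst|exact: norm_continuous].
have iexp (e : R) : 0 < e -> rintegrable mu (fun xi : R => expR (- (e * `|xi|))).
  move=> ep; have [[i _] _] := poisson_kernel 0 ep.
  suff -> : (fun xi : R => expR (- (e * `|xi|))) =
    (fun xi => complex.Re ((expR (- (e * `|xi|)))%:C * cexpi (xi * 0))) by [].
  by apply/funext => xi; rewrite mulr0 cexpi0 mulr1.
pose K (e : R) (z : R * R) := (expR (- (e * `|z.1|)))%:C * cexpi (s * (y * z.1)) *
  (cexpi (- s * (z.1 * z.2)) * u z.2).
have iK e : 0 < e -> cintegrable (mu \x mu)%E (K e).
  move=> ep; apply: (cintegrable_le (rintegrable_prod (iexp e ep)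
     (rintegrableZ C (@rintegrable_oneDsqrV R)))).
    apply: cmeasM.
      apply: cmeasM; first by apply: cmeas_real; exact: measurableT_comp (mexp e) _.
      by apply: cmeas_cexpi; do 2 apply: measurable_funM => //.
    apply: cmeasM; last exact: (cmeas_comp (measurable_snd) (ccont_cmeas cu)).
    by apply: cmeas_cexpi; do 2 apply: measurable_funM => //.
  move=> [xi t]; rewrite /K /= Normc.normcM Normc.normcM normc_cexpi mulr1 normc_real.
  by rewrite ger0_norm ?expR_ge0// ler_wpM2l ?expR_ge0.
have iu xi : cintegrable mu (fun t => cexpi (- s * (xi * t)) * u t).
  apply: (cintegrable_le (rintegrableZ C (@rintegrable_oneDsqrV R))) => //.
  apply: cmeasM; last exact: ccont_cmeas.
  by apply: cmeas_cexpi; do 2 apply: measurable_funM => //.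
have inner e xi : cint mu (fun t => K e (xi, t)) =
    (expR (- (e * `|xi|)))%:C * cexpi (s * (y * xi)) * uh xi.
  by rewrite /K /= cintZ// uhE.
(* Measurability of the transform comes from Fubini's theorem applied to the kernel with eps = 1,
   after cancelling the nonvanishing factor in front. *)
have muh : cmeas (uh : measurableTypeR R -> R[i]).
  have [i1 _] := cint_fubini1 (iK 1 ltr01).
  have m1 := cintegrable_cmeas i1.
  have -> : uh = (fun xi => ((expR (1 * `|xi|))%:C * cexpi (- (s * (y * xi)))) *
      cint mu (fun t => K 1 (xi, t))).
    apply/funext => xi; rewrite inner; set a := _ * xi.
    rewrite mulrA mulrACA -cexpiD addNr cexpi0 mulr1 -rmorphM -expRD subrr expR0.
    by rewrite mul1r.
  apply: cmeasM => //; apply: cmeasM.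
    apply: cmeas_real; apply: continuous_measurable_fun => x.
    apply: continuous_comp; last exact: continuous_expR.
    by apply: cvgM; [exact: cvg_cst|exact: norm_continuous].
  apply: cmeas_cexpi; apply: measurableT_comp => //.
  by do 2 apply: measurable_funM => //.
have := poisson_identity (y := y) du uC uL; move: (_ * u y) => w lim1.
have lim2 : (cint mu (fun xi => (expR (- (n.+1%:R^-1 * `|xi|)))%:C * cexpi (s * (y * xi)) * uh xi) : R[i]^o)
    @[n --> \oo] --> (cint mu (fun xi => cexpi (s * (y * xi)) * uh xi) : R[i]^o); last first.
  apply: (@cvg_unique (R[i]^o) (@norm_hausdorff _ (R[i]^o)) _ _ _ _ lim2).
  apply: ccvg_ext lim1 => n; under [RHS]eq_cint do rewrite -inner.
    (* Once the integrals are exchanged, the xi-integral is that of e^(-eps |xi|) against a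
       character, that is, the Poisson kernel at t - y. *)
    have [_ <-] := cint_fubini1 (iK _ (e0 n)); have [_ ->] := cint_fubini2 (iK _ (e0 n)).
    symmetry.
    apply: eq_cint => t; rewrite /K /=.
    have [ip pE] := poisson_kernel (s * (y - t)) (e0 n).
    have -> : (poisson n.+1%:R^-1 (t - y))%:C = (2 * n.+1%:R^-1 / (n.+1%:R^-1 ^+ 2 + (s * (y - t)) ^+ 2))%:C.
      by rewrite /poisson exprMn s1 mul1r -(sqrrN (t - y)) opprB.
    rewrite -pE -cintZ//.
    apply: eq_cint => xi; rewrite /K /=.
      have -> : cexpi (xi * (s * (y - t))) = cexpi (s * (y * xi)) * cexpi (- s * (xi * t)).
        by rewrite -cexpiD; congr cexpi; ring.
      by move: (_%:C) (cexpi _) (cexpi _) (u t) => c1 c2 c3 c4; ring.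
apply: (@cint_cvg _ _ _ mu _ \oo
  (fun n xi => (expR (- (n.+1%:R^-1 * `|xi|)))%:C * cexpi (s * (y * xi)) * uh xi)
  (fun xi => cexpi (s * (y * xi)) * uh xi) (fun t => C' * (1 + t ^+ 2)^-1) _ countably_based_oo).
- move=> n; apply: cmeasM => //; apply: cmeasM; first exact: cmeas_real (mexp _).
  by apply: cmeas_cexpi; do 2 apply: measurable_funM => //.
- apply: cmeasM => //; apply: cmeas_cexpi; do 2 apply: measurable_funM => //.
- by apply: rintegrableZ; exact: rintegrable_oneDsqrV.
- apply: nearW => n xi; rewrite !Normc.normcM normc_cexpi mulr1 normc_real ger0_norm ?expR_ge0//.
  apply: le_trans (decay2_le uhC xi); apply: ler_piMl; first exact: normc_ge0.
  by rewrite expR_le1 oppr_le0 mulr_ge0// ltW.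
- move=> xi; rewrite -[X in _ --> X]mul1r.
  under eq_fun do rewrite -mulrA.
  apply: (@cvgM _ _ \oo _ (fun n => (expR (- (n.+1%:R^-1 * `|xi|)))%:C : R[i]^o)
    (cst (cexpi (s * (y * xi)) * uh xi : R[i]^o))); last exact: cvg_cst.
  apply/ccvgP; split => /=; last exact: cvg_cst.
  have lim0 : (- (n.+1%:R^-1 * `|xi|)) @[n --> \oo] --> (0 : R); last first.
    by have := cvg_comp _ _ lim0 (@continuous_expR R 0); rewrite expR0.
  rewrite -[X in _ --> X]oppr0; apply: cvgN; rewrite -[X in _ --> X](mul0r `|xi|).
  by apply: cvgM; [exact: cvg_harmonic|exact: cvg_cst].
Qed.

End inversion_theorem.

(** * Fourier transforms one coordinate at a time *)

Section partial_fourier.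
Context {R : realType}.
Local Notation mu := (@lebesgue_measure R).

Lemma ccontinuous_cexpi n (f : 'rV[R]_n -> R) : continuous f -> ccontinuous (fun x => cexpi (f x)).
Proof.
move=> cf; apply/ccontinuousP; split => x /=.
  by apply: continuous_comp; [exact: cf|exact: continuous_cos].
by apply: continuous_comp; [exact: cf|exact: continuous_sin].
Qed.

Lemma pd_of_setc n (f : 'rV[R]_n -> R[i]) j x l :
  cis_derive (fun s => f (setc x j s)) (x ord0 j) l -> pd f j x l.
Proof.
move=> [dR dI].
have shift (h : R -> R) (r : R) : is_derive (x ord0 j) (1 : R) h r ->
    is_derive (0 : R) (1 : R) (fun s => h (x ord0 j + s)) r.
  move=> dh.
  have dt : is_derive (0 : R) (1 : R) (fun s : R => x ord0 j + s) (1 : R).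
    by have := is_deriveD (is_derive_cst (x ord0 j) (0 : R) (1 : R)) (is_derive_id (0 : R) (1 : R)); rewrite add0r.
  have dh' : is_derive (x ord0 j + 0) (1 : R) h r by rewrite addr0.
  by have := @is_derive1_comp _ h (fun s => x ord0 j + s) 0 r 1 dh' dt; rewrite mulr1.
split; [move: (shift _ _ dR)|move: (shift _ _ dI)]; congr is_derive; apply/funext => s;
  by rewrite /line_fun add_delta.
Qed.

Definition fourier_cst1 : R[i] := ((Num.sqrt (2 * pi)) ^-1)%:C.

Lemma fourier_cst1_sqr : fourier_cst1 * fourier_cst1 * (2 * pi)%:C = 1.
Proof.
rewrite /fourier_cst1 -!rmorphM -invfM -expr2 sqr_sqrtr; last by rewrite mulr_ge0// pi_ge0.
by rewrite mulVf// gt_eqF// mulr_gt0// pi_gt0.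
Qed.

Lemma ccontD1 (u v : R -> R[i]) : ccont u -> ccont v -> ccont (fun t => u t + v t).
Proof.
move=> [uR uI] [vR vI]; split.
  by under eq_fun do rewrite ReD; exact: contD.
by under eq_fun do rewrite ImD; exact: contD.
Qed.

(** The transform in the coordinate [j] alone, direct for s = -1 and inverse for s = 1. The
    transforms of the statement are compositions of these, so inversion on the line is enough, and
    transforming only the space coordinates needs no separate theory. *)
Definition coord_fourier (s : R) n (j : 'I_n) (f : 'rV[R]_n -> R[i]) : 'rV[R]_n -> R[i] :=
  fun x => fourier_cst1 * cint mu (fun t => cexpi (s * (x ord0 j * t)) * f (setc x j t)).

Section one_function.
Context (s : R) {n : nat} (j : 'I_n).
Implicit Types (f : 'rV[R]_n -> R[i]) (x : 'rV[R]_n).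

Definition decay1 f C := forall y, weight y * Normc.normc (f y) <= C.

Lemma decay1_slice f C x : decay1 f C -> decay2 (fun t => f (setc x j t)) C.
Proof.
move=> fC t; apply: le_trans (fC (setc x j t)).
by rewrite ler_wpM2r ?normc_ge0// weight_setc.
Qed.

Lemma ccontinuous_slice f x : ccontinuous f -> ccont (fun t => f (setc x j t)).
Proof.
move=> /ccontinuousP[fR fI]; split => t.
  exact: (cvg_comp _ _ (@continuous_setc R n x j t) (fR _)).
exact: (cvg_comp _ _ (@continuous_setc R n x j t) (fI _)).
Qed.

Lemma ccont_cexpi (a : R) : ccont (fun t => cexpi (s * (a * t))).
Proof.
apply: (@ccont_deriv _ _ (fun t => (0 +i* (s * a)) * cexpi (s * (a * t)))) => t.
have := cis_derive_cexpi (s * a) t; rewrite -mulrA; congr cis_derive.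
by apply/funext => r; rewrite mulrA.
Qed.

Lemma decay2_cexpi (a : R) u C : decay2 u C -> decay2 (fun t => cexpi (s * (a * t)) * u t) C.
Proof. by move=> uC t; rewrite Normc.normcM normc_cexpi mul1r. Qed.

Lemma cmeas_coord_fourier_integrand f x (a : R) : ccontinuous f ->
  cmeas ((fun t => cexpi (s * (a * t)) * f (setc x j t)) : measurableTypeR R -> R[i]).
Proof. by move=> cf; apply/ccont_cmeas/ccontM1; [exact: ccont_cexpi|exact: ccontinuous_slice]. Qed.

Lemma cintegrable_coord_fourier f C x (a : R) : ccontinuous f -> decay1 f C ->
  cintegrable mu (fun t => cexpi (s * (a * t)) * f (setc x j t)).
Proof.
move=> cf fC; apply: (@cintegrable_decay2 _ _ C); first exact: cmeas_coord_fourier_integrand.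
by apply: decay2_cexpi; exact: decay1_slice.
Qed.

Definition coord_fourier_bound : R := Normc.normc fourier_cst1 * cauchy_mass.

Lemma normc_coord_fourier f C x : ccontinuous f -> decay1 f C -> Normc.normc (coord_fourier s j f x) <= coord_fourier_bound * C.
Proof.
move=> cf fC; rewrite /coord_fourier Normc.normcM /coord_fourier_bound -mulrA ler_wpM2l ?normc_ge0//.
apply: normc_cint_decay2; first exact: cmeas_coord_fourier_integrand.
by apply: decay2_cexpi; exact: decay1_slice.
Qed.

Lemma ccontinuous_coord_fourier f C : ccontinuous f -> decay1 f C -> ccontinuous (coord_fourier s j f).
Proof.
move=> cf fC; rewrite /coord_fourier; apply: ccontM.
  by apply/ccontinuousP; split; exact: cst_continuous.
move=> x0; apply: (@cint_cvg _ _ _ mu _ (nbhs x0)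
  (fun x t => cexpi (s * (x ord0 j * t)) * f (setc x j t))
  (fun t => cexpi (s * (x0 ord0 j * t)) * f (setc x0 j t))
  (fun t => C * (1 + t ^+ 2)^-1) _ (@countably_based_nbhs R _ x0)).
- by move=> x; exact: cmeas_coord_fourier_integrand.
- exact: cmeas_coord_fourier_integrand.
- by apply: rintegrableZ; exact: rintegrable_oneDsqrV.
- apply: nearW => x t; exact: (decay2_le (decay2_cexpi _ (decay1_slice _ fC)) t).
- move=> t.
  have h : ccontinuous (fun x => cexpi (s * (x ord0 j * t)) * f (setc x j t)); last exact: (h x0).
  apply: ccontM.
    apply: ccontinuous_cexpi => x; apply: (@cvgM _ _ (nbhs x)); first exact: cvg_cst.
    by apply: (@cvgM _ _ (nbhs x)); [exact: coord_continuous|exact: cvg_cst].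
  move=> x; exact: (cvg_comp _ _ (@continuous_setc_l R n j t x) (cf _)).
Qed.

Lemma coord_fourier_indep f (m : 'rV[R]_n -> R[i]) C x : ccontinuous f -> decay1 f C ->
  (forall t, m (setc x j t) = m x) ->
  coord_fourier s j (fun y => m y * f y) x = m x * coord_fourier s j f x.
Proof.
move=> cf fC hm; rewrite /coord_fourier mulrCA; congr (_ * _).
rewrite -cintZ; last exact: cintegrable_coord_fourier cf fC.
by apply: eq_cint => t; rewrite hm mulrCA.
Qed.

Lemma coord_fourier_add f g C C' x : ccontinuous f -> decay1 f C -> ccontinuous g -> decay1 g C' ->
  coord_fourier s j (fun y => f y + g y) x = coord_fourier s j f x + coord_fourier s j g x.
Proof.
move=> cf fC cg gC; rewrite /coord_fourier -mulrDr; congr (_ * _).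
rewrite -cintD; [|exact: cintegrable_coord_fourier cf fC|exact: cintegrable_coord_fourier cg gC].
by apply: eq_cint => t; rewrite mulrDr.
Qed.

Lemma pd_coord_fourier_other f f' C C' k x : k != j -> ccontinuous f -> decay1 f C ->
  (forall y, pd f k y (f' y)) -> ccontinuous f' -> decay1 f' C' ->
  pd (coord_fourier s j f) k x (coord_fourier s j f' x).
Proof.
move=> kj cf fC df cf' fC'; apply: pd_of_setc.
pose F h t := cexpi (s * (x ord0 j * t)) * f (setc (setc x j t) k h).
pose F' h t := cexpi (s * (x ord0 j * t)) * f' (setc (setc x j t) k h).
have e (g : 'rV[R]_n -> R[i]) h : coord_fourier s j g (setc x k h) =
    fourier_cst1 * cint mu (fun t => cexpi (s * (x ord0 j * t)) * g (setc (setc x j t) k h)).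
  rewrite /coord_fourier setcE eq_sym (negbTE kj); congr (_ * _); apply: eq_cint => t.
  by rewrite (setcC _ _ _ kj).
have -> : (fun h => coord_fourier s j f (setc x k h)) = (fun h => fourier_cst1 * cint mu (F h)).
  by apply/funext => h; exact: e.
have -> : coord_fourier s j f' x = 0 * cint mu (F (x ord0 k)) + fourier_cst1 * cint mu (F' (x ord0 k)).
  by rewrite mul0r add0r -e setc_id.
apply: cis_deriveM; first exact: cis_derive_cst.
apply: (@cderive_under_integral _ _ _ mu F F' (fun t => C' * (1 + t ^+ 2)^-1)).
- move=> h; have := cintegrable_coord_fourier (setc x k h) (x ord0 j) cf fC.
  by congr (cintegrable mu _); apply/funext => t; rewrite /F (setcC _ _ _ kj).
- move=> h t; have := cis_deriveM (cis_derive_cst (cexpi (s * (x ord0 j * t))) h) (pd_setc (setc x j t) df h).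
  by rewrite mul0r add0r.
- by apply: rintegrableZ; exact: rintegrable_oneDsqrV.
- move=> h t _; have := decay2_le (decay2_cexpi (x ord0 j) (decay1_slice (setc x k h) fC')) t.
  by rewrite /F' (setcC _ _ _ kj).
Qed.

Lemma pd_coord_fourier_same f C C' x : ccontinuous f -> decay1 f C ->
  decay1 (fun y => (0 +i* (s * y ord0 j)) * f y) C' ->
  pd (coord_fourier s j f) j x (coord_fourier s j (fun y => (0 +i* (s * y ord0 j)) * f y) x).
Proof.
move=> cf fC fC'; apply: pd_of_setc.
have cf' : ccontinuous (fun y => (0 +i* (s * y ord0 j)) * f y).
  apply: (fun h => ccontM h cf); apply/ccontinuousP; split => /=; first exact: cst_continuous.
  by apply: contM; [exact: cst_continuous|exact: coord_continuous].
pose F h t := cexpi (s * (h * t)) * f (setc x j t).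
pose F' h t := cexpi (s * (h * t)) * ((0 +i* (s * t)) * f (setc x j t)).
have -> : (fun h => coord_fourier s j f (setc x j h)) = (fun h => fourier_cst1 * cint mu (F h)).
  apply/funext => h; rewrite /coord_fourier setcE eqxx; congr (_ * _); apply: eq_cint => t.
  by rewrite setc_setc.
have -> : coord_fourier s j (fun y => (0 +i* (s * y ord0 j)) * f y) x =
    0 * cint mu (F (x ord0 j)) + fourier_cst1 * cint mu (F' (x ord0 j)).
  by rewrite mul0r add0r /coord_fourier; congr (_ * _); apply: eq_cint => t; rewrite setcE eqxx.
apply: cis_deriveM; first exact: cis_derive_cst.
apply: (@cderive_under_integral _ _ _ mu F F' (fun t => C' * (1 + t ^+ 2)^-1)).
- by move=> h; exact: cintegrable_coord_fourier cf fC.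
- move=> h t; have := cis_deriveM (cis_derive_cexpi (s * t) h) (cis_derive_cst (f (setc x j t)) h).
  rewrite mulr0 addr0 /F /F'.
  have e r : s * t * r = s * (r * t) by ring.
  rewrite e; under [X in cis_derive X _ _ -> _]eq_fun do rewrite e.
  by rewrite -mulrA mulrCA.
- by apply: rintegrableZ; exact: rintegrable_oneDsqrV.
- move=> h t _; have := decay2_le (decay2_cexpi h (decay1_slice x fC')) t.
  by rewrite /F' setcE eqxx.
Qed.

(** Integration by parts, as the vanishing of the integral of a derivative. *)
Lemma coord_fourier_parts f f' C C' x : ccontinuous f -> decay1 f C ->
  (forall y, pd f j y (f' y)) -> ccontinuous f' -> decay1 f' C' ->
  coord_fourier s j f' x = - ((0 +i* (s * x ord0 j)) * coord_fourier s j f x).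
Proof.
move=> cf fC df cf' fC'.
set a := 0 +i* _; apply/eqP; rewrite -addr_eq0 /coord_fourier.
have i1 := cintegrable_coord_fourier x (x ord0 j) cf fC; have i2 := cintegrable_coord_fourier x (x ord0 j) cf' fC'.
rewrite [a * _]mulrCA -mulrDr -cintZ// -cintD//; last exact: cintegrableZ.
(* [u'] is the derivative of the character times the slice of [f], by the product rule. *)
set u' := fun t => _ + _.
have du t : cis_derive (fun t => cexpi (s * (x ord0 j * t)) * f (setc x j t)) t (u' t).
  have := cis_deriveM (cis_derive_cexpi (s * x ord0 j) t) (pd_setc x df t).
  rewrite /u' -!mulrA [X in cis_derive _ _ X -> _]addrC; congr cis_derive.
  by apply/funext => r; rewrite mulrA.
rewrite (@cint_derive0 _ _ u' C (C' + Normc.normc a * C) du) ?mulr0//.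
- apply: ccontD1; first by apply: ccontM1; [exact: ccont_cexpi|exact: ccontinuous_slice].
  apply: ccontM1; first by split; exact: cst_continuous.
  by apply: ccontM1; [exact: ccont_cexpi|exact: ccontinuous_slice].
- by apply: decay2_cexpi; exact: decay1_slice.
- move=> t; rewrite /u'.
  have h1 := decay2_cexpi (x ord0 j) (decay1_slice x fC') t.
  have h2 := decay2_cexpi (x ord0 j) (decay1_slice x fC) t.
  have w0 := ltW (one_add_sqr_gt0 t).
  apply: le_trans (ler_wpM2l w0 (normcDle _ _)) _; rewrite mulrDr lerD//.
  by rewrite Normc.normcM mulrCA ler_wpM2l ?normc_ge0.
Qed.

End one_function.

End partial_fourier.

(** * Continuity of the one-coordinate transforms on the Schwartz space *)

Section fourier_families.
Context {R : realType}.
Local Notation mu := (@lebesgue_measure R).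
Variable I : set (nat -> R).
Hypothesis idI : seq_ideal I.

Lemma SF_decay1 n (phi : nat -> 'rV[R]_n -> R[i]) : SF I phi ->
  (forall k, ccontinuous (phi k)) /\ exists2 a, I a & forall k, decay1 (phi k) (a k).
Proof.
move=> /SF_schwartz_class[c d _]; split=> //.
by have [a Ia ha] := d 1%N; exists a => // k y; have := ha k y; rewrite expr1.
Qed.

Variable s : R.
Hypothesis s1 : s ^+ 2 = 1.

Section coordinate.
Context {n : nat} (j : 'I_n).
Implicit Types phi psi : nat -> 'rV[R]_n -> R[i].

Lemma SF_icoord phi : SF I phi -> SF I (fun k x => (0 +i* (s * x ord0 j)) * phi k x).
Proof.
move=> sphi; have := SF_scale idI (0 +i* s) (SF_coord idI j sphi); congr SF.
apply/funext => k; apply/funext => x; rewrite mulrA; congr (_ * _).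
by apply: complexP => /=; ring.
Qed.

(** The part of the weight that is constant along the coordinate [j], hence commutes with the
    transform in that coordinate. *)
Definition weight_off (x : 'rV[R]_n) : R := weight x - x ord0 j ^+ 2.

Lemma SF_weight_off phi : SF I phi -> SF I (fun k x => (weight_off x)%:C * phi k x).
Proof.
move=> sphi.
have h i : SF I (fun k x => (if i == j then 0 else 1) * ((x ord0 i)%:C * ((x ord0 i)%:C * phi k x))).
  by apply: SF_scale => //; do 2 apply: SF_coord => //.
have := SF_add idI sphi (SF_sum idI (index_enum 'I_n) (ex_intro _ _ sphi) h).
congr SF; apply/funext => k; apply/funext => x.
rewrite -[X in X + _]mul1r /weight_off /weight /dotv (bigD1 j)//= [\sum_(i < n) _ i * _](bigD1 j)//=.
rewrite eqxx mul0r add0r.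
have -> : \sum_(i < n | i != j) (if i == j then 0 else 1) * ((x ord0 i)%:C * ((x ord0 i)%:C * phi k x)) =
  (\sum_(i < n | i != j) x ord0 i * x ord0 i)%:C * phi k x.
  rewrite rmorph_sum mulr_suml; apply: eq_bigr => i /negbTE ->.
  by rewrite mul1r mulrA rmorphM.
by rewrite -mulrDl -rmorphD; congr (_%:C * _); rewrite expr2; ring.
Qed.

(** The operator that the transform in coordinate [j] turns into multiplication by the weight: x_j^2
    corresponds to minus the second derivative along [j], because s^2 = 1. *)
Definition coord_fourier_laplace phi : nat -> 'rV[R]_n -> R[i] := fun k x =>
  (weight_off x)%:C * phi k x + (-1) * partial j (partial j (phi k)) x.

Lemma SF_laplace phi : SF I phi -> SF I (coord_fourier_laplace phi).
Proof.
move=> sphi; apply: (SF_add idI); first exact: SF_weight_off.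
by apply: SF_scale => //; apply: (SF_partial j (SF_partial j sphi).1).1.
Qed.

Lemma coord_fourier_weight phi k x : SF I phi ->
  (weight x)%:C * coord_fourier s j (phi k) x = coord_fourier s j (coord_fourier_laplace phi k) x.
Proof.
move=> sphi; have [cphi [a _ ha]] := SF_decay1 sphi.
have [sd dd] := SF_partial j sphi; have [cd [b _ hb]] := SF_decay1 sd.
have [sdd ddd] := SF_partial j sd; have [cdd [e _ he]] := SF_decay1 sdd.
have [cw [w _ hw]] := SF_decay1 (SF_weight_off sphi).
have [cm [m _ hm]] := SF_decay1 (SF_scale idI (-1) sdd).
rewrite /coord_fourier_laplace (coord_fourier_add s j x (cw k) (hw k) (cm k) (hm k)).
rewrite (coord_fourier_indep s (cphi k) (ha k)); last first.
  move=> t; congr (_%:C); rewrite /weight_off /weight /dotv (bigD1 j)//= [X in _ = 1 + X - _](bigD1 j)//= setcE eqxx.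
  have -> : \sum_(i < n | i != j) setc x j t ord0 i * setc x j t ord0 i =
      \sum_(i < n | i != j) x ord0 i * x ord0 i.
    by apply: eq_bigr => i /negbTE ij; rewrite setcE ij.
  by ring.
rewrite (coord_fourier_indep s (cdd k) (he k))//.
rewrite (coord_fourier_parts s x (cd k) (hb k) (ddd k) (cdd k) (he k)).
rewrite (coord_fourier_parts s x (cphi k) (ha k) (dd k) (cd k) (hb k)).
rewrite mulN1r opprK mulrN; set P := coord_fourier _ _ _ _.
rewrite [X in _ - X]mulrA -mulrBl; congr (_ * _).
apply: complexP; rewrite /weight_off /=; last by ring.
have -> : s * x ord0 j * (s * x ord0 j) = s ^+ 2 * x ord0 j ^+ 2 by ring.
by rewrite s1; ring.
Qed.

(** Induction on the power of the weight: each power is traded for one application of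
    [coord_fourier_laplace], which stays within Schwartz families. *)
Lemma decays_coord_fourier phi : SF I phi -> decays I (fun k => coord_fourier s j (phi k)).
Proof.
move=> sphi N; elim: N phi sphi => [|N ih] phi sphi.
  have [cphi [a Ia ha]] := SF_decay1 sphi.
  exists (fun k => coord_fourier_bound * a k); first by case: idI => _ + _; apply.
  by move=> k x; rewrite expr0 mul1r; apply: normc_coord_fourier.
have [a Ia ha] := ih _ (SF_laplace sphi); exists a => // k x.
rewrite exprSr -mulrA; have := ha k x; rewrite -(coord_fourier_weight k x sphi) Normc.normcM normc_real.
by rewrite ger0_norm// ltW// weight_gt0.
Qed.

(** Transforms of Schwartz families are closed under derivation: along [j] it becomes multiplication
    by a coordinate under the integral, along other coordinates it commutes with the transform. *)
Lemma SF_coord_fourier phi : SF I phi -> SF I (fun k => coord_fourier s j (phi k)).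
Proof.
move=> sphi; apply: (@SF_class _ _ _ [set chi | exists2 psi, SF I psi & chi = fun k => coord_fourier s j (psi k)]); last by exists phi.
move=> _ [psi spsi ->]; have [cpsi [a _ ha]] := SF_decay1 spsi; split.
- by move=> k; exact: ccontinuous_coord_fourier (ha k).
- exact: decays_coord_fourier.
- move=> i; have [->|ij] := eqVneq i j.
    have sx := SF_icoord spsi; have [cx [b _ hb]] := SF_decay1 sx.
    exists (fun k => coord_fourier s j (fun x => (0 +i* (s * x ord0 j)) * psi k x)).
      by exists (fun k (x : 'rV[R]_n) => (0 +i* (s * x ord0 j)) * psi k x).
    by move=> k x; exact: pd_coord_fourier_same (ha k) (hb k).
  have [sd dd] := SF_partial i spsi; have [cd [b _ hb]] := SF_decay1 sd.
  exists (fun k => coord_fourier s j (partial i (psi k))); first by exists (fun k => partial i (psi k)).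
  by move=> k x; exact: (pd_coord_fourier_other s x ij (cpsi k) (ha k) (dd k) (cd k) (hb k)).
Qed.

End coordinate.

End fourier_families.

Section fourier_schwartz.
Context {R : realType}.
Local Notation mu := (@lebesgue_measure R).

Local Notation S f := (SF (@all_seq R) (fun=> f)).

Lemma S_decay1 n (f : 'rV[R]_n -> R[i]) : S f -> ccontinuous f /\ exists C, decay1 f C.
Proof. by move=> /SF_decay1[c [a _ h]]; split; [exact: c 0%N|exists (a 0%N); exact: h]. Qed.

Lemma S_decay n (f : 'rV[R]_n -> R[i]) N : S f -> exists C, forall x, weight x ^+ N * Normc.normc (f x) <= C.
Proof. by move=> /SF_schwartz_class[_ /(_ N)[a _ h] _]; exists (a 0%N) => x; exact: h. Qed.

Lemma S_coord_fourier n s (j : 'I_n) (f : 'rV[R]_n -> R[i]) : s ^+ 2 = 1 -> S f -> S (coord_fourier s j f).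
Proof. by move=> s1 sf; have := SF_coord_fourier (@all_seq_ideal R) s1 j sf. Qed.

Lemma coord_fourier_inversion n s (j : 'I_n) (f : 'rV[R]_n -> R[i]) : s ^+ 2 = 1 -> S f ->
  coord_fourier s j (coord_fourier (- s) j f) = f.
Proof.
move=> s1 sf; apply/funext => x.
have [sd dd] := SF_partial j sf; have [cd [L hL]] := S_decay1 sd.
have [cf [C hC]] := S_decay1 sf.
have s1' : (- s) ^+ 2 = 1 by rewrite sqrrN.
have [_ [C' hC']] := S_decay1 (S_coord_fourier j s1' sf).
pose uh xi := cint mu (fun t => cexpi (- s * (xi * t)) * f (setc x j t)).
have e xi : coord_fourier (- s) j f (setc x j xi) = fourier_cst1 * uh xi.
  rewrite /coord_fourier setcE eqxx; congr (_ * _); apply: eq_cint => t; by rewrite setc_setc.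
have fc0 : 0 < Normc.normc (@fourier_cst1 R).
  by rewrite /fourier_cst1 normc_real normr_gt0 invr_eq0 gt_eqF// sqrtr_gt0 mulr_gt0// pi_gt0.
have uhC : decay2 uh (C' / Normc.normc (@fourier_cst1 R)).
  move=> xi; rewrite ler_pdivlMr// -mulrA [X in _ * X]mulrC -Normc.normcM -e.
  exact: (@decay1_slice R n j _ _ x hC' xi).
have L1 t : Normc.normc (partial j f (setc x j t)) <= L.
  by apply: le_trans (hL (setc x j t)); rewrite ler_peMl ?normc_ge0// weight_ge1.
have := @fourier_inversion1 R (fun t => f (setc x j t)) (fun t => partial j f (setc x j t)) uh
  C L _ s (x ord0 j) s1 (pd_setc x (dd 0%N)) (decay1_slice j x hC) L1 (fun=> erefl) uhC.
rewrite setc_id => h.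
rewrite {1}/coord_fourier; under eq_cint do rewrite e mulrCA.
rewrite cintZ; last first.
  apply: (@cintegrable_decay2 _ _ (C' / Normc.normc (@fourier_cst1 R))); last exact: decay2_cexpi.
  have -> : uh = (fun xi => fourier_cst1^-1 * coord_fourier (- s) j f (setc x j xi)).
    by apply/funext => xi; rewrite e mulKf//; apply/eqP => fc; rewrite fc Normc.normc0 ltxx in fc0.
  apply/ccont_cmeas/ccontM1; first exact: ccont_cexpi.
  apply: ccontM1; first by split; exact: cst_continuous.
  by apply: ccontinuous_slice; exact: ccontinuous_coord_fourier hC.
by rewrite h !mulrA fourier_cst1_sqr mul1r.
Qed.

(** Both sides are iterated integrals of the same kernel, whose joint integrability comes from two
    powers of the weight. *)
Lemma coord_fourierC n s t (i j : 'I_n) (f : 'rV[R]_n -> R[i]) : i != j -> S f ->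
  coord_fourier s i (coord_fourier t j f) = coord_fourier t j (coord_fourier s i f).
Proof.
move=> ij sf; apply/funext => x.
have [cf [C1 hC1]] := S_decay1 sf; have [C hC] := S_decay 2 sf.
pose K (z : R * R) := cexpi (s * (x ord0 i * z.1)) * (cexpi (t * (x ord0 j * z.2)) * f (setc (setc x i z.1) j z.2)).
have iK : cintegrable (mu \x mu)%E K.
  have ioneD := @rintegrable_oneDsqrV R.
  apply: (cintegrable_le (rintegrable_prod (rintegrableZ C ioneD) ioneD)).
    apply: cmeasM; first by apply: cmeas_cexpi; do 2 apply: measurable_funM => //.
    apply: cmeasM; first by apply: cmeas_cexpi; do 2 apply: measurable_funM => //.
    apply: (@cmeas_comp _ _ _ _ _ (fun z : R * R => setc (setc x i z.1) j z.2)); last exact: ccontinuous_cmeas.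
    apply: measurable_fun_rV => k; under eq_fun do rewrite setcE.
    case: (k == j); first exact: measurable_snd.
    under eq_fun do rewrite setcE.
    by case: (k == i); [exact: measurable_fst|exact: measurable_cst].
  move=> [a b]; rewrite /K /= !Normc.normcM !normc_cexpi !mul1r.
  rewrite -mulrA -invfM ler_pdivlMr ?mulr_gt0 ?one_add_sqr_gt0// mulrC.
  by apply: le_trans (hC _); apply: ler_wpM2r; [exact: normc_ge0|exact: weight_setc2].
have fs : coord_fourier s i (coord_fourier t j f) x = fourier_cst1 * (fourier_cst1 * cint mu (fun a => cint mu (fun b => K (a, b)))).
  rewrite {1}/coord_fourier; congr (_ * _); rewrite -cintZ; last by have [] := cint_fubini1 iK.
  apply: eq_cint => a; rewrite /coord_fourier setcE eq_sym (negbTE ij) /K /= cintZ; first by rewrite mulrCA.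
  exact: cintegrable_coord_fourier cf hC1.
have ft : coord_fourier t j (coord_fourier s i f) x = fourier_cst1 * (fourier_cst1 * cint mu (fun b => cint mu (fun a => K (a, b)))).
  rewrite {1}/coord_fourier; congr (_ * _); rewrite -cintZ; last by have [] := cint_fubini2 iK.
  apply: eq_cint => b; rewrite /coord_fourier setcE (negbTE ij) /K /= mulrCA -cintZ; last exact: cintegrable_coord_fourier cf hC1.
  congr (_ * _); apply: eq_cint => a; rewrite mulrCA; congr (_ * (_ * f _)).
  by rewrite (setcC _ _ _ ij).
rewrite fs ft; have [_ <-] := cint_fubini1 iK; have [_ <-] := cint_fubini2 iK; by [].
Qed.

Definition multi_fourier (s : R) n (l : seq 'I_n) (f : 'rV[R]_n -> R[i]) : 'rV[R]_n -> R[i] :=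
  foldr (@coord_fourier R s n) f l.

Lemma SF_multi_fourier I n s (l : seq 'I_n) (phi : nat -> 'rV[R]_n -> R[i]) : seq_ideal I -> s ^+ 2 = 1 ->
  SF I phi -> SF I (fun k => multi_fourier s l (phi k)).
Proof. by move=> idI s1 sphi; elim: l => //= j l ih; exact: (SF_coord_fourier idI s1 j ih). Qed.

Lemma coord_fourier_multi_fourier n s t (j : 'I_n) l (f : 'rV[R]_n -> R[i]) : s ^+ 2 = 1 -> t ^+ 2 = 1 ->
  j \notin l -> S f -> multi_fourier t l (coord_fourier s j f) = coord_fourier s j (multi_fourier t l f).
Proof.
move=> s1 t1; elim: l => //= i l ih; rewrite in_cons negb_or => /andP[ji jl] sf.
rewrite (ih jl sf); apply: coord_fourierC; first by rewrite eq_sym.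
exact: (SF_multi_fourier l (@all_seq_ideal R) t1 sf).
Qed.

(** As the coordinates are distinct, the transform in [j] moves outward past those in [l] and meets
    its own inverse. *)
Lemma multi_fourier_inversion n s (l : seq 'I_n) (f : 'rV[R]_n -> R[i]) : s ^+ 2 = 1 -> uniq l -> S f ->
  multi_fourier s l (multi_fourier (- s) l f) = f.
Proof.
move=> s1; elim: l => //= j l ih /andP[jl ul] sf.
have s1' : (- s) ^+ 2 = 1 by rewrite sqrrN.
have sF := SF_multi_fourier l (@all_seq_ideal R) s1' sf.
by rewrite (coord_fourier_multi_fourier s1' s1 jl sF) (ih ul sf) (coord_fourier_inversion _ s1 sf).
Qed.

Lemma multi_fourier_cat n s (l1 l2 : seq 'I_n) (f : 'rV[R]_n -> R[i]) :
  multi_fourier s (l1 ++ l2) f = multi_fourier s l1 (multi_fourier s l2 f).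
Proof. exact: foldr_cat. Qed.

(** Coordinates outside the image of [e] are frozen parameters. The uses are a frozen leading
    coordinate, in the induction on the dimension, and a frozen time, for [sfourier]. *)
Lemma multi_fourier_embedding m n s (E : 'rV[R]_m -> 'rV[R]_n) (e : 'I_m -> 'I_n) (l : seq 'I_m)
    (f : 'rV[R]_n -> R[i]) :
  (forall x j, E x ord0 (e j) = x ord0 j) ->
  (forall x j t, E (setc x j t) = setc (E x) (e j) t) ->
  multi_fourier s l (fun x => f (E x)) = fun x => multi_fourier s (map e l) f (E x).
Proof.
move=> E1 E2; elim: l => //= j l ->; apply/funext => x.
by rewrite /coord_fourier E1; congr (_ * _); apply: eq_cint => t; rewrite E2.
Qed.

End fourier_schwartz.

Section fourier_iterated.
Context {R : realType}.
Local Notation S f := (SF (@all_seq R) (fun=> f)).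

Lemma S_CFD n (f : 'rV[R]_n -> R[i]) : S f -> CFD f.
Proof.
move=> sf; split; first by have [] := S_decay1 sf.
by move=> N; exact: S_decay.
Qed.

Lemma CFD_cintegrable n (f : 'rV[R]_n -> R[i]) : CFD f -> cintegrable (leb n) f.
Proof.
move=> [cf df]; have [C hC] := df n.
apply: (cintegrable_le (rintegrableZ C (@rintegrable_weight R n))); first exact: ccontinuous_cmeas.
by move=> x; rewrite ler_pdivlMr ?exprn_gt0 ?weight_gt0// mulrC.
Qed.

Lemma CFD_mul_unimodular n (f m : 'rV[R]_n -> R[i]) : ccontinuous m ->
  (forall x, Normc.normc (m x) = 1) -> CFD f -> CFD (fun x => m x * f x).
Proof.
move=> cm m1 [cf df]; split; first exact: ccontM.
by move=> N; have [C hC] := df N; exists C => x; rewrite Normc.normcM m1 mul1r.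
Qed.

Lemma CFD_comp m n (E : 'rV[R]_m -> 'rV[R]_n) (f : 'rV[R]_n -> R[i]) : continuous E ->
  (forall x, weight x <= weight (E x)) -> CFD f -> CFD (fun x => f (E x)).
Proof.
move=> cE wE [cf df]; split; first by move=> x; exact: (cvg_comp _ _ (cE x) (cf _)).
move=> N; have [C hC] := df N; exists C => x; apply: le_trans (hC (E x)).
by rewrite ler_wpM2r ?normc_ge0// lerXn2r// nnegrE ltW// weight_gt0.
Qed.

Lemma continuous_dotv_r n (xi : 'rV[R]_n) : continuous (fun x => dotv xi x).
Proof.
rewrite /dotv; elim: (index_enum _) => [|j s ih].
  by under eq_fun do rewrite big_nil; exact: cst_continuous.
under eq_fun do rewrite big_cons; apply: contD => //.
by apply: contM; [exact: cst_continuous|exact: coord_continuous].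
Qed.

Lemma CFD_character n (s : R) (xi : 'rV[R]_n) (f : 'rV[R]_n -> R[i]) : CFD f ->
  CFD (fun x => cexpi (s * dotv xi x) * f x).
Proof.
apply: CFD_mul_unimodular => [|x]; last exact: normc_cexpi.
apply: ccontinuous_cexpi => x; apply: (@cvgM _ _ (nbhs x)); first exact: cvg_cst.
exact: continuous_dotv_r.
Qed.

Lemma cons_rV_surj m (x : 'rV[R]_m.+1) : exists t (y : 'rV[R]_m), x = cons_rV (t, y).
Proof.
exists (x ord0 ord0), (\row_j x ord0 (lift ord0 j)); apply: row_ext => k.
by case: (unliftP ord0 k) => [j|] ->; rewrite ?cons_rV0 ?cons_rVS ?mxE.
Qed.

Lemma setc_cons m (t r : R) (x : 'rV[R]_m) j :
  cons_rV (t, setc x j r) = setc (cons_rV (t, x)) (lift ord0 j) r.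
Proof.
apply: row_ext => k; rewrite setcE; case: (unliftP ord0 k) => [i|] ->.
  by rewrite !cons_rVS setcE (inj_eq lift_inj).
by rewrite !cons_rV0.
Qed.

Lemma setc_cons0 m (t r : R) (x : 'rV[R]_m) : setc (cons_rV (t, x)) ord0 r = cons_rV (r, x).
Proof.
apply: row_ext => k; rewrite setcE; case: (unliftP ord0 k) => [i|] ->; last by rewrite eqxx cons_rV0.
by rewrite !cons_rVS.
Qed.

Lemma dotv_cons m (t r : R) (x y : 'rV[R]_m) :
  dotv (cons_rV (t, x)) (cons_rV (r, y)) = t * r + dotv x y.
Proof.
rewrite /dotv big_ord_recl !cons_rV0; congr (_ + _).
by apply: eq_bigr => i _; rewrite !cons_rVS.
Qed.

Lemma continuous_cons_rV m (t : R) : continuous (fun x : 'rV[R]_m => cons_rV (t, x)).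
Proof.
apply: continuous_rV => k; case: (unliftP ord0 k) => [i|] ->.
  by under eq_fun do rewrite cons_rVS; exact: coord_continuous.
by under eq_fun do rewrite cons_rV0; exact: cst_continuous.
Qed.

Lemma fourier_cstS m : fourier_cst m.+1 = fourier_cst1 * fourier_cst m :> R[i].
Proof. by rewrite /fourier_cst /fourier_cst1 -rmorphM exprS invfM. Qed.

Lemma cintegrable_leb_cons m (f : 'rV[R]_m.+1 -> R[i]) : cintegrable (leb m.+1) f ->
  cintegrable (lebesgue_measure \x leb m)%E (fun p => f (cons_rV p)).
Proof.
move=> fi; have mf := cintegrable_cmeas fi.
by case: fi => fR fI; split; [exact: (rintegrable_leb_cons mf.1).1|exact: (rintegrable_leb_cons mf.2).1].
Qed.

(** The leading coordinate is split off exactly as in the recursive definition of Lebesgue measure;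
    the character factors accordingly. *)
Lemma fourier_iterated s n (f : 'rV[R]_n -> R[i]) (xi : 'rV[R]_n) : CFD f ->
  fourier_cst n * cint (@lebesgue_rV R n) (fun x => cexpi (s * dotv xi x) * f x) =
  multi_fourier s (enum 'I_n) f xi.
Proof.
elim: n f xi => [|m ih] f xi cf.
  rewrite (size0nil (size_enum_ord 0)) /= /fourier_cst expr0 invr1 mul1r.
  have -> : (fun x : 'rV[R]_0 => cexpi (s * dotv xi x) * f x) = fun=> f xi.
    apply/funext => x; rewrite /dotv big_ord0 mulr0 cexpi0 mul1r; congr f.
    by apply: row_ext => -[].
  have aux (r : R) : rint (dirac (0 : 'rV[R]_0) : set 'rV[R]_0 -> \bar R) (fun=> r) = r.
    rewrite /rint (_ : integral _ _ _ = r%:E)//.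
    by rewrite integral_cst//= diracT mule1.
  by apply: complexP; exact: aux.
have cf' := CFD_character s xi cf.
rewrite cint_leb cint_leb_cons; last exact: CFD_cintegrable.
have [t0 [y0 ->]] := cons_rV_surj xi.
rewrite enum_ordSl /= fourier_cstS -mulrA; congr (_ * _).
rewrite cons_rV0.
have slice t : CFD (fun x => f (cons_rV (t, x))).
  apply: CFD_comp cf; first exact: continuous_cons_rV.
  by move=> x; rewrite weight_cons lerDr sqr_ge0.
have inner t : cint (leb m) (fun x => cexpi (s * dotv (cons_rV (t0, y0)) (cons_rV (t, x))) * f (cons_rV (t, x))) =
    cexpi (s * (t0 * t)) * cint (leb m) (fun x => cexpi (s * dotv y0 x) * f (cons_rV (t, x))).
  rewrite -cintZ; last exact/CFD_cintegrable/CFD_character.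
  by apply: eq_cint => x; rewrite dotv_cons mulrDr cexpiD -mulrA.
rewrite -cintZ; last first.
  have [+ _] := cint_fubini1 (cintegrable_leb_cons (CFD_cintegrable (CFD_character s (cons_rV (t0, y0)) cf))).
  exact.
apply: eq_cint => t; rewrite inner mulrCA; congr (_ * _).
rewrite -cint_leb (ih _ y0 (slice t)) setc_cons0.
by rewrite (multi_fourier_embedding _ _ _ (e := lift ord0)) // => [x j|x j r]; rewrite ?cons_rVS// setc_cons.
Qed.

Lemma fourier_multi_fourier n (f : 'rV[R]_n -> R[i]) : CFD f -> fourier f = multi_fourier (-1) (enum 'I_n) f.
Proof.
move=> cf; apply/funext => xi; rewrite -fourier_iterated// /fourier.
by congr (_ * cint _ _); apply/funext => x; rewrite mulN1r.
Qed.

Lemma dotvC n (x y : 'rV[R]_n) : dotv x y = dotv y x.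
Proof. by apply: eq_bigr => i _; rewrite mulrC. Qed.

Lemma ifourier_multi_fourier n (f : 'rV[R]_n -> R[i]) : CFD f -> ifourier f = multi_fourier 1 (enum 'I_n) f.
Proof.
move=> cf; apply/funext => xi; rewrite -fourier_iterated// /ifourier.
by congr (_ * cint _ _); apply/funext => x; rewrite mul1r dotvC.
Qed.

Lemma continuous_row_mx_l m n (y : 'rV[R]_n) : continuous (fun x : 'rV[R]_m => row_mx x y).
Proof.
apply: continuous_rV => k; case: (split_ordP k) => j ->.
  by under eq_fun do rewrite row_mxEl; exact: coord_continuous.
by under eq_fun do rewrite row_mxEr; exact: cst_continuous.
Qed.

Lemma dotv_row_mx m n (x x' : 'rV[R]_m) (y y' : 'rV[R]_n) :
  dotv (row_mx x y) (row_mx x' y') = dotv x x' + dotv y y'.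
Proof.
rewrite /dotv big_split_ord /=; congr (_ + _); apply: eq_bigr => i _.
  by rewrite !row_mxEl.
by rewrite !row_mxEr.
Qed.

Lemma weight_row_mx m n (x : 'rV[R]_m) (y : 'rV[R]_n) :
  weight (row_mx x y) = weight x + dotv y y.
Proof. by rewrite /weight dotv_row_mx addrA. Qed.

Lemma CFD_row_mx_l m n (y : 'rV[R]_n) (f : 'rV[R]_(m + n) -> R[i]) : CFD f ->
  CFD (fun x : 'rV[R]_m => f (row_mx x y)).
Proof.
apply: CFD_comp => [|x]; first exact: continuous_row_mx_l.
by rewrite weight_row_mx lerDl dotv_ge0.
Qed.

Definition space_coords d : seq 'I_(d + 1) := map (lshift 1) (enum 'I_d).

Lemma sfourier_multi_fourier d (f : 'rV[R]_(d + 1) -> R[i]) : CFD f -> sfourier f = multi_fourier (-1) (space_coords d) f.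
Proof.
move=> cf; apply/funext => z.
have h := fourier_iterated (-1) (lsubmx z) (CFD_row_mx_l (rsubmx z) cf).
rewrite (multi_fourier_embedding _ _ _ (e := lshift 1)) in h.
- rewrite hsubmxK in h; rewrite -h /sfourier.
  by congr (_ * cint _ _); apply/funext => x; rewrite mulN1r.
- by move=> x j; rewrite row_mxEl.
- move=> x j t; apply: row_ext => k; rewrite setcE; case: (split_ordP k) => i ->.
    by rewrite !row_mxEl setcE (inj_eq (@lshift_inj _ _)).
  by rewrite !row_mxEr; case: eqP => // /eqP; rewrite eq_rlshift.
Qed.

Lemma SF_fourier I n (phi : nat -> 'rV[R]_n -> R[i]) : seq_ideal I -> SF I phi ->
  (forall k, S (phi k)) -> SF I (fun k => fourier (phi k)).
Proof.
move=> idI sphi ss; have := SF_multi_fourier (enum 'I_n) idI (_ : (-1) ^+ 2 = 1) sphi.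
rewrite sqrrN expr1n => /(_ erefl); congr SF; apply/funext => k.
by rewrite fourier_multi_fourier//; exact: S_CFD.
Qed.

Lemma SF_ifourier I n (phi : nat -> 'rV[R]_n -> R[i]) : seq_ideal I -> SF I phi ->
  (forall k, S (phi k)) -> SF I (fun k => ifourier (phi k)).
Proof.
move=> idI sphi ss; have := SF_multi_fourier (enum 'I_n) idI (expr1n _ 2) sphi.
congr SF; apply/funext => k.
by rewrite ifourier_multi_fourier//; exact: S_CFD.
Qed.

Lemma fourierK n (f : 'rV[R]_n -> R[i]) : S f -> ifourier (fourier f) = f.
Proof.
move=> sf; have sF := SF_fourier (@all_seq_ideal R) sf (fun=> sf).
rewrite (ifourier_multi_fourier (S_CFD sF)) (fourier_multi_fourier (S_CFD sf)).
by apply: multi_fourier_inversion => //; [exact: expr1n|exact: enum_uniq].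
Qed.

Lemma ifourierK n (f : 'rV[R]_n -> R[i]) : S f -> fourier (ifourier f) = f.
Proof.
move=> sf; have sF := SF_ifourier (@all_seq_ideal R) sf (fun=> sf).
rewrite (fourier_multi_fourier (S_CFD sF)) (ifourier_multi_fourier (S_CFD sf)).
have := @multi_fourier_inversion R n (-1) (enum 'I_n) f; rewrite opprK; apply => //.
  by rewrite sqrrN expr1n.
exact: enum_uniq.
Qed.

(** The space transforms cancel and the inverse transform in time remains. This is the only relation
    through which [F X] and [F_S X] are compared. *)
Lemma ifourier_sfourier d (f : 'rV[R]_(d + 1) -> R[i]) : S f ->
  ifourier (sfourier f) = coord_fourier 1 (rshift d ord0) f.
Proof.
move=> sf; have n1 : (-1 : R) ^+ 2 = 1 by rewrite sqrrN expr1n.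
have sF := SF_multi_fourier (space_coords d) (@all_seq_ideal R) n1 sf.
rewrite (sfourier_multi_fourier (S_CFD sf)) (ifourier_multi_fourier (S_CFD sF)).
have -> : enum 'I_(d + 1) = space_coords d ++ [:: rshift d ord0].
  apply: (inj_map val_inj); rewrite val_enum_ord map_cat -map_comp.
  rewrite (eq_map (g := val)) // val_enum_ord /= addn0 -[RHS]/(iota 0 d ++ iota (0 + d) 1).
  by rewrite -iotaD.
have jl : rshift d ord0 \notin space_coords d.
  by apply/mapP => -[i _ /eqP]; rewrite eq_rlshift.
rewrite multi_fourier_cat /= (coord_fourier_multi_fourier (expr1n _ 2) (expr1n _ 2) jl sF); congr coord_fourier.
apply: multi_fourier_inversion => //; first exact: expr1n.
by rewrite map_inj_uniq ?enum_uniq//; exact: lshift_inj.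
Qed.

End fourier_iterated.

(** * Schwartz functions determine slow-growing measures *)

Section flat_functions.
Context {R : realType}.
Implicit Types (P Q : {poly R}) (y t : R).

(** P(1/y) e^(-1/y) extended by 0. Letting [P] vary makes the family closed under derivation, so
    smoothness at 0 is proved once for all orders. *)
Definition flat P y : R := if 0 < y then P.[y^-1] * expR (- y^-1) else 0.

Lemma poly_exp_bounded P (a : R) : 0 < a ->
  exists2 C, 0 <= C & forall t, 0 <= t -> `|P.[t]| * expR (- (a * t)) <= C.
Proof.
elim/poly_ind: P a => [|P c ih] a a0.
  by exists 0 => // t _; rewrite horner0 normr0 mul0r.
have a20 : 0 < a / 2 by rewrite divr_gt0.
(* For the polynomial P X + c, half of the exponent controls [P] by induction and the other half
   absorbs the factor t. *)
have [C C0 hC] := ih _ a20; exists (2 / a * C + `|c|).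
  by rewrite addr_ge0// mulr_ge0// divr_ge0// ltW.
move=> t t0; rewrite !hornerE.
have e : expR (- (a * t)) = expR (- (a / 2 * t)) * expR (- (a / 2 * t)).
  by rewrite -expRD; congr expR; field.
apply: le_trans (_ : (`|P.[t]| * t + `|c|) * expR (- (a * t)) <= _).
  rewrite ler_wpM2r ?expR_ge0//; apply: le_trans (ler_normD _ _) _.
  by rewrite normrM (ger0_norm t0).
rewrite mulrDl lerD//; last first.
  by rewrite ler_piMr// expR_le1 oppr_le0 mulr_ge0// ltW.
have h : t * expR (- (a / 2 * t)) <= 2 / a.
  rewrite expRN ler_pdivrMr ?expR_gt0//.
  have := expR_ge1Dx (a / 2 * t); set E := expR _; move=> hE.
  have -> : t = 2 / a * (a / 2 * t) by field; rewrite gt_eqF.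
  by apply: ler_wpM2l; [rewrite divr_ge0// ltW|lra].
rewrite e; have -> : forall p q r : R, p * q * (r * r) = (q * r) * (p * r) by move=> *; ring.
by apply: ler_pM; [rewrite mulr_ge0// expR_ge0|rewrite mulr_ge0// expR_ge0|exact: h|exact: hC].
Qed.

Lemma flat_bounded P : exists C, forall y, `|flat P y| <= C.
Proof.
have [C C0 hC] := poly_exp_bounded P ltr01; exists C => y; rewrite /flat.
case: ifPn => [y0|_]; last by rewrite normr0.
have := hC y^-1; rewrite mul1r normrM (ger0_norm (expR_ge0 _)); apply.
by rewrite invr_ge0 ltW.
Qed.

(** The derivative of P(1/y) e^(-1/y) is y^-2 (P - P')(1/y) e^(-1/y). *)
Definition flat_deriv P : {poly R} := 'X^2 * (P - P^`()).

(** Since every member of the family is bounded, this makes each of them O(y^2), hence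
    differentiable at 0 with derivative 0. *)
Lemma flat_X2 P y : flat P y = y ^+ 2 * flat ('X^2 * P) y.
Proof.
rewrite /flat; case: ifPn => [y0|_]; last by rewrite mulr0.
rewrite hornerM hornerXn exprVn; move: P.[_] (expR _) => p e; field.
by rewrite gt_eqF.
Qed.

Lemma flat_small P : exists C, forall y, `|flat P y| <= C * y ^+ 2.
Proof.
have [C hC] := flat_bounded ('X^2 * P); exists C => y.
rewrite flat_X2 normrM (ger0_norm (sqr_ge0 _)) mulrC.
by rewrite ler_wpM2r ?sqr_ge0.
Qed.

Lemma flat0 P y : y <= 0 -> flat P y = 0.
Proof. by rewrite /flat ltNge => ->. Qed.

Lemma is_derive_flat P y : is_derive y (1 : R) (flat P) (flat (flat_deriv P) y).
Proof.
have [y0|y0|->] := ltgtP y 0.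
- apply: (@near_eq_is_derive _ _ _ (cst 0)).
  + have : nbhs y [set z | z < 0] by apply: open_nbhs_nbhs; split; [exact: open_lt|].
    by apply: filterS => z /= z0; rewrite flat0// ltW.
  + by rewrite flat0 ?ltW//; exact: is_derive_cst.
- have dV : is_derive y (1 : R) (fun s => s^-1) (- y ^- 2).
    have := @is_deriveV R id y 1 1 (lt0r_neq0 y0) (is_derive_id _ _).
    by rewrite /GRing.scale /= mulr1.
  have dN : is_derive y (1 : R) (fun s => - s^-1) (y ^- 2).
    by have := is_deriveN dV; rewrite opprK.
  have dP := @is_derive1_comp _ (horner P) (fun s => s^-1) y _ _ (is_derive_poly P y^-1) dV.
  have dE := @is_derive1_comp _ (@expR R) (fun s => - s^-1) y _ _ (is_derive_expR _) dN.
  have := is_deriveM dP dE.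
  rewrite {2}/flat y0 => d.
  apply: (@near_eq_is_derive _ _ _ ((horner P \o [eta GRing.inv]) * (expR \o (fun s : R => - s^-1)))).
    have : nbhs y [set z | 0 < z] by apply: open_nbhs_nbhs; split; [exact: open_gt|].
    by apply: filterS => z /= z0; rewrite /flat z0.
  move: d; congr is_derive; rewrite /flat_deriv hornerM hornerXn hornerD hornerN /GRing.scale /=.
  by rewrite exprVn; ring.
(* At 0 the difference quotient is at most C |h|. *)
- have [C hC] := flat_small P.
  have c : (h^-1 *: (flat P (h *: 1 + 0) - flat P 0)) @[h --> (0 : R)^'] --> (0 : R).
    apply/cvgrPdist_le => e e0.
    have C1 : 0 < e / (`|C| + 1) by rewrite divr_gt0// ltr_wpDl.
    apply: filterS2 (dnbhs0_le C1) (nbhs_dnbhs_neq (0 : R)) => h hl h0.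
    rewrite sub0r normrN (flat0 _ (lexx 0)) subr0 addr0 /GRing.scale /= mulr1 normrM normfV.
    rewrite ler_pdivrMl ?normr_gt0//; apply: le_trans (hC h) _.
    rewrite -real_normK ?num_real// mulrC expr2 -mulrA ler_wpM2l//.
    rewrite ler_pdivlMr in hl; last by rewrite ltr_wpDl.
    by apply: le_trans hl; rewrite ler_wpM2l// (le_trans (ler_norm C))// lerDl.
  rewrite flat0//; apply: DeriveDef; first exact: (cvgP _ c).
  exact: (cvg_lim _ c).
Qed.

End flat_functions.

Section bumps.
Context {R : realType}.

(** Smooth functions supported in [a, b], in a form closed under derivation: the product rule yields
    sums of such products. The scale [c] steepens the flanks. *)
Inductive flat_itv (c a b : R) : (R -> R) -> Prop :=
| flat_itv1 (P Q : {poly R}) : flat_itv c a b (fun y => flat P (c * (y - a)) * flat Q (c * (b - y)))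
| flat_itvD h1 h2 : flat_itv c a b h1 -> flat_itv c a b h2 ->
    flat_itv c a b (fun y => h1 y + h2 y).

Lemma flatZ (r : R) P y : flat (r *: P) y = r * flat P y.
Proof. by rewrite /flat; case: ifP => _; rewrite ?mulr0// hornerZ mulrA. Qed.

Lemma flat_itv_deriv c a b h : flat_itv c a b h ->
  exists2 h', flat_itv c a b h' & forall y, is_derive y (1 : R) h (h' y).
Proof.
elim=> {h} [P Q|h1 h2 _ [k1 f1 d1] _ [k2 f2 d2]]; last first.
  by exists (fun y => k1 y + k2 y) => [|y]; [exact: flat_itvD|exact: is_deriveD].
exists (fun y => flat (c *: flat_deriv P) (c * (y - a)) * flat Q (c * (b - y)) +
    flat P (c * (y - a)) * flat (- c *: flat_deriv Q) (c * (b - y))).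
  by apply: flat_itvD; exact: flat_itv1.
move=> y.
have dl : is_derive y (1 : R) (fun s : R => c * (s - a)) c.
  have := is_deriveM (is_derive_cst c y (1 : R)) (is_deriveB (is_derive_id y (1 : R)) (is_derive_cst a y (1 : R))).
  by rewrite subr0 /GRing.scale /= mulr0 addr0 mulr1.
have dr : is_derive y (1 : R) (fun s : R => c * (b - s)) (- c).
  have := is_deriveM (is_derive_cst c y (1 : R)) (is_deriveB (is_derive_cst b y (1 : R)) (is_derive_id y (1 : R))).
  by rewrite sub0r /GRing.scale /= mulr0 addr0 mulrN1.
have d1 := @is_derive1_comp _ (flat P) (fun s => c * (s - a)) y _ _ (is_derive_flat P _) dl.
have d2 := @is_derive1_comp _ (flat Q) (fun s => c * (b - s)) y _ _ (is_derive_flat Q _) dr.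
have := is_deriveM d1 d2; congr is_derive.
by rewrite /GRing.scale /= !flatZ; ring.
Qed.

Lemma flat_itv_bounded c a b h : flat_itv c a b h -> exists2 C, 0 <= C & forall y, `|h y| <= C.
Proof.
elim=> {h} [P Q|h1 h2 _ [C1 p1 b1] _ [C2 p2 b2]]; last first.
  exists (C1 + C2); first exact: addr_ge0.
  by move=> y; apply: le_trans (ler_normD _ _) _; exact: lerD.
have [C hC] := flat_bounded P; have [D hD] := flat_bounded Q.
have C0 := le_trans (normr_ge0 _) (hC 0); have D0 := le_trans (normr_ge0 _) (hD 0).
exists (C * D); first exact: mulr_ge0.
by move=> y; rewrite normrM ler_pM.
Qed.

Lemma flat_itv_support c a b h y : 0 < c -> flat_itv c a b h -> ~~ (a < y < b) -> h y = 0.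
Proof.
move=> c0 fh; rewrite negb_and -!leNgt => hy.
elim: fh => {h} [P Q|h1 h2 _ -> _ ->]; last by rewrite addr0.
case/orP: hy => hy; first by rewrite flat0 ?mul0r// pmulr_rle0// subr_le0.
by rewrite [X in _ * X]flat0 ?mulr0// pmulr_rle0// subr_le0.
Qed.

Lemma flat_itv_continuous c a b h : flat_itv c a b h -> continuous h.
Proof.
move=> /flat_itv_deriv[h' _ dh] y; apply: differentiable_continuous.
by apply/derivable1_diffP; have [] := dh y.
Qed.

Section product.
Context {n : nat} (c : R) (c0 : 0 < c) (a b : 'rV[R]_n).

(** Different coordinates may carry different functions, since a partial derivative alters only one
    factor. *)
Definition box_product (phi : nat -> 'rV[R]_n -> R[i]) :=
  exists2 h : 'I_n -> R -> R, (forall j, flat_itv c (a ord0 j) (b ord0 j) (h j)) &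
    phi = fun _ x => (\prod_j h j (x ord0 j))%:C.

Lemma box_product_schwartz_class : schwartz_class (@all_seq R) box_product.
Proof.
move=> _ [h fh ->]; split.
- move=> _; apply/ccontinuousP; split => /=; last exact: cst_continuous.
  elim: (index_enum _) => [|j s ih].
    by under eq_fun do rewrite big_nil; exact: cst_continuous.
  under eq_fun do rewrite big_cons; apply: contM => //.
  move=> x; apply: (cvg_comp _ _ (@coord_continuous R 1 n ord0 j x)).
  exact: (flat_itv_continuous (fh j)).
- move=> N.
  have [C hC] : exists C : 'I_n -> R, forall j y, `|h j y| <= C j.
    have /choice[C hC] : forall j, exists C, forall y, `|h j y| <= C.
      by move=> j; have [C _ hC] := flat_itv_bounded (fh j); exists C.
    by exists C.
  have [_ [M hM]] := bounded_borel_box a b.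
  exists (fun=> (1 + `|M|) ^+ N * \prod_j C j) => // _ x.
  rewrite normc_real normr_prod.
  have P0 : 0 <= \prod_j `|h j (x ord0 j)| by apply: prodr_ge0.
  have P1 : \prod_j `|h j (x ord0 j)| <= \prod_j C j.
    by apply: ler_prod => j _; rewrite normr_ge0 hC.
  have [xab|/existsNP[j hj]] := pselect (box a b x).
    apply: ler_pM => //; first by rewrite exprn_ge0// ltW// weight_gt0.
    rewrite lerXn2r ?nnegrE//; first exact/ltW/weight_gt0.
    by rewrite /weight lerD2l (le_trans (hM x xab))// ler_norm.
  rewrite (bigD1 j)//= (flat_itv_support c0 (fh j)); last exact/negP.
  rewrite normr0 mul0r mulr0; apply: mulr_ge0; last exact: le_trans P1.
  by apply: exprn_ge0; apply: addr_ge0.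
- move=> i; have [h' fh' dh] := flat_itv_deriv (fh i).
  exists (fun _ x => (\prod_j (if j == i then h' else h j) (x ord0 j))%:C).
    exists (fun j => if j == i then h' else h j) => // j.
    by case: eqP => // ->.
  move=> _ x; apply: pd_of_setc; apply: cis_derive_real.
  rewrite (bigD1 i)//= eqxx.
  set S := \prod_(j < n | j != i) h j (x ord0 j).
  have -> : (fun s => \prod_j h j (setc x i s ord0 j)) = (fun s => S * h i s).
    apply/funext => s; rewrite (bigD1 i)//= setcE eqxx mulrC; congr (_ * _).
    by apply: eq_bigr => j /negbTE ji; rewrite setcE ji.
  have := is_deriveM (is_derive_cst S (x ord0 i) (1 : R)) (dh (x ord0 i)).
  congr is_derive; rewrite /GRing.scale /= mulr0 addr0 mulrC; congr (_ * _).
  by apply: eq_bigr => j /negbTE ji; rewrite ji.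
Qed.

End product.

(** Each factor is e^(-1/((k+1) w)) with w the distance to a face, so as k grows the bumps tend
    pointwise to the indicator of the open box, which also dominates them. *)
Definition bump n (a b : 'rV[R]_n) (k : nat) : 'rV[R]_n -> R[i] := fun x =>
  (\prod_j (flat 1 (k.+1%:R * (x ord0 j - a ord0 j)) * flat 1 (k.+1%:R * (b ord0 j - x ord0 j))))%:C.

Lemma S_bump n (a b : 'rV[R]_n) k : SF (@all_seq R) (fun=> bump a b k).
Proof.
apply: (SF_class (@box_product_schwartz_class n k.+1%:R (ltr0Sn _ _) a b)).
by exists (fun j y => flat 1 (k.+1%:R * (y - a ord0 j)) * flat 1 (k.+1%:R * (b ord0 j - y))) => // j;
  exact: flat_itv1.
Qed.

Lemma flat1_01 (y : R) : 0 <= flat 1 y <= 1.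
Proof.
rewrite /flat; case: ifPn => [y0|_]; last by rewrite lexx ler01.
by rewrite hornerC mul1r expR_ge0 /= expR_le1 oppr_le0 invr_ge0 ltW.
Qed.

Lemma normc_bump n (a b : 'rV[R]_n) k x :
  Normc.normc (bump a b k x) <= if x \in box a b then 1 else 0.
Proof.
rewrite normc_real normr_prod; case: ifPn => [_|].
  apply: prodr_ile1 => j _; rewrite normr_ge0 normrM.
  have /andP[p1 q1] := flat1_01 (k.+1%:R * (x ord0 j - a ord0 j)).
  have /andP[p2 q2] := flat1_01 (k.+1%:R * (b ord0 j - x ord0 j)).
  by rewrite !ger0_norm// mulr_ile1.
rewrite notin_setE => /existsNP[j /negP hj].
rewrite (bigD1 j)//= (flat_itv_support _ (flat_itv1 k.+1%:R (a ord0 j) (b ord0 j) 1 1) hj)//.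
by rewrite normr0 mul0r.
Qed.

Lemma cvg_flat1 (w : R) : 0 < w -> flat 1 (k.+1%:R * w) @[k --> \oo] --> (1 : R).
Proof.
move=> w0.
have -> : (fun k => flat 1 (k.+1%:R * w)) = (fun k => expR (- (w^-1 * k.+1%:R^-1))).
  by apply/funext => k; rewrite /flat mulr_gt0// hornerC mul1r invfM mulrC.
have lim0 : (- (w^-1 * k.+1%:R^-1)) @[k --> \oo] --> (0 : R).
  rewrite -[X in _ --> X]oppr0; apply: cvgN; rewrite -[X in _ --> X](mulr0 w^-1).
  by apply: cvgM; [exact: cvg_cst|exact: cvg_harmonic].
by have := cvg_comp _ _ lim0 (@continuous_expR R 0); rewrite expR0.
Qed.

Lemma cvg_bump n (a b x : 'rV[R]_n) :
  (bump a b k x : R[i]^o) @[k --> \oo] --> ((if x \in box a b then 1 else 0) : R[i]^o).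
Proof.
case: ifPn => [|xab]; last first.
  have -> : (fun k => bump a b k x) = (fun=> 0); last exact: cvg_cst.
  apply/funext => k; apply: Normc.eq0_normc; apply/eqP; rewrite eq_le normc_ge0 andbT.
  by have := normc_bump a b k x; rewrite (negbTE xab).
rewrite inE => xab; apply/ccvgP; split => /=; last exact: cvg_cst.
have aux (f g : nat -> R) : f k @[k --> \oo] --> (1 : R) -> g k @[k --> \oo] --> (1 : R) ->
    (f k * g k) @[k --> \oo] --> (1 : R).
  by move=> hf hg; rewrite -[X in _ --> X]mulr1; exact: cvgM.
elim: (index_enum _) => [|j s ih].
  by under eq_fun do rewrite big_nil; exact: cvg_cst.
under eq_fun do rewrite big_cons; apply: (aux) => //.
have /andP[aj bj] := xab j.
by apply: (aux); apply: cvg_flat1; rewrite subr_gt0.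
Qed.

End bumps.

Section measure_uniqueness.
Context {R : realType} {n : nat}.
Implicit Types (mu nu : set 'rV[R]_n -> R[i]).

(** m1 = m2 is equivalent to m1^+ + m2^- = m2^+ + m1^-, an equality of positive measures, which
    boxes determine. *)
Lemma real_radon_unique (m1 m2 : set 'rV[R]_n -> R) : real_radon m1 -> real_radon m2 ->
  (forall a b, m1 (box a b) = m2 (box a b)) ->
  forall A, bounded_borel A -> m1 A = m2 A.
Proof.
move=> r1 r2 m12 A bA.
have [P1 [P1E P1fin]] := pos_variation_measure r1.
have [N1 [N1E N1fin]] := pos_variation_measure (real_radonN r1).
have [P2 [P2E P2fin]] := pos_variation_measure r2.
have [N2 [N2E N2fin]] := pos_variation_measure (real_radonN r2).
have dec1 B : bounded_borel B -> N1 B = (P1 B - (m1 B)%:E)%E.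
  by move=> bB; rewrite -N1E ?(pos_variation_decomp r1 bB) ?P1E//; exact: bB.1.
have dec2 B : bounded_borel B -> N2 B = (P2 B - (m2 B)%:E)%E.
  by move=> bB; rewrite -N2E ?(pos_variation_decomp r2 bB) ?P2E//; exact: bB.1.
have bal B : bounded_borel B -> m1 B = m2 B <-> measure_add P1 N2 B = measure_add P2 N1 B.
  move=> bB; rewrite !measure_addE dec1// dec2//.
  have := P1fin _ bB; have := P2fin _ bB.
  have : (0 <= P1 B)%E by []. have : (0 <= P2 B)%E by [].
  case: (P1 B) => [p1| |]//; case: (P2 B) => [p2| |]// _ _ _ _.
  rewrite -!EFinN -!EFinD; split=> [-> |[]]; last by lra.
  by congr EFin; ring.
apply/(bal A bA); apply: measure_rV_unique => [a b|k|]; last exact: bA.1.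
  by apply/bal; [exact: bounded_borel_box|exact: m12].
rewrite -[X in (X < _)%E]/(measure_add P1 N2 (cube k)) measure_addE lte_add_pinfty//.
  by apply: P1fin; exact: bounded_borel_cube.
by apply: N2fin; exact: bounded_borel_cube.
Qed.

Lemma complex_radon_unique mu nu : complex_radon mu -> complex_radon nu ->
  (forall a b, mu (box a b) = nu (box a b)) ->
  forall A, bounded_borel A -> mu A = nu A.
Proof.
have parts mu' : complex_radon mu' -> real_radon (fun A => complex.Re (mu' A)) /\
    real_radon (fun A => complex.Im (mu' A)).
  move=> rmu; split=> F mF tF bF; have /ccvgP[hR hI] := rmu F mF tF bF.
    by move: hR; under eq_fun do rewrite Re_sum.
  by move: hI; under eq_fun do rewrite Im_sum.
move=> /parts[r1 i1] /parts[r2 i2] e A bA; apply: complexP.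
  by apply: (real_radon_unique r1 r2) => // a b; rewrite e.
by apply: (real_radon_unique i1 i2) => // a b; rewrite e.
Qed.

(** Dominated convergence on a presentation, the bumps being bounded by the indicator of the box. *)
Lemma slow_growing_box mu a b : slow_growing mu ->
  (mint mu (bump a b k) : R[i]^o) @[k --> \oo] --> (mu (box a b) : R[i]^o).
Proof.
move=> sg; have [P [N pmu]] := slow_growing_presentation sg.
have [mpi mu_ iu muE] := pmu.
have bb := bounded_borel_box a b.
pose w (y : ('rV[R]_n * bool * bool)%type) : R := if y.1.1 \in box a b then Normc.normc (jordan_weight y : R[i]) else 0.
have iw : rintegrable P w.
  apply: (rintegrable_restrict mpi bb (measurable_normc mu_) iu) => y.
  by rewrite ger0_norm ?normc_ge0.
have bw k y : Normc.normc (bump a b k y.1.1) * Normc.normc (jordan_weight y : R[i]) <= w y.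
  have := normc_bump a b k y.1.1; rewrite /w; case: ifP => _ h.
    by rewrite ler_piMl ?normc_ge0.
  have -> : Normc.normc (bump a b k y.1.1) = 0 by apply/eqP; rewrite eq_le h normc_ge0.
  by rewrite mul0r.
have mb k : cmeas (bump a b k) by apply: ccontinuous_cmeas; have [] := S_decay1 (S_bump a b k).
have e k : mint mu (bump a b k) = cint P (fun y => bump a b k y.1.1 * jordan_weight y).
  apply: (presentation_mint pmu) => //; apply: (rintegrable_le iw).
    apply: measurable_funM; last exact: measurable_normc.
    exact: (measurableT_comp (measurable_normc (mb k)) mpi).
  by move=> y; rewrite ger0_norm ?mulr_ge0 ?normc_ge0.
apply: (ccvg_ext (fun k => esym (e k))).
rewrite muE//.
apply: (@cint_cvg _ _ _ P _ \oo _ _ w _ countably_based_oo).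
- by move=> k; apply: cmeasM => //; exact: cmeas_comp.
- have mB : measurable ((fun y : ('rV[R]_n * bool * bool)%type => y.1.1) @^-1` box a b).
    by rewrite -[X in measurable X]setTI; apply: mpi => //; exact: bb.1.
  exact: (cmeas_if mB mu_).
- exact: iw.
- by apply: nearW => k y; rewrite Normc.normcM.
- move=> y; have := cvg_bump (a := a) (b := b) (x := y.1.1); case: ifP => _ h.
    rewrite -[X in _ --> X](mul1r (jordan_weight y : R[i]^o)).
    exact: (@cvgM _ _ \oo _ _ (cst (jordan_weight y : R[i]^o)) _ _ h (cvg_cst _)).
  rewrite -[X in _ --> X](mul0r (jordan_weight y : R[i]^o)).
  exact: (@cvgM _ _ \oo _ _ (cst (jordan_weight y : R[i]^o)) _ _ h (cvg_cst _)).
Qed.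

Lemma slow_growing_unique mu nu : slow_growing mu -> slow_growing nu ->
  (forall phi, schwartz phi -> mint mu phi = mint nu phi) ->
  forall A, bounded_borel A -> mu A = nu A.
Proof.
move=> smu snu e; apply: complex_radon_unique; [exact: smu.1|exact: snu.1|move=> a b].
have h1 := slow_growing_box (a := a) (b := b) smu; have h2 := slow_growing_box (a := a) (b := b) snu.
apply: (@cvg_unique (R[i]^o) (@norm_hausdorff _ (R[i]^o)) _ _ _ _ h1).
apply: (ccvg_ext _ h2) => k; rewrite e//.
exact: (@SF_schwartz _ _ _ _ 0%N (S_bump a b k)).
Qed.

End measure_uniqueness.

(** * Distributions whose Fourier transform is a presented measure *)

Section measures_and_distributions.
Context {R : realType}.
Local Notation S f := (SF (@all_seq R) (fun=> f)).

Lemma S_schwartz n (f : 'rV[R]_n -> R[i]) : S f -> schwartz f.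
Proof. by move=> sf; have := @SF_schwartz R _ n _ 0%N sf. Qed.

Section integration_against_presented_measure.
Context {n : nat} d (Y : measurableType d) (P : {measure set Y -> \bar R})
  (pi : Y -> 'rV[R]_n) (u : Y -> R[i]) (N : nat) (mu : set 'rV[R]_n -> R[i]).
Hypothesis pmu : presentation P pi u N mu.

Lemma presentation_decay (f : 'rV[R]_n -> R[i]) C : cmeas f ->
  (forall x, weight x ^+ N * Normc.normc (f x) <= C) ->
  [/\ cintegrable P (fun y => f (pi y) * u y), mint mu f = cint P (fun y => f (pi y) * u y) &
      Normc.normc (mint mu f) <=
        2 * (C * rint P (fun y => Normc.normc (u y) * weight (pi y) ^- N))].
Proof.
move=> mf hC; have [mpi mu_ iu _] := pmu.
have b y : Normc.normc (f (pi y)) * Normc.normc (u y) <= C * (Normc.normc (u y) * weight (pi y) ^- N).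
  rewrite [X in _ <= X]mulrCA [X in X <= _]mulrC ler_wpM2l ?normc_ge0//.
  by rewrite ler_pdivlMr ?exprn_gt0 ?weight_gt0// mulrC.
have mfu : cmeas (fun y => f (pi y) * u y) by apply: cmeasM => //; exact: cmeas_comp.
have e : mint mu f = cint P (fun y => f (pi y) * u y).
  apply: (presentation_mint pmu) => //; apply: (rintegrable_le (rintegrableZ C iu)).
    apply: measurable_funM; last exact: measurable_normc.
    exact: (measurable_normc (cmeas_comp mpi mf)).
  by move=> y; rewrite ger0_norm ?mulr_ge0 ?normc_ge0.
have b' y : Normc.normc (f (pi y) * u y) <= C * (Normc.normc (u y) * weight (pi y) ^- N).
  by rewrite Normc.normcM.
split=> //; first exact: (cintegrable_le (rintegrableZ C iu)).
rewrite e; apply: le_trans (normc_cint_le (rintegrableZ C iu) mfu b') _.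
by rewrite rintZ.
Qed.

Lemma presentation_CFD (f : 'rV[R]_n -> R[i]) : CFD f ->
  cintegrable P (fun y => f (pi y) * u y) /\ mint mu f = cint P (fun y => f (pi y) * u y).
Proof.
move=> [cf df]; have [C hC] := df N.
by have [] := presentation_decay (ccontinuous_cmeas cf) hC.
Qed.

(** The measures chosen by [xget] are determined only on bounded Borel sets; that is all a
    presentation looks at. *)
Lemma presentation_transfer mu' : (forall A, bounded_borel A -> mu' A = mu A) ->
  presentation P pi u N mu'.
Proof. by move=> e; have [? ? ? h] := pmu; split=> // A bA; rewrite e// h. Qed.

(** Multiplication acts on the density alone; growth of order [M] is paid for by [M] further inverse
    powers of the weight. *)
Lemma presentation_mul (a : 'rV[R]_n -> R[i]) C M : cmeas a ->
  (forall x, Normc.normc (a x) <= C * weight x ^+ M) ->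
  presentation P pi (fun y => a (pi y) * u y) (N + M) (mul_measure a mu).
Proof.
move=> ma hC; have [mpi mu_ iu _] := pmu.
have C0 : 0 <= C.
  by have := le_trans (normc_ge0 _) (hC 0); rewrite pmulr_lge0// exprn_gt0// weight_gt0.
have map : cmeas (fun y => a (pi y) * u y) by apply: cmeasM => //; exact: cmeas_comp.
have iau : rintegrable P (fun y => Normc.normc (a (pi y) * u y) * weight (pi y) ^- (N + M)).
  apply: (rintegrable_le (rintegrableZ C iu)).
    apply: measurable_funM; first exact: measurable_normc.
    exact: (measurableT_comp (measurable_weightV _)).
  move=> y; rewrite ger0_norm; last by rewrite mulr_ge0 ?normc_ge0 ?weightV_ge0.
  rewrite Normc.normcM exprD invfM.
  have w0 : 0 < weight (pi y) ^+ M by rewrite exprn_gt0 ?weight_gt0.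
  have -> : Normc.normc (a (pi y)) * Normc.normc (u y) * (weight (pi y) ^- N * weight (pi y) ^- M) =
    (Normc.normc (a (pi y)) / weight (pi y) ^+ M) * (Normc.normc (u y) * weight (pi y) ^- N).
    by move: (weight _ ^- N) (weight _ ^- M) => p q; ring.
  rewrite ler_wpM2r ?mulr_ge0 ?normc_ge0 ?weightV_ge0//.
  by rewrite ler_pdivrMr.
split=> // A bA; rewrite /mul_measure.
have e y : (if pi y \in A then a (pi y) else 0) * u y = if pi y \in A then a (pi y) * u y else 0.
  by case: ifP => _; rewrite ?mul0r.
rewrite (presentation_mint pmu (f := fun x => if x \in A then a x else 0)).
- by apply: eq_cint => y; rewrite e.
- by apply: cmeas_if => //; exact: bA.1.
- have normle y : `|Normc.normc (a (pi y) * u y)| <= Normc.normc (a (pi y) * u y).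
    by rewrite ger0_norm ?normc_ge0.
  have i1 := rintegrable_restrict mpi bA (measurable_normc map) iau
    (fun y => normle y).
  move: i1; congr (rintegrable P _); apply/funext => y.
  by case: ifP => _; rewrite ?Normc.normcM// Normc.normc0 mul0r.
Qed.

End integration_against_presented_measure.

(** A presentation bounds the integral of [f] by a single weighted supremum of [f]. Temperedness
    follows because [ifourier] preserves Schwartz families with null bounds. *)
Lemma Vdual_of_measure n (nu : set 'rV[R]_n -> R[i]) : slow_growing nu ->
  tempered (difourier (dist_of_measure nu)) /\
  is_fourier_measure (difourier (dist_of_measure nu)) nu.
Proof.
move=> sg; have [P [N pnu]] := slow_growing_presentation sg.
have sI (phi : 'rV[R]_n -> R[i]) : schwartz phi -> S (ifourier phi).
  by move=> /schwartz_SF sphi; exact: (SF_ifourier (@all_seq_ideal R) sphi (fun=> sphi)).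
split; last first.
  split=> // phi /schwartz_SF sphi; rewrite /dfourier /difourier /dist_of_measure.
  by rewrite fourierK.
split.
  move=> a phi psi sphi spsi; rewrite /difourier /dist_of_measure.
  have [i1 e1] := presentation_CFD pnu (S_CFD (sI _ sphi)).
  have [i2 e2] := presentation_CFD pnu (S_CFD (sI _ spsi)).
  have cphi := S_CFD (schwartz_SF sphi); have cpsi := S_CFD (schwartz_SF spsi).
  have e : ifourier (fun x => a * phi x + psi x) = fun x => a * ifourier phi x + ifourier psi x.
    apply/funext => x; rewrite /ifourier mulrCA -mulrDr; congr (_ * _); rewrite !cint_leb.
    have j1 := CFD_cintegrable (CFD_character 1 x cphi); have j2 := CFD_cintegrable (CFD_character 1 x cpsi).
    have c (f : 'rV[R]_n -> R[i]) : (fun xi => cexpi (1 * dotv x xi) * f xi) = (fun xi => cexpi (dotv xi x) * f xi).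
      by apply/funext => xi; rewrite mul1r dotvC.
    rewrite c in j1; rewrite c in j2.
    rewrite -cintZ// -cintD//; last exact: cintegrableZ.
    by apply: eq_cint => xi; rewrite mulrDr mulrCA.
  have s3 : CFD (fun x => a * ifourier phi x + ifourier psi x).
    apply: S_CFD; have := SF_add (@all_seq_ideal R) (SF_scale (@all_seq_ideal R) a (sI _ sphi)) (sI _ spsi).
    exact.
  rewrite e e1 e2 (presentation_CFD pnu s3).2 -cintZ// -cintD//; last exact: cintegrableZ.
  by apply: eq_cint => y; rewrite mulrDl mulrA.
move=> phi sphi cphi.
have ss k : S (phi k) := schwartz_SF (sphi k).
have /SF_schwartz_class[_ /(_ N)[a a0 ha] _] :=
  SF_ifourier (@null_seq_ideal R) (schwartz_cvg0_SF sphi cphi) ss.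
set K := rint P (fun y => Normc.normc (jordan_weight y : R[i]) * weight y.1.1 ^- N).
have b k : Normc.normc (mint nu (ifourier (phi k))) <= 2 * (a k * K).
  have [cI _] := S_decay1 (sI _ (sphi k)).
  by have [] := presentation_decay pnu (ccontinuous_cmeas cI) (ha k).
have lim0 : (2 * (a k * K)) @[k --> \oo] --> (0 : R).
  rewrite -[X in _ --> X](mulr0 2); apply: cvgM; first exact: cvg_cst.
  by rewrite -[X in _ --> X](mul0r K); apply: cvgM => //; exact: cvg_cst.
have lim0N : (- (2 * (a k * K))) @[k --> \oo] --> (0 : R).
  by rewrite -[X in _ --> X]oppr0; exact: cvgN.
apply/ccvgP; split => /=; apply: (squeeze_cvgr _ lim0N lim0); apply: nearW => k; rewrite -ler_norml.
  exact: le_trans (Re_le_normc _) (b k).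
exact: le_trans (Im_le_normc _) (b k).
Qed.

Lemma fourier_measureP n (T : @dist R n) : Vdual T -> is_fourier_measure T (fourier_measure T).
Proof.
by move=> [_ [mu hmu]]; exact: (@xgetPex _ _ [set mu | is_fourier_measure T mu] (ex_intro _ mu hmu)).
Qed.

Lemma sfourier_measureP d (T : @dist R (d + 1)) : VCdual T -> is_sfourier_measure T (sfourier_measure T).
Proof.
by move=> [_ [mu hmu]]; exact: (@xgetPex _ _ [set mu | is_sfourier_measure T mu] (ex_intro _ mu hmu)).
Qed.

Lemma fourier_measure_unique n (T : @dist R n) mu nu :
  is_fourier_measure T mu -> is_fourier_measure T nu ->
  forall A, bounded_borel A -> mu A = nu A.
Proof.
move=> [smu hmu] [snu hnu]; apply: slow_growing_unique => // phi sphi.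
by rewrite -[LHS]hmu// -[RHS]hnu.
Qed.

Lemma sfourier_measure_unique d (T : @dist R (d + 1)) mu nu :
  is_sfourier_measure T mu -> is_sfourier_measure T nu ->
  forall A, bounded_borel A -> mu A = nu A.
Proof.
move=> [smu hmu] [snu hnu]; apply: slow_growing_unique => // phi sphi.
by rewrite -[LHS]hmu// -[RHS]hnu.
Qed.

Lemma fourier_measure_eval n (T : @dist R n) mu phi : is_fourier_measure T mu -> schwartz phi ->
  T phi = mint mu (ifourier phi).
Proof.
move=> [_ h] sphi; rewrite -[in LHS](ifourierK (schwartz_SF sphi)).
apply: h; apply: S_schwartz.
exact: (SF_ifourier (@all_seq_ideal R) (schwartz_SF sphi) (fun=> schwartz_SF sphi)).
Qed.

End measures_and_distributions.

(** * The evolution equation *)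

Section evolution_equation.
Context {R : realType} {d : nat} (g : 'rV[R]_d -> R[i]) (kappa : R).
Hypotheses (hg : symbol_function g) (hgc : ccontinuous g) (hkappa : 0 < kappa)
  (hgR : forall xi, kappa <= complex.Re (g xi)).

Lemma last_coordE (z : 'rV[R]_(d + 1)) : last_coord z = z ord0 (rshift d ord0).
Proof. by rewrite /last_coord mxE. Qed.

Lemma continuous_lsubmx : continuous (fun z : 'rV[R]_(d + 1) => lsubmx z).
Proof.
apply: continuous_rV => k.
by under eq_fun do rewrite mxE; exact: coord_continuous.
Qed.

Lemma weight_split (z : 'rV[R]_(d + 1)) : weight z = weight (lsubmx z) + last_coord z ^+ 2.
Proof.
rewrite -[in LHS](hsubmxK z) weight_row_mx; congr (_ + _).
by rewrite /dotv big_ord1 -expr2.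
Qed.

Lemma weight_lsubmx (z : 'rV[R]_(d + 1)) : weight (lsubmx z) <= weight z.
Proof. by rewrite weight_split lerDl sqr_ge0. Qed.

Lemma ccontinuous_evolution_symbol : ccontinuous (evolution_symbol g).
Proof.
rewrite /evolution_symbol; apply: ccontD.
  apply/ccontinuousP; split => /=; first exact: cst_continuous.
  by under eq_fun do rewrite last_coordE; exact: coord_continuous.
move=> z; have cg := @hgc (lsubmx z).
exact: (@cvg_comp _ _ _ (fun z : 'rV[R]_(d + 1) => lsubmx z) (g : _ -> R[i]^o) _ _ _ (@continuous_lsubmx z) cg).
Qed.

Lemma Re_evolution_symbol z : complex.Re (evolution_symbol g z) = complex.Re (g (lsubmx z)).
Proof. by rewrite /evolution_symbol ReD /= add0r. Qed.

Lemma evolution_symbol_neq0 z : evolution_symbol g z != 0.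
Proof.
apply/eqP => e; have := hgR (lsubmx z); rewrite -Re_evolution_symbol e /= leNgt.
by rewrite hkappa.
Qed.

Lemma normc_evolution_symbol_inv z : Normc.normc (evolution_symbol g z)^-1 <= kappa^-1.
Proof.
have h : kappa <= Normc.normc (evolution_symbol g z).
  apply: le_trans (hgR (lsubmx z)) _; rewrite -Re_evolution_symbol.
  exact: le_trans (ler_norm _) (Re_le_normc _).
have n0 := lt_le_trans hkappa h.
have -> : Normc.normc (evolution_symbol g z)^-1 = (Normc.normc (evolution_symbol g z))^-1.
  apply: (mulfI (lt0r_neq0 n0)); rewrite mulfV ?gt_eqF// -Normc.normcM.
  by rewrite mulfV ?evolution_symbol_neq0// -[1]/(1%:C) normc_real normr1.
by rewrite lef_pV2.
Qed.

Lemma cmeas_evolution_symbol_inv : cmeas (fun z => (evolution_symbol g z)^-1).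
Proof.
apply: ccontinuous_cmeas => z; apply: (@cvgV _ _ (nbhs z)); first exact: evolution_symbol_neq0.
exact: ccontinuous_evolution_symbol.
Qed.

Lemma evolution_symbol_growth : exists C M, forall z,
  Normc.normc (evolution_symbol g z) <= C * weight z ^+ M.
Proof.
(* The extra power covers the time frequency, since |w| <= 1 + w^2. *)
have [_ [C [M hC]] _ _] := hg; exists (1 + C), M.+1 => z.
have C0 : 0 <= C.
  by have := le_trans (normc_ge0 _) (hC 0); rewrite pmulr_lge0// exprn_gt0// weight_gt0.
have w1 := weight_ge1 z.
apply: le_trans (normcDle _ _) _; rewrite mulrDl mul1r; apply: lerD.
  apply: le_trans (_ : weight z <= _); last by rewrite ler_eXnr.
  apply: le_trans (normc_le_ReIm _) _; rewrite /= normr0 add0r weight_split.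
  have := weight_ge1 (lsubmx z); rewrite -(real_normK (num_real (last_coord z))).
  by have := normr_ge0 (last_coord z); nra.
apply: le_trans (hC _) _; rewrite ler_wpM2l//.
apply: le_trans (_ : weight z ^+ M <= _).
  by rewrite lerXn2r ?nnegrE ?weight_lsubmx// ltW// weight_gt0.
by rewrite ler_weXn2l.
Qed.

Variable X : @dist R (d + 1).
Hypothesis hXV : Vdual X.

Lemma presentation_Uinfty e (Y : measurableType e) (P : {measure set Y -> \bar R}) pi u N :
  presentation P pi u N (fourier_measure X) ->
  presentation P pi (fun y => (evolution_symbol g (pi y))^-1 * u y) N
    (mul_measure (fun z => (evolution_symbol g z)^-1) (fourier_measure X)).
Proof.
move=> pmu; have h z : Normc.normc (evolution_symbol g z)^-1 <= kappa^-1 * weight z ^+ 0.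
  by rewrite expr0 mulr1; exact: normc_evolution_symbol_inv.
by have := presentation_mul pmu cmeas_evolution_symbol_inv h; rewrite addn0.
Qed.

Lemma Uinfty_fourier : tempered (Uinfty g X) /\ is_fourier_measure (Uinfty g X)
  (mul_measure (fun z => (evolution_symbol g z)^-1) (fourier_measure X)).
Proof.
have [smu _] := fourier_measureP hXV; have [P [N pmu]] := slow_growing_presentation smu.
exact: Vdual_of_measure (presentation_slow_growing (presentation_Uinfty pmu)).
Qed.

Lemma Vdual_Uinfty : Vdual (Uinfty g X).
Proof. by have [? ?] := Uinfty_fourier; split=> //; eexists; eassumption. Qed.

Lemma Uinfty_solution : eq_dist (evolution_operator g (Uinfty g X)) X.
Proof.
move=> phi sphi.
have hX := fourier_measureP hXV; have [P [N pmu]] := slow_growing_presentation hX.1.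
have pU := presentation_transfer (presentation_Uinfty pmu)
  (fourier_measure_unique (fourier_measureP Vdual_Uinfty) Uinfty_fourier.2).
have [C [M hC]] := evolution_symbol_growth.
have pE := presentation_mul pU (ccontinuous_cmeas ccontinuous_evolution_symbol) hC.
have sI := SF_ifourier (@all_seq_ideal R) (schwartz_SF sphi) (fun=> schwartz_SF sphi).
rewrite /evolution_operator /multiplier /difourier /dist_of_measure.
rewrite (presentation_CFD pE (S_CFD sI)).2 (fourier_measure_eval hX sphi) (presentation_CFD pmu (S_CFD sI)).2.
by apply: eq_cint => y; rewrite mulVKf// evolution_symbol_neq0.
Qed.

(** Tested on Schwartz functions, the equation identifies the measure F X with (i w + g) F U on
    bounded sets; the symbol has no zeros and can be divided out of the density. *)
Lemma Uinfty_unique (U : @dist R (d + 1)) : Vdual U -> eq_dist (evolution_operator g U) X ->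
  eq_dist U (Uinfty g X).
Proof.
move=> hU eU phi sphi.
have hX := fourier_measureP hXV.
have hF := fourier_measureP hU; have [P [N pmu]] := slow_growing_presentation hF.1.
have [C [M hC]] := evolution_symbol_growth.
have pE := presentation_mul pmu (ccontinuous_cmeas ccontinuous_evolution_symbol) hC.
have same A : bounded_borel A -> fourier_measure X A =
    mul_measure (evolution_symbol g) (fourier_measure U) A.
  apply: slow_growing_unique; [exact: hX.1|exact: presentation_slow_growing pE|].
  move=> psi spsi; rewrite -[LHS]hX.2// /dfourier -eU.
    by rewrite /evolution_operator /multiplier /difourier fourierK//; exact: schwartz_SF.
  apply: S_schwartz; exact: (SF_fourier (@all_seq_ideal R) (schwartz_SF spsi) (fun=> schwartz_SF spsi)).
have pX := presentation_Uinfty (presentation_transfer pE same).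
have sI := SF_ifourier (@all_seq_ideal R) (schwartz_SF sphi) (fun=> schwartz_SF sphi).
rewrite (fourier_measure_eval hF sphi) (fourier_measure_eval Uinfty_fourier.2 sphi).
rewrite (presentation_CFD pX (S_CFD sI)).2 (presentation_CFD pmu (S_CFD sI)).2.
by apply: eq_cint => y; rewrite mulKf// evolution_symbol_neq0.
Qed.

End evolution_equation.

(** * The spatial Fourier transform of the solution *)

Section half_line_exponential.
Context {R : realType}.

Definition half_exp (w : R[i]) (s : R) : R[i] :=
  if s \in `[0, +oo[%classic then cexp (s%:C * (- w)) else 0.

Lemma normc_half_exp_le (kappa : R) w s : kappa <= complex.Re w ->
  Normc.normc (half_exp w s) <= if s \in `[0, +oo[%classic then expR (- (kappa * s)) else 0.
Proof.
move=> kw; rewrite /half_exp; case: ifPn => [sI|_]; last by rewrite Normc.normc0.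
have s0 : 0 <= s by move: sI; rewrite inE/= in_itv/= andbT.
rewrite normc_cexp ReM /= mul0r subr0 ReN mulrN.
by rewrite ler_expR lerN2 mulrC ler_wpM2l.
Qed.

(** The bound is uniform in all w with Re w >= kappa, that is, over all frequencies. It supplies the
    powers of 1 + s^2 consumed by Peetre's inequality. *)
Lemma half_exp_decay (kappa : R) M : 0 < kappa -> exists C, forall w s, kappa <= complex.Re w ->
  (1 + s ^+ 2) ^+ M * Normc.normc (half_exp w s) <= C.
Proof.
move=> k0; have [C hC] := exp_decay M k0; exists C => w s kw.
have p0 : 0 <= (1 + s ^+ 2) ^+ M by rewrite exprn_ge0// ltW// one_add_sqr_gt0.
apply: le_trans (ler_wpM2l p0 (normc_half_exp_le s kw)) _.
case: ifPn => [|_]; first by rewrite inE/= in_itv/= andbT mulrC; exact: hC.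
by rewrite mulr0; apply: le_trans (hC 0 (lexx 0)); rewrite mulr_ge0 ?expR_ge0// exprn_ge0// addr_ge0// sqr_ge0.
Qed.

Lemma half_exp_le1 (kappa : R) w s : 0 < kappa -> kappa <= complex.Re w ->
  Normc.normc (half_exp w s) <= 1.
Proof.
move=> k0 kw; apply: le_trans (normc_half_exp_le s kw) _.
case: ifPn => [|_]; last exact: ler01.
by rewrite inE/= in_itv/= andbT => s0; rewrite expR_le1 oppr_le0 mulr_ge0// ltW.
Qed.

Lemma cmeas_cexp d (T : measurableType d) (f : T -> R[i]) : cmeas f -> cmeas (fun x => cexp (f x)).
Proof.
move=> [fR fI]; apply: cmeasM; last exact: cmeas_cexpi.
by apply: cmeas_real; exact: measurableT_comp.
Qed.

Lemma cmeas_half_exp d (T : measurableType d) (f : T -> R[i]) (h : T -> R) :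
  cmeas f -> measurable_fun setT h -> cmeas (fun x => half_exp (f x) (h x)).
Proof.
move=> mf mh; have mA : measurable (h @^-1` `[0, +oo[%classic).
  by rewrite -[X in measurable X]setTI; apply: mh => //; exact: measurable_itv.
have mN : cmeas (fun x => - f x).
  have h1 : cmeas (fun _ : T => (-1 : R[i])) by exact: cmeas_cst.
  by have := cmeasM h1 mf; congr cmeas; apply/funext => x; rewrite mulN1r.
exact: (cmeas_if mA (cmeas_cexp (cmeasM (cmeas_real mh) mN))).
Qed.

End half_line_exponential.

(** * Translations in time *)

Section time_translation.
Context {R : realType} {d : nat}.
Local Notation jt := (rshift d (ord0 : 'I_1)).
Local Notation S f := (SF (@all_seq R) (fun=> f)).

Definition tshift (z : 'rV[R]_(d + 1)) (s : R) : 'rV[R]_(d + 1) := z + s *: delta_mx ord0 jt.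

Lemma tshift_setc z s : tshift z s = setc z jt (z ord0 jt + s).
Proof. exact: add_delta. Qed.

Lemma lsubmx_setc (z : 'rV[R]_(d + 1)) (s : R) : lsubmx (setc z jt s) = lsubmx z.
Proof. by apply: row_ext => k; rewrite !mxE eq_lrshift. Qed.

Lemma last_coord_setc (z : 'rV[R]_(d + 1)) (s : R) : last_coord (setc z jt s) = s.
Proof. by rewrite last_coordE setcE eqxx. Qed.

(** Peetre's inequality for a shift of the time coordinate: the excess of the right side is a sum of
    nonnegative terms. *)
Lemma peetre_tshift z s : weight z <= 2 * (1 + s ^+ 2) * weight (tshift z s).
Proof.
rewrite tshift_setc !weight_split lsubmx_setc last_coord_setc last_coordE.
have := weight_ge1 (lsubmx z); set A := weight _; set t := z _ _ => A1.
have h1 := sqr_ge0 (t + 2 * s); have h2 := sqr_ge0 (s * (t + s)).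
have h3 : 0 <= (A - 1) * s ^+ 2 by rewrite mulr_ge0 ?sqr_ge0// subr_ge0.
have -> : 2 * (1 + s ^+ 2) * (A + (t + s) ^+ 2) =
  (A + t ^+ 2) + (A + (t + 2 * s) ^+ 2 + 2 * ((A - 1) * s ^+ 2) + 2 * (s * (t + s)) ^+ 2) by ring.
by rewrite lerDl; lra.
Qed.

Lemma S_tshift (phi : 'rV[R]_(d + 1) -> R[i]) s : S phi -> S (fun z => phi (tshift z s)).
Proof.
move=> sphi; apply: (@SF_class _ _ _ [set chi | exists2 psi : nat -> 'rV[R]_(d + 1) -> R[i],
  SF (@all_seq R) psi & chi = fun k z => psi k (tshift z s)]); last by exists (fun=> phi).
move=> _ [psi /SF_schwartz_class[c dec p] ->]; split.
- move=> k z; have ct : continuous (fun z => tshift z s).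
    apply: continuous_rV => j; under eq_fun do rewrite !mxE.
    by apply: contD; [exact: coord_continuous|exact: cst_continuous].
  exact: (@cvg_comp _ _ _ (fun z => tshift z s) (psi k : _ -> R[i]^o) _ _ _ (ct z) (c k _)).
- move=> N; have [a _ ha] := dec N; exists (fun k => (2 * (1 + s ^+ 2)) ^+ N * a k) => // k z.
  have p0 : 0 <= 2 * (1 + s ^+ 2) by rewrite mulr_ge0// ltW// one_add_sqr_gt0.
  apply: le_trans (_ : (2 * (1 + s ^+ 2)) ^+ N * (weight (tshift z s) ^+ N * Normc.normc (psi k (tshift z s))) <= _).
    rewrite mulrA ler_wpM2r ?normc_ge0// -exprMn lerXn2r ?nnegrE ?peetre_tshift//.
      exact/ltW/weight_gt0.
    by rewrite mulr_ge0// ltW// weight_gt0.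
  by rewrite ler_wpM2l ?exprn_ge0.
- move=> j; have [chi schi h] := p j; exists (fun k z => chi k (tshift z s)); first by exists chi.
  move=> k z; have := h k (tshift z s); rewrite /pd; congr cis_derive.
  by apply/funext => r; rewrite /line_fun /tshift addrAC.
Qed.

(** The substitution t + s in the time integral turns a shift into a character. *)
Lemma coord_fourier_tshift (phi : 'rV[R]_(d + 1) -> R[i]) s z : S phi ->
  coord_fourier 1 jt (fun z => phi (tshift z s)) z = cexpi (- (s * last_coord z)) * coord_fourier 1 jt phi z.
Proof.
move=> sphi; have [cphi [C hC]] := S_decay1 sphi; rewrite /coord_fourier mulrCA; congr (_ * _).
have i1 := cintegrable_coord_fourier 1 jt z (z ord0 jt) cphi hC.
rewrite -cintZ//.
have m1 := cintegrable_cmeas (cintegrableZ (cexpi (- (s * last_coord z))) i1).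
have [cphis [C' hC']] := S_decay1 (S_tshift s sphi).
have i2 := cintegrable_coord_fourier 1 jt z (z ord0 jt) cphis hC'.
have e : (fun t => cexpi (1 * (z ord0 jt * t)) * phi (tshift (setc z jt t) s)) =
  (fun t => cexpi (- (s * last_coord z)) * (cexpi (1 * (z ord0 jt * (t + s))) * phi (setc z jt (t + s)))).
  apply/funext => t; rewrite tshift_setc setc_setc setcE eqxx [RHS]mulrA -cexpiD last_coordE.
  by congr (cexpi _ * _); ring.
by rewrite e; apply: (cint_translation m1); rewrite -e.
Qed.

(** A Schwartz function of the space variable does not decay in time, so on space-time it is only a
    multiplier. *)
Lemma OM_lsubmx (chi : 'rV[R]_d -> R[i]) : S chi -> OM (fun z : 'rV[R]_(d + 1) => chi (lsubmx z)).
Proof.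
move=> schi; exists [set m | exists2 psi : 'rV[R]_d -> R[i], S psi & m = fun z => psi (lsubmx z)]; last by exists chi.
move=> _ [psi spsi ->]; have [c _] := S_decay1 spsi; split.
- move=> z; exact: (@cvg_comp _ _ _ (fun z : 'rV[R]_(d + 1) => lsubmx z) (psi : _ -> R[i]^o) _ _ _ (@continuous_lsubmx R d z) (c _)).
- have [C hC] := S_decay 0 spsi; exists C, 0%N => z.
  by have := hC (lsubmx z); rewrite !expr0 mul1r mulr1.
- move=> j; case: (split_ordP j) => i ->.
    have [sd dd] := SF_partial i spsi.
    exists (fun z => partial i psi (lsubmx z)); first by exists (partial i psi).
    move=> z; have := dd 0%N (lsubmx z); rewrite /pd; congr cis_derive.
    apply/funext => r; rewrite /line_fun; congr psi; apply: row_ext => k.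
    by rewrite !mxE (inj_eq (@lshift_inj _ _)).
  exists (fun=> 0).
    exists (fun=> 0) => //; have := SF_scale (@all_seq_ideal R) 0 spsi; congr SF.
    by apply/funext => k; apply/funext => x; rewrite mul0r.
  move=> z; have -> : pd (fun z => psi (lsubmx z)) (rshift d i) z 0 =
      cis_derive (fun=> psi (lsubmx z)) 0 0; last exact: cis_derive_cst.
  congr cis_derive; apply/funext => r; rewrite /line_fun; congr psi; apply: row_ext => k.
  by rewrite !mxE eq_lrshift /= mulr0 addr0.
Qed.

Lemma S_mul_lsubmx (chi : 'rV[R]_d -> R[i]) (phi : 'rV[R]_(d + 1) -> R[i]) : S chi -> S phi ->
  S (fun z => chi (lsubmx z) * phi z).
Proof. by move=> schi sphi; have := SF_mul (@all_seq_ideal R) (OM_lsubmx schi) sphi. Qed.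

End time_translation.

Section spatial_transform.
Context {R : realType} {d : nat} (g : 'rV[R]_d -> R[i]) (kappa : R).
Local Notation jt := (rshift d (ord0 : 'I_1)).
Local Notation leb1 := (@lebesgue_measure R).
Hypotheses (hg : symbol_function g) (hgc : ccontinuous g) (hkappa : 0 < kappa)
  (hgR : forall xi, kappa <= complex.Re (g xi)).
Variable X : @dist R (d + 1).
Hypotheses (hXV : Vdual X) (hXVC : VCdual X).
Let mu := fourier_measure X.
Let nu := sfourier_measure X.

(* F_S X = F_T^-1 (F X), tested against phi. *)
Lemma mint_coord_fourier phi : schwartz phi -> mint mu (coord_fourier 1 jt phi) = mint nu phi.
Proof.
move=> sphi; have ss := schwartz_SF sphi; have [_ h] := sfourier_measureP hXVC.
rewrite -[RHS]h//.
have n1 : (-1 : R) ^+ 2 = 1 by rewrite sqrrN expr1n.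
rewrite /dsfourier (fourier_measure_eval (fourier_measureP hXV)) ?ifourier_sfourier//.
rewrite sfourier_multi_fourier; last exact: S_CFD.
apply: S_schwartz; exact: (SF_multi_fourier (space_coords d) (@all_seq_ideal R) n1 ss).
Qed.

Context e1 (Y : measurableType e1) (P : {sigma_finite_measure set Y -> \bar R})
  (pi : Y -> 'rV[R]_(d + 1)) (u : Y -> R[i]) (N : nat).
Context e2 (Z : measurableType e2) (Q : {sigma_finite_measure set Z -> \bar R})
  (rho : Z -> 'rV[R]_(d + 1)) (v : Z -> R[i]) (M : nat).
Hypotheses (pmu : presentation P pi u N mu) (pnu : presentation Q rho v M nu).

Let mpi : measurable_fun setT pi. Proof. by case: pmu. Qed.
Let mrho : measurable_fun setT rho. Proof. by case: pnu. Qed.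
Let mu_ : cmeas u. Proof. by case: pmu. Qed.
Let mv : cmeas v. Proof. by case: pnu. Qed.

Section test_function.
Variables (phi : 'rV[R]_(d + 1) -> R[i]).
Hypothesis sphi : schwartz phi.
Let sS := schwartz_SF sphi.
Let psi := coord_fourier 1 jt phi.
Let spsi := S_coord_fourier jt (expr1n _ 2) sS.

Let iP : cintegrable P (fun y => psi (pi y) * u y).
Proof. by have [] := presentation_CFD pmu (S_CFD spsi). Qed.
Let iQ : cintegrable Q (fun y => phi (rho y) * v y).
Proof. by have [] := presentation_CFD pnu (S_CFD sS). Qed.

(** [m1] and [m2] are the projections to xi-space of [psi] F X and [phi] F_S X, where [psi] is the
    inverse time transform of [phi]. *)
Let m1 (A : set 'rV[R]_d) := cint P (fun y => if lsubmx (pi y) \in A then psi (pi y) * u y else 0).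
Let m2 (A : set 'rV[R]_d) := cint Q (fun y => if lsubmx (rho y) \in A then phi (rho y) * v y else 0).

Let p1 : presentation P (fun y => lsubmx (pi y)) (fun y => psi (pi y) * u y) 0 m1.
Proof.
split=> //; first exact: (measurableT_comp (@measurable_lsubmx R d 1)).
  exact: cintegrable_cmeas iP.
by have := rintegrable_normc iP; congr (rintegrable P _); apply/funext => y; rewrite expr0 invr1 mulr1.
Qed.

Let p2 : presentation Q (fun y => lsubmx (rho y)) (fun y => phi (rho y) * v y) 0 m2.
Proof.
split=> //; first exact: (measurableT_comp (@measurable_lsubmx R d 1)).
  exact: cintegrable_cmeas iQ.
by have := rintegrable_normc iQ; congr (rintegrable Q _); apply/funext => y; rewrite expr0 invr1 mulr1.
Qed.

(* For Schwartz m this is mint_coord_fourier; and Schwartz functions determine a measure. *)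
Lemma spatial_multiplier (m : 'rV[R]_d -> R[i]) C : cmeas m -> (forall x, Normc.normc (m x) <= C) ->
  cint P (fun y => m (lsubmx (pi y)) * (psi (pi y) * u y)) =
  cint Q (fun y => m (lsubmx (rho y)) * (phi (rho y) * v y)).
Proof.
move=> mm hC.
have same A : bounded_borel A -> m2 A = m1 A.
  apply: slow_growing_unique; [exact: presentation_slow_growing p2|exact: presentation_slow_growing p1|].
  move=> chi schi; have sc := schwartz_SF schi.
  rewrite (presentation_CFD p1 (S_CFD sc)).2 (presentation_CFD p2 (S_CFD sc)).2.
  have sm := S_mul_lsubmx sc sS.
  have := mint_coord_fourier (S_schwartz sm).
  rewrite (presentation_CFD pnu (S_CFD sm)).2 (presentation_CFD pmu (S_CFD (S_coord_fourier jt (expr1n _ 2) sm))).2.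
  have [cphi [B hB]] := S_decay1 sS.
  have -> : coord_fourier 1 jt (fun z => chi (lsubmx z) * phi z) = fun z => chi (lsubmx z) * psi z.
    apply/funext => z; rewrite (coord_fourier_indep 1 (m := fun z => chi (lsubmx z)) cphi hB)// => t.
    by rewrite lsubmx_setc.
  move=> h; rewrite [LHS](_ : _ = cint Q (fun y => chi (lsubmx (rho y)) * phi (rho y) * v y)).
    by rewrite -h; apply: eq_cint => y; rewrite mulrA.
  by apply: eq_cint => y; rewrite mulrA.
have hC' x : weight x ^+ 0 * Normc.normc (m x) <= C by rewrite expr0 mul1r.
have [_ e4 _] := presentation_decay (presentation_transfer p1 same) mm hC'.
have [_ e5 _] := presentation_decay p2 mm hC'.
by rewrite -e5 -e4.
Qed.

End test_function.

(* The solution relaxes along time translations: 1/(i w + g) is the Laplace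
   integral of e^{-(i w + g) s}, and e^{-i w s} translates by s in time. *)
Definition drift (p : Z * R) : 'rV[R]_(d + 1) := tshift (rho p.1) p.2.
Definition relaxed (p : Z * R) : R[i] := half_exp (g (lsubmx (rho p.1))) p.2 * v p.1.
Definition spatial_solution (A : set 'rV[R]_(d + 1)) : R[i] :=
  cint (Q \x leb1)%E (fun p => if drift p \in A then relaxed p else 0).

Lemma measurable_drift : measurable_fun setT drift.
Proof.
apply: measurable_fun_rV => k; under eq_fun do rewrite !mxE.
apply: measurable_funD.
  apply: (measurableT_comp (measurable_coord k)); exact: measurableT_comp.
by apply: measurable_funM => //; exact: measurable_snd.
Qed.

Lemma cmeas_relaxed : cmeas relaxed.
Proof.
apply: cmeasM; last exact: (cmeas_comp measurable_fst mv).
apply: cmeas_half_exp; last exact: measurable_snd.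
apply: (cmeas_comp (h := fun p : Z * R => lsubmx (rho p.1))); last exact: ccontinuous_cmeas.
by apply: (measurableT_comp (@measurable_lsubmx R d 1)); exact: measurableT_comp.
Qed.

Lemma presentation_spatial_solution : presentation (Q \x leb1)%E drift relaxed M spatial_solution.
Proof.
split => //; [exact: measurable_drift|exact: cmeas_relaxed|].
(* [M] powers of 1 + s^2 pay for the translation by Peetre's inequality, and one more makes the
   bound integrable in s. *)
have [C hC] := half_exp_decay M.+1 hkappa.
have [_ _ iv _] := pnu.
apply: (rintegrable_le (rintegrable_prod iv (rintegrableZ (2 ^+ M * C) (@rintegrable_oneDsqrV R)))).
  apply: measurable_funM; first exact: measurable_normc cmeas_relaxed.
  exact: (measurableT_comp (measurable_weightV _) measurable_drift).
move=> [y s]; rewrite ger0_norm; last by rewrite mulr_ge0 ?normc_ge0 ?weightV_ge0.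
rewrite /relaxed /drift /= Normc.normcM.
have := hC (g (lsubmx (rho y))) s (hgR _); set E := Normc.normc (half_exp _ _).
have := peetre_tshift (rho y) s; set W := weight (tshift _ _); set w := weight _ => hW hE.
have W0 : 0 < W := weight_gt0 _; have w0 : 0 < w := weight_gt0 _; have s0 := one_add_sqr_gt0 s.
have v0 := normc_ge0 (v y).
have h : E * W ^- M <= w ^- M * (2 ^+ M * C * (1 + s ^+ 2)^-1).
  rewrite ler_pdivrMr ?exprn_gt0//.
  have -> : w ^- M * (2 ^+ M * C / (1 + s ^+ 2)) * W ^+ M =
      (2 ^+ M * C * W ^+ M) / (w ^+ M * (1 + s ^+ 2)).
    by rewrite invfM; move: (w ^- M) (_^-1) => p q; ring.
  rewrite ler_pdivlMr ?mulr_gt0 ?exprn_gt0//.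
  apply: le_trans (_ : E * ((2 * (1 + s ^+ 2) * W) ^+ M * (1 + s ^+ 2)) <= _).
    rewrite ler_wpM2l ?normc_ge0// ler_wpM2r ?(ltW s0)// lerXn2r ?nnegrE ?(ltW w0)//.
    by rewrite !mulr_ge0// ltW.
  have -> : E * ((2 * (1 + s ^+ 2) * W) ^+ M * (1 + s ^+ 2)) =
      2 ^+ M * W ^+ M * ((1 + s ^+ 2) ^+ M.+1 * E).
    by set q := 1 + s ^+ 2; rewrite !exprMn exprS; ring.
  rewrite [X in _ <= X]mulrAC ler_wpM2l// mulr_ge0// exprn_ge0//; exact: ltW.
rewrite mulrAC mulrC; apply: le_trans (ler_wpM2l v0 h) _.
by rewrite -[X in _ <= X]mulrA.
Qed.

Lemma half_exp_symbol (z : 'rV[R]_(d + 1)) (s : R) : half_exp (evolution_symbol g z) s =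
  half_exp (g (lsubmx z)) s * cexpi (- (s * last_coord z)).
Proof.
rewrite /half_exp; case: ifP => _; last by rewrite mul0r.
have -> : s%:C * - evolution_symbol g z = s%:C * - g (lsubmx z) + (0 +i* (- (s * last_coord z))).
  by rewrite /evolution_symbol; case: (g _) => p q; apply: complexP => /=; ring.
by rewrite cexpD; congr (_ * _); rewrite /cexp /= expR0 mul1r.
Qed.

(** On the side of F X, 1/(i w + g) is written as a Laplace integral and the integral over s is
    pulled out. At fixed s, the oscillating factor shifts the test function, and the remaining e^(-g
    s) depends on xi only, so [spatial_multiplier] carries the integral over to F_S X. *)
Lemma Uinfty_sfourier : is_sfourier_measure (Uinfty g X) spatial_solution.
Proof.
split; first exact: presentation_slow_growing presentation_spatial_solution.
move=> phi sphi; have sS := schwartz_SF sphi.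
have n1 : (-1 : R) ^+ 2 = 1 by rewrite sqrrN expr1n.
have spsi := S_coord_fourier jt (expr1n _ 2) sS.
have pU := presentation_Uinfty hgc hkappa hgR pmu.
rewrite /dsfourier (fourier_measure_eval (Uinfty_fourier hgc hkappa hgR hXV).2); last first.
  rewrite sfourier_multi_fourier; last exact: S_CFD.
  apply: S_schwartz; exact: (SF_multi_fourier (space_coords d) (@all_seq_ideal R) n1 sS).
rewrite ifourier_sfourier// (presentation_CFD pU (S_CFD spsi)).2.
rewrite /dist_of_measure (presentation_CFD presentation_spatial_solution (S_CFD sS)).2.
have [iP _] := presentation_CFD pmu (S_CFD spsi).
have [iR _] := presentation_CFD presentation_spatial_solution (S_CFD sS).
(* The integrand of the Laplace representation on Y times the s-axis; integrating out s restores the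
   inverse of the symbol. *)
pose K (p : Y * R) := half_exp (evolution_symbol g (pi p.1)) p.2 * (coord_fourier 1 jt phi (pi p.1) * u p.1).
have iK : cintegrable (P \x leb1)%E K.
  have [C hC] := half_exp_decay 1 hkappa.
  apply: (cintegrable_le (rintegrable_prod (rintegrable_normc iP) (rintegrableZ C (@rintegrable_oneDsqrV R)))).
    apply: cmeasM; last exact: (cmeas_comp measurable_fst (cintegrable_cmeas iP)).
    apply: cmeas_half_exp; last exact: measurable_snd.
    apply: (cmeas_comp (h := fun p : Y * R => pi p.1)); first exact: measurableT_comp.
    exact: ccontinuous_cmeas (ccontinuous_evolution_symbol hgc).
  move=> [y s]; rewrite /K /= Normc.normcM mulrC ler_wpM2l ?normc_ge0//.
  rewrite ler_pdivlMr ?one_add_sqr_gt0// mulrC.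
  by have := hC (evolution_symbol g (pi y)) s; rewrite expr1 Re_evolution_symbol; apply.
transitivity (cint (P \x leb1)%E K).
  have [_ ->] := cint_fubini1 iK; apply: eq_cint => y; rewrite /K /=.
  have kz : 0 < complex.Re (evolution_symbol g (pi y)).
    by rewrite Re_evolution_symbol; exact: lt_le_trans hkappa (hgR _).
  have [i1 <-] := cexp_half_line kz.
  rewrite mulrCA mulrC -cintZ//; apply: eq_cint => s; exact: mulrC.
have [_ ->] := cint_fubini2 iK; have [_ ->] := cint_fubini2 iR.
apply: eq_cint => s.
have mm : cmeas (fun xi => half_exp (g xi) s).
  by apply: cmeas_half_exp; [exact: ccontinuous_cmeas|exact: measurable_cst].
have m1 xi : Normc.normc (half_exp (g xi) s) <= 1 by exact: half_exp_le1 hkappa _.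
(* At fixed s, the integral over [Y] becomes one over [Z], with the test function shifted by s. *)
have := spatial_multiplier (S_schwartz (S_tshift s sS)) mm m1.
have eK y : K (y, s) = half_exp (g (lsubmx (pi y))) s * (coord_fourier 1 jt (fun z => phi (tshift z s)) (pi y) * u y).
  by rewrite /K /= coord_fourier_tshift// half_exp_symbol -!mulrA.
move=> hs; rewrite (eq_cint P eK) hs; apply: eq_cint => y.
by rewrite /relaxed /drift /= mulrCA.
Qed.

Lemma VCdual_Uinfty : VCdual (Uinfty g X).
Proof.
split; first by have [] := Vdual_Uinfty hgc hkappa hgR hXV.
by exists spatial_solution; exact: Uinfty_sfourier.
Qed.

End spatial_transform.

(** * Injectivity of the Fourier transform *)

Section injectivity.
Context {R : realType}.
Local Notation S f := (SF (@all_seq R) (fun=> f)).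

(** Both sides are iterated integrals of one kernel, the character being symmetric in its two
    arguments. *)
Lemma fourier_selfadjoint n (f chi : 'rV[R]_n -> R[i]) : CFD f -> CFD chi ->
  cint (leb n) (fun x => fourier chi x * f x) = cint (leb n) (fun xi => chi xi * fourier f xi).
Proof.
move=> cf cc; have if_ := CFD_cintegrable cf; have ic := CFD_cintegrable cc.
pose K (p : 'rV[R]_n * 'rV[R]_n) := fourier_cst n * (cexpi (-1 * dotv p.1 p.2) * (chi p.2 * f p.1)).
have iK : cintegrable (leb n \x leb n)%E K.
  have := rintegrable_prod (rintegrable_normc if_) (rintegrable_normc ic) => i1.
  apply: (cintegrable_le (rintegrableZ (Normc.normc (fourier_cst n : R[i])) i1)).
    apply: cmeasM; first exact: cmeas_cst.
    apply: cmeasM.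
      by apply: cmeas_cexpi; apply: measurable_funM => //; apply: measurable_dotv.
    apply: cmeasM; first exact: (cmeas_comp measurable_snd (cintegrable_cmeas ic)).
    exact: (cmeas_comp measurable_fst (cintegrable_cmeas if_)).
  move=> [x y]; rewrite /K /= !Normc.normcM normc_cexpi mul1r ler_wpM2l ?normc_ge0//.
  by rewrite mulrC.
have m1 (r : R) : -1 * r = - r by rewrite mulN1r.
transitivity (cint (leb n \x leb n)%E K).
  have [_ ->] := cint_fubini1 iK; apply: eq_cint => x; rewrite /K /= /fourier cint_leb.
  rewrite cintZ; last first.
    apply: (cintegrable_le (rintegrableZ (Normc.normc (f x)) (rintegrable_normc ic))).
      apply: cmeasM; first by apply: cmeas_cexpi; apply: measurable_funM => //; exact: measurable_dotv.
      by apply: cmeasM; [exact: cintegrable_cmeas ic|exact: cmeas_cst].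
    by move=> y; rewrite !Normc.normcM normc_cexpi mul1r mulrC.
  rewrite -mulrA; congr (_ * _); rewrite mulrC -cintZ.
    by apply: eq_cint => y; rewrite m1; move: (cexpi _) (chi y) (f x) => a b c; ring.
  have := CFD_cintegrable (CFD_character (-1) x cc); congr (cintegrable (leb n) _).
  by apply/funext => y; rewrite m1.
have [_ ->] := cint_fubini2 iK; apply: eq_cint => y; rewrite /K /= /fourier cint_leb.
rewrite cintZ; last first.
  apply: (cintegrable_le (rintegrableZ (Normc.normc (chi y)) (rintegrable_normc if_))).
    apply: cmeasM; first by apply: cmeas_cexpi; apply: measurable_funM => //; exact: measurable_dotv.
    by apply: cmeasM; [exact: cmeas_cst|exact: cintegrable_cmeas if_].
  by move=> x; rewrite !Normc.normcM normc_cexpi mul1r.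
rewrite mulrCA; congr (_ * _); rewrite -cintZ.
  by apply: eq_cint => x; rewrite m1 (dotvC x y); move: (cexpi _) (chi y) (f x) => a b c; ring.
have := CFD_cintegrable (CFD_character (-1) y cf); congr (cintegrable (leb n) _).
by apply/funext => x; rewrite m1.
Qed.

(** Where k(x) > 0, continuity keeps [k] above k(x)/2 on a sup-norm ball, which is a box of positive
    Lebesgue measure; its integral there could not vanish. *)
Lemma continuous_integral_eq0 n (k b0 : 'rV[R]_n -> R) : continuous k -> rintegrable (leb n) b0 ->
  (forall x, `|k x| <= b0 x) ->
  (forall a b, rint (leb n) (fun x => if x \in box a b then k x else 0) = 0) ->
  forall x, k x <= 0.
Proof.
move=> ck ib0 kb k0 x; rewrite leNgt; apply/negP => kx.
have kx2 : 0 < k x / 2 by rewrite divr_gt0.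
have : nbhs x [set y | k x / 2 < k y].
  have : nbhs (k x) [set r | k x / 2 < r].
    by apply: open_nbhs_nbhs; split; [exact: open_gt|rewrite /= ltr_pdivrMr// ltr_pMr// ltr1n].
  exact: (ck x).
move=> /nbhs_ballP[e /= e0 eU].
set a := x - const_mx e; set b := x + const_mx e.
have bab : box a b = ball x e by rewrite ball_box.
have mb : measurable (box a b) by exact: (bounded_borel_box a b).1.
have pos : (0 < leb n (box a b))%E.
  by apply: leb_box_gt0 => j; rewrite !mxE ltrD2l gtrN.
have fin := leb_box_lty a b.
pose h (y : 'rV[R]_n) : R := if y \in box a b then k x / 2 else 0.
have intE : (\int[leb n]_y (h y)%:E = (k x / 2)%:E * leb n (box a b))%E.
  rewrite -integral_cst// [in RHS]integral_mkcond; apply: eq_integral => y _.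
  by rewrite /h /patch; case: ifP.
have ih : rintegrable (leb n) h.
  apply/integrableP; split.
    apply/measurable_EFinP; have := measurable_fun_if_in mb (measurable_cst (k x / 2)).
    exact.
  have -> : (fun y => `|(EFin \o h) y|)%E = (fun y => (h y)%:E).
    apply/funext => y /=; rewrite ger0_norm// /h; case: ifP => // _; exact: ltW.
  by rewrite intE lte_mul_pinfty// lee_fin ltW.
have ib : rintegrable (leb n) (fun y => if y \in box a b then k y else 0).
  have mk : measurable_fun setT k by exact: continuous_measurable_rV.
  apply: (rintegrable_le ib0); first exact: measurable_fun_if_in.
  by move=> y; case: ifP => // _; rewrite normr0 (le_trans _ (kb y)).
have : rint (leb n) h <= 0.
  rewrite -(k0 a b); apply: (@le_Rintegral _ _ _ (leb n) setT) => // y _.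
  rewrite /h; case: ifPn => // yb; apply/ltW/eU; rewrite -bab.
  by rewrite inE in yb.
rewrite /rint intE leNgt => /negP; apply.
by rewrite fine_gt0// mule_gt0 ?lte_fin//= lte_mul_pinfty// lee_fin ltW.
Qed.

Lemma CFD_scale n c (f : 'rV[R]_n -> R[i]) : CFD f -> CFD (fun x => c * f x).
Proof.
move=> [cf df]; split.
  by apply: (fun h => ccontM h cf); apply/ccontinuousP; split; exact: cst_continuous.
move=> N; have [C hC] := df N; exists (Normc.normc c * C) => x.
by rewrite Normc.normcM mulrCA ler_wpM2l ?normc_ge0.
Qed.

Lemma CFD_add n (f h : 'rV[R]_n -> R[i]) : CFD f -> CFD h -> CFD (fun x => f x + h x).
Proof.
move=> [cf df] [ch dh]; split; first exact: ccontD.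
move=> N; have [C hC] := df N; have [D hD] := dh N; exists (C + D) => x.
apply: le_trans (lerD (hC x) (hD x)).
by rewrite -mulrDr ler_wpM2l ?normcDle// exprn_ge0// ltW// weight_gt0.
Qed.

(** The measure D dx vanishes: each Schwartz function is the transform of another, so its integral
    against [D] moves to the transform of [D], which is 0. Continuity then gives D = 0 at every
    point. *)
Lemma fourier_ker n (D : 'rV[R]_n -> R[i]) : CFD D -> (forall xi, fourier D xi = 0) ->
  forall x, D x = 0.
Proof.
move=> cD FD.
pose m (A : set 'rV[R]_n) := cint (leb n) (fun x => if x \in A then D x else 0).
have iD := CFD_cintegrable cD.
have iN : rintegrable (leb n) (fun x => Normc.normc (D x)) := rintegrable_normc iD.
have pm : presentation (leb n) (fun x => x) D 0 m.
  split=> //; first exact: cintegrable_cmeas iD.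
  by move: iN; congr (rintegrable (leb n) _); apply/funext => y; rewrite expr0 invr1 mulr1.
have p0 : presentation (leb n) (fun x => x) (fun=> 0) 0 (fun _ : set 'rV[R]_n => 0).
  split=> //.
    apply: (rintegrable_le iN); first by under eq_fun do rewrite Normc.normc0 mul0r; exact: measurable_cst.
    by move=> x; rewrite Normc.normc0 mul0r normr0 normc_ge0.
  by move=> A _; rewrite -[LHS](cint0 (leb n)); apply: eq_cint => x; case: ifP.
have m0 A : bounded_borel A -> m A = 0.
  apply: (slow_growing_unique (nu := fun=> 0)); [exact: presentation_slow_growing pm|exact: presentation_slow_growing p0|].
  move=> psi /schwartz_SF spsi.
  have cI : CFD (ifourier psi) := S_CFD (SF_ifourier (@all_seq_ideal R) spsi (fun=> spsi)).
  rewrite (presentation_CFD pm (S_CFD spsi)).2 (presentation_CFD p0 (S_CFD spsi)).2.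
  rewrite -(ifourierK spsi) (fourier_selfadjoint cD cI).
  by apply: eq_cint => x; rewrite FD !mulr0.
(* Used for c = 1, -1, i, -i, which forces both parts of D(x) to vanish. *)
have key c x : complex.Re (c * D x) <= 0.
  have [cc _] := CFD_scale c cD; have [cR _] := iffLR (ccontinuousP _) cc.
  apply: (continuous_integral_eq0 cR (rintegrableZ (Normc.normc c) iN)) => [y|a b].
    by apply: le_trans (Re_le_normc _) _; rewrite Normc.normcM.
  have iB : cintegrable (leb n) (fun x => if x \in box a b then D x else 0).
    apply: (cintegrable_le iN).
      by apply: cmeas_if; [exact: (bounded_borel_box a b).1|exact: cintegrable_cmeas iD].
    by move=> y; case: ifP => // _; rewrite Normc.normc0 normc_ge0.
  have := cintZ c iB; rewrite -/(m _) m0; last exact: bounded_borel_box.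
  rewrite mulr0 => /(congr1 (@complex.Re R)) /= h; rewrite -[RHS]h; congr rint; apply/funext => y.
  by case: ifP => //; rewrite mulr0.
move=> x; have := key 1 x; have := key (-1) x; have := key (0 +i* 1) x; have := key (0 +i* (-1)) x.
rewrite !ReM /= !(mul1r, mul0r, sub0r, mulN1r, opprK, oppr0, subr0, addr0, oppr_le0) => h1 h2 h3 h4.
by apply: complexP; rewrite [RHS]/=; lra.
Qed.

Lemma fourier_inj n (f h : 'rV[R]_n -> R[i]) : CFD f -> CFD h -> fourier f = fourier h -> f = h.
Proof.
move=> cf ch fh; apply/funext => x; apply/eqP; rewrite -subr_eq0 -mulN1r; apply/eqP.
apply: (fourier_ker (D := fun x => f x + -1 * h x)).
  by apply: CFD_add => //; exact: CFD_scale.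
move=> xi; have i1 := CFD_cintegrable (CFD_character (-1) xi cf).
have i2 := CFD_cintegrable (CFD_character (-1) xi ch).
have := congr1 (fun F => F xi) fh; rewrite /fourier !cint_leb.
have e (k : 'rV[R]_n -> R[i]) : cint (leb n) (fun x => cexpi (- dotv xi x) * k x) =
    cint (leb n) (fun x => cexpi (-1 * dotv xi x) * k x).
  by apply: eq_cint => y; rewrite mulN1r.
rewrite !e => efh.
rewrite (eq_cint (leb n) (g := fun x => cexpi (-1 * dotv xi x) * f x + -1 * (cexpi (-1 * dotv xi x) * h x))).
  by rewrite cintD// ?cintZ// ?mulrDr 1?[X in _ + X]mulrCA ?efh ?mulN1r ?subrr//; exact: cintegrableZ.
by move=> y; rewrite mulrDr [X in _ + X]mulrCA.
Qed.

(** At each fixed time this is injectivity in the space variable. It makes the preimage chosen in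
    [VCpairing] computable. *)
Lemma sfourier_inj d (f h : 'rV[R]_(d + 1) -> R[i]) : CFD f -> CFD h ->
  sfourier f = sfourier h -> f = h.
Proof.
move=> cf ch e; apply/funext => z.
have slice : (fun x : 'rV[R]_d => f (row_mx x (rsubmx z))) = (fun x => h (row_mx x (rsubmx z))).
  apply: fourier_inj; [exact: CFD_row_mx_l|exact: CFD_row_mx_l|].
  apply/funext => xi; have := congr1 (fun F => F (row_mx xi (rsubmx z))) e.
  by rewrite /sfourier row_mxKl row_mxKr.
by have := congr1 (fun F => F (lsubmx z)) slice; rewrite /= hsubmxK.
Qed.

End injectivity.

(** * The representation *)

Section tensor_products.
Context {R : realType} {d : nat}.
Local Notation leb1 := (@lebesgue_measure R).

Lemma CFD_tensor (f : 'rV[R]_d -> R[i]) (theta : R -> R[i]) : CFD f ->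
  CFD (fun s : 'rV[R]_1 => theta (s ord0 ord0)) -> CFD (tensor f theta).
Proof.
move=> [cf df] [ct dt]; split.
  apply: ccontM => z.
    exact: (@cvg_comp _ _ _ (fun z : 'rV[R]_(d + 1) => lsubmx z) (f : _ -> R[i]^o) _ _ _ (@continuous_lsubmx R d z) (cf _)).
  have cr : continuous (fun z : 'rV[R]_(d + 1) => rsubmx z).
    by apply: continuous_rV => k; under eq_fun do rewrite mxE; exact: coord_continuous.
  exact: (@cvg_comp _ _ _ (fun z : 'rV[R]_(d + 1) => rsubmx z) ((fun s : 'rV[R]_1 => theta (s ord0 ord0)) : _ -> R[i]^o) _ _ _ (cr z) (ct _)).
move=> N; have [C hC] := df N; have [D hD] := dt N; exists (C * D) => z.
rewrite /tensor Normc.normcM.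
have := hD (rsubmx z); have := hC (lsubmx z); rewrite -/(last_coord z).
have -> : weight (rsubmx z) = 1 + last_coord z ^+ 2 by rewrite /weight /dotv big_ord1 expr2.
set a := weight (lsubmx z); set p := Normc.normc _; set t := 1 + _; set q := Normc.normc _ => h1 h2.
have w : weight z <= a * t.
  rewrite weight_split /t -/a mulrDr mulr1 lerD2l ler_peMl ?sqr_ge0//; exact: weight_ge1.
have a0 : 0 <= a := ltW (weight_gt0 _); have t0 : 0 <= t := ltW (one_add_sqr_gt0 _).
have p0 : 0 <= p := normc_ge0 _; have q0 : 0 <= q := normc_ge0 _.
apply: le_trans (_ : (a * t) ^+ N * (p * q) <= _).
  by rewrite ler_wpM2r ?mulr_ge0// lerXn2r ?nnegrE ?mulr_ge0// ltW// weight_gt0.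
by rewrite exprMn mulrACA ler_pM// mulr_ge0 ?exprn_ge0.
Qed.

Lemma sfourier_tensor (f : 'rV[R]_d -> R[i]) (theta : R -> R[i]) : CFD f ->
  sfourier (tensor f theta) = tensor (fourier f) theta.
Proof.
move=> cf; apply/funext => z; rewrite /sfourier /tensor /fourier -mulrA; congr (_ * _).
rewrite !cint_leb [RHS]mulrC -cintZ.
  by apply: eq_cint => x; rewrite row_mxKl /last_coord row_mxKr mulrA mulrC.
have := CFD_cintegrable (CFD_character (-1) (lsubmx z) cf); congr (cintegrable (leb d) _).
by apply/funext => x; rewrite mulN1r.
Qed.

End tensor_products.

Section one_sided_limits.
Context {R : realType}.

Lemma cvg_cexp (w : R[i]) (tau t0 : R) :
  (cexp ((t - tau)%:C * - w) : R[i]^o) @[t --> t0] --> (cexp ((t0 - tau)%:C * - w) : R[i]^o).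
Proof.
have [cR cI] := @ccont_cexp R (- w).
have ct : (t - tau) @[t --> t0] --> t0 - tau by apply: cvgB; [exact: cvg_id|exact: cvg_cst].
by apply/ccvgP; split; [exact: (cvg_comp _ _ ct (cR _))|exact: (cvg_comp _ _ ct (cI _))].
Qed.

Lemma half_expE (w : R[i]) (s : R) : half_exp w s = if 0 <= s then cexp (s%:C * - w) else 0.
Proof.
rewrite /half_exp; case: ifPn => h.
  by have -> : 0 <= s by move: h; rewrite inE/= in_itv/= andbT.
by case: ifPn => // h'; move: h; rewrite notin_setE/= in_itv/= andbT h'.
Qed.

Lemma ccvg_near (F : set_system R) (f h : R -> R[i]) (l : R[i]) : Filter F ->
  (\forall t \near F, f t = h t) -> (f t : R[i]^o) @[t --> F] --> (l : R[i]^o) ->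
  (h t : R[i]^o) @[t --> F] --> (l : R[i]^o).
Proof. by move=> FF fh fl; apply: cvg_trans fl; apply: near_eq_cvg. Qed.

(** The half-line of [half_exp] is closed at 0, so at the jump t = tau the value is the limit from
    the right. *)
Lemma half_exp_right (w : R[i]) (tau t0 : R) :
  (half_exp w (t - tau) : R[i]^o) @[t --> t0^'+] --> (half_exp w (t0 - tau) : R[i]^o).
Proof.
rewrite [half_exp w (t0 - tau)]half_expE subr_ge0; have [h|h] := leP tau t0.
  apply: (ccvg_near (f := fun t => cexp ((t - tau)%:C * - w))); last first.
    by apply: cvg_at_right_filter; exact: cvg_cexp.
  near=> t; rewrite half_expE subr_ge0.
  have -> // : tau <= t.
  apply: le_trans h _; apply: ltW; near: t; exact: nbhs_right_gt.
apply: (ccvg_near (f := fun=> 0)); last exact: cvg_cst.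
near=> t; rewrite half_expE subr_ge0 leNgt.
have -> // : t < tau by near: t; exact: nbhs_right_lt.
Unshelve. all: by end_near.
Qed.

(** From the left the jump at t = tau has not happened yet, hence the strict inequality. *)
Lemma half_exp_left (w : R[i]) (tau t0 : R) :
  (half_exp w (t - tau) : R[i]^o) @[t --> t0^'-] -->
  ((if tau < t0 then cexp ((t0 - tau)%:C * - w) else 0) : R[i]^o).
Proof.
have [h|h] := ltP tau t0.
  apply: (ccvg_near (f := fun t => cexp ((t - tau)%:C * - w))); last first.
    by apply: cvg_at_left_filter; exact: cvg_cexp.
  near=> t; rewrite half_expE subr_ge0.
  have -> // : tau <= t.
  by apply: ltW; near: t; exact: nbhs_left_gt.
apply: (ccvg_near (f := fun=> 0)); last exact: cvg_cst.
near=> t; rewrite half_expE subr_ge0 leNgt.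
have -> // : t < tau.
apply: lt_le_trans h; near: t; exact: nbhs_left_lt.
Unshelve. all: by end_near.
Qed.

End one_sided_limits.

(** * The time slices of the solution *)

Section cadlag_representation.
Context {R : realType} {d : nat} (g : 'rV[R]_d -> R[i]) (kappa : R).
Local Notation leb1 := (@lebesgue_measure R).
Hypotheses (hgc : ccontinuous g) (hkappa : 0 < kappa)
  (hgR : forall xi, kappa <= complex.Re (g xi)).
Context e2 (Z : measurableType e2) (Q : {sigma_finite_measure set Z -> \bar R})
  (rho : Z -> 'rV[R]_(d + 1)) (v : Z -> R[i]) (M : nat).
Hypotheses (mrho : measurable_fun setT rho) (mv : cmeas v)
  (iv : rintegrable Q (fun y => Normc.normc (v y) * weight (rho y) ^- M)).

Let xi y := lsubmx (rho y).
Let tau y := last_coord (rho y).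
Let b y := Normc.normc (v y) * weight (rho y) ^- M.

(** Mass of F_S X placed at frequency xi and time tau contributes to time t only after tau, damped
    by the elapsed time. *)
Definition memory (t : R) (y : Z) : R[i] := half_exp (g (xi y)) (t - tau y) * v y.
Definition marginal (t : R) (A : set 'rV[R]_d) : R[i] :=
  cint Q (fun y => if xi y \in A then memory t y else 0).

Lemma measurable_xi : measurable_fun setT xi.
Proof. exact: (measurableT_comp (@measurable_lsubmx R d 1) mrho). Qed.

Lemma measurable_tau : measurable_fun setT tau.
Proof. exact: (measurableT_comp (@measurable_last_coord R d) mrho). Qed.

Lemma cmeas_memory_prod : cmeas (fun p : R * Z => memory p.1 p.2).
Proof.
apply: cmeasM; last exact: (cmeas_comp measurable_snd mv).
apply: cmeas_half_exp.
  apply: (cmeas_comp (h := fun p : R * Z => xi p.2)); last exact: ccontinuous_cmeas.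
  exact: (measurableT_comp measurable_xi measurable_snd).
apply: measurable_funB; first exact: measurable_fst.
exact: (measurableT_comp measurable_tau measurable_snd).
Qed.

Lemma cmeas_memory t : cmeas (memory t).
Proof.
apply: cmeasM => //; apply: cmeas_half_exp.
  by apply: (cmeas_comp (h := xi)); [exact: measurable_xi|exact: ccontinuous_cmeas].
by apply: measurable_funB; [exact: measurable_cst|exact: measurable_tau].
Qed.

(** Only the weight in xi is available on a slice, so the growth of F_S X in tau has to be absorbed.
    Peetre's inequality splits 1 + tau^2 into 1 + t^2, kept as polynomial growth in t, and 1 + (t -
    tau)^2, killed by the exponential. *)
Lemma memory_bound : exists2 C, 0 <= C & forall t y,
  Normc.normc (memory t y) * weight (xi y) ^- M <= C * (1 + t ^+ 2) ^+ M * b y.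
Proof.
have [C hC] := half_exp_decay M hkappa.
have C0 : 0 <= C.
  apply: le_trans (hC (g 0) 0 (hgR _)).
  by rewrite mulr_ge0 ?normc_ge0// exprn_ge0// ltW// one_add_sqr_gt0.
exists (2 ^+ M * C); first by rewrite mulr_ge0// exprn_ge0.
move=> t y; rewrite /memory /b Normc.normcM.
have := hC (g (xi y)) (t - tau y) (hgR _); set E := Normc.normc _; set r := t - tau y => hE.
have E0 : 0 <= E := normc_ge0 _; have v0 := normc_ge0 (v y).
have W0 : 0 < weight (xi y) := weight_gt0 _; have w0 : 0 < weight (rho y) := weight_gt0 _.
have r0 := one_add_sqr_gt0 r; have t0 := one_add_sqr_gt0 t.
have hw : weight (rho y) <= weight (xi y) * (2 * (1 + t ^+ 2) * (1 + r ^+ 2)).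
  apply: le_trans (_ : weight (xi y) * (1 + tau y ^+ 2) <= _).
    rewrite weight_split mulrDr mulr1 lerD2l ler_peMl ?sqr_ge0//; exact: weight_ge1.
  rewrite ler_wpM2l ?(ltW W0)//; have := peetre1 t (tau y).
  by rewrite -(sqrrN (_ - t)) opprB.
have h : E * weight (xi y) ^- M <= 2 ^+ M * C * (1 + t ^+ 2) ^+ M * weight (rho y) ^- M.
  rewrite ler_pdivlMr ?exprn_gt0// mulrAC ler_pdivrMr ?exprn_gt0//.
  apply: le_trans (_ : E * (weight (xi y) * (2 * (1 + t ^+ 2) * (1 + r ^+ 2))) ^+ M <= _).
    by rewrite ler_wpM2l// lerXn2r ?nnegrE ?(ltW w0)// !mulr_ge0// ltW.
  have -> : E * (weight (xi y) * (2 * (1 + t ^+ 2) * (1 + r ^+ 2))) ^+ M =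
      2 ^+ M * (1 + t ^+ 2) ^+ M * weight (xi y) ^+ M * ((1 + r ^+ 2) ^+ M * E).
    by set q := 1 + t ^+ 2; set q' := 1 + r ^+ 2; rewrite !exprMn; ring.
  have -> : 2 ^+ M * C * (1 + t ^+ 2) ^+ M * weight (xi y) ^+ M =
      2 ^+ M * (1 + t ^+ 2) ^+ M * weight (xi y) ^+ M * C by ring.
  by rewrite ler_wpM2l// !mulr_ge0// exprn_ge0// ltW.
rewrite mulrAC mulrC; apply: le_trans (ler_wpM2l v0 h) _.
by rewrite mulrCA.
Qed.

Lemma presentation_marginal t : presentation Q xi (memory t) M (marginal t).
Proof.
have [C C0 hC] := memory_bound.
split=> //; [exact: measurable_xi|exact: cmeas_memory|].
apply: (rintegrable_le (rintegrableZ (C * (1 + t ^+ 2) ^+ M) iv)).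
  apply: measurable_funM; first exact/measurable_normc/cmeas_memory.
  exact: (measurableT_comp (measurable_weightV _) measurable_xi).
by move=> y; rewrite ger0_norm ?mulr_ge0 ?normc_ge0 ?weightV_ge0//; exact: hC.
Qed.

Definition time_slice (t : R) : @dist R d := difourier (dist_of_measure (marginal t)).

Lemma time_slice_fourier t : tempered (time_slice t) /\ is_fourier_measure (time_slice t) (marginal t).
Proof. exact: Vdual_of_measure (presentation_slow_growing (presentation_marginal t)). Qed.

Lemma Vdual_time_slice t : Vdual (time_slice t).
Proof. by have [? ?] := time_slice_fourier t; split=> //; exists (marginal t). Qed.

Section test_function.
Variable (phi : 'rV[R]_d -> R[i]).
Hypothesis hphi : Vspace phi.
Let f := Vpreimage phi.

Lemma VpreimageP : CFD f /\ fourier f = phi.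
Proof. by have [k ck kphi] := hphi; exact: (@xgetPex _ _ [set f | CFD f /\ fourier f = phi] (ex_intro _ k (conj ck kphi))). Qed.

Lemma Vpairing_time_slice t : Vpairing (time_slice t) phi = cint Q (fun y => f (xi y) * memory t y).
Proof.
rewrite /Vpairing; have pt := presentation_transfer (presentation_marginal t)
  (fourier_measure_unique (fourier_measureP (Vdual_time_slice t)) (time_slice_fourier t).2).
exact: (presentation_CFD pt VpreimageP.1).2.
Qed.

Lemma test_memory_bound : exists2 D, 0 <= D & forall t y,
  Normc.normc (f (xi y) * memory t y) <= D * (1 + t ^+ 2) ^+ M * b y.
Proof.
have [C C0 hC] := memory_bound; have [[_ df] _] := VpreimageP; have [B hB] := df M.
have B0 : 0 <= B.
  by apply: le_trans (hB 0); rewrite mulr_ge0 ?normc_ge0// exprn_ge0// ltW// weight_gt0.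
exists (B * C); first exact: mulr_ge0.
move=> t y; rewrite Normc.normcM; have W0 : 0 < weight (xi y) ^+ M by rewrite exprn_gt0// weight_gt0.
have -> : Normc.normc (f (xi y)) * Normc.normc (memory t y) =
  (weight (xi y) ^+ M * Normc.normc (f (xi y))) * (Normc.normc (memory t y) * weight (xi y) ^- M).
  by move: W0; set w := weight _ ^+ M => W0; field; rewrite gt_eqF.
have -> : B * C * (1 + t ^+ 2) ^+ M * b y = B * (C * (1 + t ^+ 2) ^+ M * b y) by ring.
apply: ler_pM.
- by rewrite mulr_ge0 ?normc_ge0// ltW.
- by rewrite mulr_ge0 ?normc_ge0 ?weightV_ge0.
- exact: hB.
- exact: hC.
Qed.

Let cmeas_f : cmeas f. Proof. by apply: ccontinuous_cmeas; have [[]] := VpreimageP. Qed.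
Let mf : cmeas (fun y => f (xi y)). Proof. exact: (cmeas_comp measurable_xi cmeas_f). Qed.

Lemma near_weight_bound (t0 : R) : \forall t \near t0, (1 + t ^+ 2) ^+ M <= (1 + (`|t0| + 1) ^+ 2) ^+ M.
Proof.
have : \forall t \near t0, ball t0 1 t by exact: nbhsx_ballx.
apply: filterS => t; rewrite /ball/= => h.
have ht : `|t| <= `|t0| + 1.
  have -> : t = t0 - (t0 - t) by ring.
  by apply: le_trans (ler_normB _ _) _; rewrite lerD2l ltW.
rewrite lerXn2r ?nnegrE ?addr_ge0 ?sqr_ge0// lerD2l -(real_normK (num_real t)).
by rewrite lerXn2r ?nnegrE ?addr_ge0.
Qed.

Lemma cint_memory_cvg (F : set_system R) (t0 : R) (l : Z -> R[i]) : Filter F ->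
  countably_based F -> (forall A, nbhs t0 A -> F A) -> cmeas l ->
  (forall y, (half_exp (g (xi y)) (t - tau y) : R[i]^o) @[t --> F] --> (l y : R[i]^o)) ->
  (cint Q (fun y => f (xi y) * memory t y) : R[i]^o) @[t --> F] -->
  (cint Q (fun y => f (xi y) * (l y * v y)) : R[i]^o).
Proof.
move=> FF cF nF ml hl; have [D D0 hD] := test_memory_bound.
pose c := D * (1 + (`|t0| + 1) ^+ 2) ^+ M.
apply: (@cint_cvg _ _ _ Q _ F (fun t y => f (xi y) * memory t y) _ (fun y => c * b y) FF cF).
- by move=> t; apply: cmeasM => //; exact: cmeas_memory.
- by do 2 apply: cmeasM => //.
- exact: rintegrableZ.
(* Domination needs a bound independent of t; it holds for t within distance 1 of [t0]. *)
- apply: nF; apply: filterS (near_weight_bound t0) => t ht y; apply: le_trans (hD t y) _.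
  by rewrite /c ler_wpM2r ?mulr_ge0 ?normc_ge0 ?weightV_ge0// ler_wpM2l.
- move=> y.
  apply: (@cvgM _ _ F _ (cst (f (xi y) : R[i]^o)) (fun t => memory t y : R[i]^o)); first exact: cvg_cst.
  by apply: (@cvgM _ _ F _ (fun t => half_exp (g (xi y)) (t - tau y) : R[i]^o) (cst (v y : R[i]^o))); [exact: hl|exact: cvg_cst].
Qed.

Definition trace (t : R) : R[i] := cint Q (fun y => f (xi y) * memory t y).

Lemma cadlag_trace : cadlag trace.
Proof.
have mg : cmeas (fun y => g (xi y)).
  by apply: (cmeas_comp (h := xi)); [exact: measurable_xi|exact: ccontinuous_cmeas].
move=> t0; rewrite /trace; split.
  apply: (cint_memory_cvg (t0 := t0) (l := fun y => half_exp (g (xi y)) (t0 - tau y))).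
  - by apply: countably_based_within; exact: countably_based_nbhs.
  - by move=> A; rewrite /at_right /within /=; apply: filterS => x Ax _.
  - apply: cmeas_half_exp => //.
    by apply: measurable_funB; [exact: measurable_cst|exact: measurable_tau].
  - by move=> y; exact: half_exp_right.
(* The left limit at [t0] omits the mass sitting exactly at tau = t0; this is the possible jump of
   the solution. *)
exists (cint Q (fun y => f (xi y) * ((if y \in tau @^-1` `]-oo, t0[ then cexp ((t0 - tau y)%:C * - g (xi y)) else 0) * v y))).
apply: (cint_memory_cvg (t0 := t0)).
- by apply: countably_based_within; exact: countably_based_nbhs.
- by move=> A; rewrite /at_left /within /=; apply: filterS => x Ax _.
- apply: cmeas_if; first by rewrite -[X in measurable X]setTI; apply: measurable_tau => //; exact: measurable_itv.
  apply: cmeas_cexp; apply: cmeasM.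
    by apply: cmeas_real; apply: measurable_funB; [exact: measurable_cst|exact: measurable_tau].
  have h1 : cmeas (fun _ : Z => (-1 : R[i])) by exact: cmeas_cst.
  by have := cmeasM h1 mg; congr cmeas; apply/funext => x; rewrite mulN1r.
- move=> y; have := @half_exp_left R (g (xi y)) (tau y) t0.
  have -> // : (y \in tau @^-1` `]-oo, t0[) = (tau y < t0).
  by apply/idP/idP; rewrite inE /= in_itv.
Qed.

(** Of the M + 1 powers of 1 + t^2, [M] offset the polynomial growth of the slices and one gives
    integrability in t. *)
Lemma trace_integrable (w : R -> R[i]) B : cmeas (w : measurableTypeR R -> R[i]) ->
  (forall t, (1 + t ^+ 2) ^+ M.+1 * Normc.normc (w t) <= B) ->
  cintegrable (leb1 \x Q)%E (fun p => w p.1 * (f (xi p.2) * memory p.1 p.2)).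
Proof.
move=> mw hw; have [D D0 hD] := test_memory_bound.
apply: (cintegrable_le (rintegrable_prod (rintegrableZ (D * B) (@rintegrable_oneDsqrV R)) iv)).
  apply: cmeasM; first exact: (cmeas_comp measurable_fst mw).
  by apply: cmeasM; [exact: (cmeas_comp measurable_snd mf)|exact: cmeas_memory_prod].
move=> [t y]; rewrite Normc.normcM /=; have t0 := one_add_sqr_gt0 t.
apply: le_trans (ler_wpM2l (normc_ge0 _) (hD t y)) _.
have -> : Normc.normc (w t) * (D * (1 + t ^+ 2) ^+ M * b y) =
    (D * ((1 + t ^+ 2) ^+ M * Normc.normc (w t))) * b y by ring.
rewrite ler_wpM2r ?mulr_ge0 ?normc_ge0 ?weightV_ge0// -mulrA ler_wpM2l//.
by rewrite ler_pdivlMr// mulrAC -exprSr.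
Qed.

Lemma cintegrable_test_memory t : cintegrable Q (fun y => f (xi y) * memory t y).
Proof. by have [] := presentation_CFD (presentation_marginal t) VpreimageP.1. Qed.

Lemma slow_growing_trace : slow_growing (density_measure trace).
Proof.
pose w (t : R) : R[i] := (((1 + t ^+ 2) ^+ M.+1)^-1)%:C.
have w0 (t : R) : 0 < (1 + t ^+ 2) ^+ M.+1 by rewrite exprn_gt0// one_add_sqr_gt0.
have mp : measurable_fun setT (fun t : R => (1 + t ^+ 2) ^+ M.+1).
  by apply: measurable_funX; apply: measurable_funD => //; exact: measurable_funX.
have mV : measurable_fun setT (fun t : R => ((1 + t ^+ 2) ^+ M.+1)^-1).
  have := measurableT_comp (@measurable_weightV R 1 M.+1) (@measurable_const_mx R 1 _ _ (fun t : R => t) (@measurable_id _ _ setT)).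
  congr (measurable_fun setT _); apply/funext => t /=.
  by rewrite /weight /dotv big_ord1 mxE expr2.
have iw : cintegrable leb1 (fun t => w t * trace t).
  have hw t : (1 + t ^+ 2) ^+ M.+1 * Normc.normc (w t) <= 1.
    by rewrite normc_real ger0_norm ?invr_ge0 ?(ltW (w0 t))// mulfV// gt_eqF.
  have [i1 _] := cint_fubini1 (trace_integrable (cmeas_real mV) hw).
  move: i1; congr (cintegrable leb1 _); apply/funext => t /=.
  by rewrite cintZ//; exact: cintegrable_test_memory.
apply: (@presentation_slow_growing R 1 _ _ leb1 (fun t : R => const_mx t) trace M.+1); split=> //.
- exact: measurable_const_mx.
(* Fubini's theorem makes [w] times the trace measurable; multiplying by the inverse of [w] recovers
   the trace. *)
- have := cmeasM (cmeas_real mp) (cintegrable_cmeas iw); congr cmeas; apply/funext => t.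
  by rewrite mulrA /w -rmorphM mulfV ?mul1r// gt_eqF.
- have := rintegrable_normc iw; congr (rintegrable leb1 _); apply/funext => t.
  rewrite Normc.normcM normc_real ger0_norm ?invr_ge0 ?(ltW (w0 t))// mulrC.
  by rewrite /weight /dotv big_ord1 mxE expr2.
Qed.

(** The disintegration along t: for each point of [Z], the substitution t = tau + s turns the
    relaxed density in s into the memory at time t, and Fubini's theorem exchanges the two
    integrals. *)
Lemma trace_pairing theta : CFD (fun s : 'rV[R]_1 => theta (s ord0 ord0)) ->
  cintegrable (Q \x leb1)%E (fun p => tensor f theta (drift rho p) * relaxed g rho v p) ->
  cint (Q \x leb1)%E (fun p => tensor f theta (drift rho p) * relaxed g rho v p) =
  cint leb1 (fun t => trace t * theta t).
Proof.
move=> ct iR.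
have mth : cmeas (theta : measurableTypeR R -> R[i]).
  have := cmeas_comp (@measurable_const_mx R 1 _ _ (fun t : R => t) (@measurable_id _ _ setT)) (ccontinuous_cmeas ct.1).
  by congr cmeas; apply/funext => t; rewrite mxE.
have dth N : exists B, forall t : R, (1 + t ^+ 2) ^+ N * Normc.normc (theta t) <= B.
  have [B hB] := ct.2 N; exists B => t; have := hB (const_mx t).
  by rewrite /weight /dotv big_ord1 !mxE expr2.
have [B hB] := dth M.+1; have [B' hB'] := dth 1%N.
have ith : cintegrable leb1 theta.
  by apply: (@cintegrable_decay2 _ _ B') => // t; have := hB' t; rewrite expr1.
have iK := trace_integrable mth hB.
transitivity (cint (leb1 \x Q)%E (fun p => theta p.1 * (f (xi p.2) * memory p.1 p.2))); last first.
  have [_ ->] := cint_fubini1 iK; apply: eq_cint => t /=.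
  by rewrite cintZ 1?mulrC//; exact: cintegrable_test_memory.
have [_ ->] := cint_fubini2 iK; have [_ ->] := cint_fubini1 iR; apply: eq_cint => y /=.
pose F s := (f (xi y) * theta (tau y + s)) * (half_exp (g (xi y)) s * v y).
have e1 : (fun s => tensor f theta (drift rho (y, s)) * relaxed g rho v (y, s)) = F.
  apply/funext => s; rewrite /tensor /drift /relaxed /= tshift_setc lsubmx_setc last_coord_setc.
  by rewrite -last_coordE.
(* The integrands in t and in s differ by the translation by - tau, under which Lebesgue measure is
   invariant. *)
have e2' : (fun t => theta t * (f (xi y) * memory t y)) = (fun t => F (t + - tau y)).
  apply/funext => t; rewrite /F /memory (addrC (tau y)) subrK.
  by move: (theta t) (f _) (half_exp _ _) (v y) => p q r s; ring.
rewrite e1 e2' cint_translation//.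
- apply: cmeasM; first apply: cmeasM.
  + exact: cmeas_cst.
  + by apply: (cmeas_comp (h := fun s : R => tau y + s)) => //; exact: measurable_funD.
  + apply: cmeasM; last exact: cmeas_cst.
    by apply: cmeas_half_exp; [exact: cmeas_cst|exact: measurable_id].
- rewrite -e2'; apply: (cintegrable_le (rintegrableZ (Normc.normc (f (xi y) * v y)) (rintegrable_normc ith))).
    apply: cmeasM => //; apply: cmeasM; first exact: cmeas_cst.
    apply: cmeasM; last exact: cmeas_cst.
    apply: cmeas_half_exp; first exact: cmeas_cst.
    by apply: measurable_funB; [exact: measurable_id|exact: measurable_cst].
  move=> t; rewrite /memory !Normc.normcM.
  have h1 : Normc.normc (half_exp (g (xi y)) (t - tau y)) <= 1 := half_exp_le1 _ hkappa (hgR _).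
  rewrite [X in X <= _]mulrC ler_wpM2r ?normc_ge0// mulrCA.
  by rewrite mulrA ler_wpM2r ?normc_ge0// ler_piMl ?normc_ge0.
Qed.

End test_function.

End cadlag_representation.

Theorem proposition3p6 (R : realType) (d : nat) (hd : (1 <= d)%N)
    (g : 'rV[R]_d -> R[i]) (kappa : R) (X : @dist R (d + 1)%N)
    (hg : symbol_function g) (hgc : ccontinuous g)
    (hkappa : 0 < kappa) (hgR : forall xi, kappa <= complex.Re (g xi))
    (hXV : Vdual X) (hXVC : VCdual X) :
  [/\ Vdual (Uinfty g X) /\ VCdual (Uinfty g X),
      eq_dist (evolution_operator g (Uinfty g X)) X,
      (forall U : @dist R (d + 1)%N, Vdual U ->
         eq_dist (evolution_operator g U) X -> eq_dist U (Uinfty g X)) &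
      has_cadlag_in_time_representation (Uinfty g X)].
Proof.
have [smu _] := fourier_measureP hXV; have [P [N pmu]] := slow_growing_presentation smu.
have [snu _] := sfourier_measureP hXVC; have [Q [M pnu]] := slow_growing_presentation snu.
have VU := Vdual_Uinfty hgc hkappa hgR hXV.
have VCU := VCdual_Uinfty hgc hkappa hgR hXV hXVC pmu pnu.
split; [by []|exact: (Uinfty_solution hg hgc hkappa hgR hXV)|exact: (Uinfty_unique hg hgc hkappa hgR hXV)|].
have [mrho mv iv _] := pnu.
exists (time_slice g Q (fun y => y.1.1) jordan_weight); split.
  by move=> t; exact: (Vdual_time_slice hgc hkappa hgR mrho mv iv).
move=> phi hphi; have [cf fphi] := VpreimageP hphi.
have -> : (fun t => Vpairing (time_slice g Q (fun y => y.1.1) jordan_weight t) phi) =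
    trace g Q (fun y => y.1.1) jordan_weight phi.
  by apply/funext => t; exact: (Vpairing_time_slice hgc hkappa hgR mrho mv iv hphi).
have rhoP := Uinfty_sfourier hgc hkappa hgR hXV hXVC pmu pnu.
(* The measure chosen in [VCpairing] agrees with [spatial_solution] on bounded sets, so it has the
   same presentation. *)
have prho := presentation_transfer (presentation_spatial_solution hgc hkappa hgR pnu)
  (sfourier_measure_unique (sfourier_measureP VCU) rhoP).
split.
- exact: (cadlag_trace hgc hkappa hgR mrho mv iv hphi).
- exact: (slow_growing_trace hgc hkappa hgR mrho mv iv hphi).
- move=> theta ct; have cT := CFD_tensor cf ct.
  have sT : sfourier (tensor (Vpreimage phi) theta) = tensor phi theta.
    by rewrite sfourier_tensor// fphi.
  have [cV sV] : CFD (VCpreimage (tensor phi theta)) /\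
      sfourier (VCpreimage (tensor phi theta)) = tensor phi theta.
    exact: (@xgetPex _ _ [set f | CFD f /\ sfourier f = tensor phi theta] (ex_intro _ _ (conj cT sT))).
  (* The space transform leaves the time factor alone, and injectivity identifies the chosen
     preimage with the tensor product. *)
  have preE : VCpreimage (tensor phi theta) = tensor (Vpreimage phi) theta.
    by apply: sfourier_inj => //; rewrite sT.
  have [iT eT] := presentation_CFD prho cT.
  rewrite /VCpairing preE eT (trace_pairing hgc hkappa hgR mrho mv iv hphi ct iT).
  apply: eq_cint => t; congr (_ * _).
  exact: esym (Vpairing_time_slice hgc hkappa hgR mrho mv iv hphi t).
Qed.
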